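(* Consider the model and standardized statistic $\widetilde W_N$ described in the context, under the null hypothesis $\mathcal H_0(\boldsymbol T):\boldsymbol T\boldsymbol\mu=\mathbf 0$, along a sequence of designs following one of the asymptotic frameworks (I)–(V). Let $\beta_s=\lambda_s/\sqrt{\sum_{\ell=1}^{ad}\lambda_\ell^2}$ for $s=1,\dots,ad$ (and $\beta_s:=0$ for $s>ad$). Let $(C_s)_{s\ge1}$ be i.i.d. $\chi^2_1$ random variables and $Z\sim\mathcal N(0,1)$ independent of them. (a) Let $(b_s)_{s\ge1}$ be a non-increasing sequence in $[0,1]$ such that $r:=\#\{s:b_s\neq0\}$ is finite and $\sum_{s=1}^r b_s^2\le 1$. Then $\widetilde W_N$ converges in distribution to $\sum_{s=1}^r b_s\,(C_s-1)/\sqrt2+\sqrt{1-\sum_{s=1}^r b_s^2}\cdot Z$ if and only if $\beta_s\to b_s$ for every $s\in\mathbb N$ as $N\to\infty$. (b) If there is a non-increasing sequence $(b_s)_{s\ge1}$ in $(0,1)$ with $\sum_{s=1}^\infty b_s^2=1$ such that $\beta_s\to b_s$ for every $s\in\mathbb N$ as $N\to\infty$, then $\widetilde W_N$ converges in distribution to $\sum_{s=1}^\infty b_s\,(C_s-1)/\sqrt2$.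
   Context: Model: there are $a$ independent groups; for $i=1,\dots,a$ and $j=1,\dots,n_i$ the observations $\boldsymbol X_{i,j}\in\mathbb R^d$ are independent with $\boldsymbol X_{i,j}\sim\mathcal N_d(\boldsymbol\mu_i,\boldsymbol\Sigma)$, where $\boldsymbol\Sigma$ is a common positive definite $d\times d$ matrix. $N=\sum_{i=1}^a n_i$, $n_{\max}=\max_i n_i$, $\boldsymbol\mu=(\boldsymbol\mu_1^\top,\dots,\boldsymbol\mu_a^\top)^\top$. The hypothesis matrix is $\boldsymbol T=\boldsymbol T_W\otimes\boldsymbol T_S$ with $\boldsymbol T_W$ an $a\times a$ and $\boldsymbol T_S$ a $d\times d$ symmetric idempotent (orthogonal projection) matrix, both nonzero. Group means $\overline{\boldsymbol X}_i=n_i^{-1}\sum_{j}\boldsymbol X_{i,j}$, $\overline{\boldsymbol X}=(\overline{\boldsymbol X}_1^\top,\dots,\overline{\boldsymbol X}_a^\top)^\top$, and $Q_N=N\,\overline{\boldsymbol X}^\top\boldsymbol T\overline{\boldsymbol X}$. Under $\mathcal H_0$, $E(Q_N)=\operatorname{tr}(\boldsymbol T_S\boldsymbol\Sigma)\sum_{i=1}^a\frac{N}{n_i}(\boldsymbol T_W)_{ii}$ and $\operatorname{Var}(Q_N)=2\operatorname{tr}((\boldsymbol T_S\boldsymbol\Sigma)^2)\sum_{i,r=1}^a\frac{N^2}{n_in_r}(\boldsymbol T_W)_{ir}^2$, and $\widetilde W_N=(Q_N-E_{\mathcal H_0}(Q_N))/\sqrt{\operatorname{Var}_{\mathcal H_0}(Q_N)}$.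 $\boldsymbol V_N=\bigoplus_{i=1}^a\frac{N}{n_i}\boldsymbol\Sigma$ (block diagonal) and $\lambda_1\ge\lambda_2\ge\dots\ge\lambda_{ad}$ are the eigenvalues of $\boldsymbol T\boldsymbol V_N\boldsymbol T$. Asymptotic frameworks: all of $a,d,n_1,\dots,n_a,\boldsymbol\Sigma,\boldsymbol\mu,\boldsymbol T_W,\boldsymbol T_S$ may depend on an index along which $N\to\infty$, and one of the following holds (quantities not listed stay bounded): (I) $a\to\infty$; (II) $a,d\to\infty$; (III) $a,n_{\max}\to\infty$; (IV) $d,n_{\max}\to\infty$; (V) $a,d,n_{\max}\to\infty$. No condition on ratios $n_i/N$ is assumed. *)

(* Defs.v *)
From HB Require Import structures.
From mathcomp Require Import all_boot all_order all_algebra.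
From mathcomp Require Import mxtens.
From mathcomp Require Import all_classical all_reals all_analysis.

Set Implicit Arguments.
Unset Strict Implicit.
Unset Printing Implicit Defensive.

Import Order.TTheory GRing.Theory Num.Theory.
Import numFieldNormedType.Exports.

Local Open Scope classical_set_scope.
Local Open Scope ring_scope.

Section prob_defs.
Context {dsp : measure_display} {T : measurableType dsp} {R : realType}.
Variable P : probability T R.

Definition random_vector (m : nat) (X : T -> 'rV[R]_m) :=
  forall l : 'I_m, measurable_fun setT (fun w => X w 0 l).

(* Mutual independence of a family of random vectors in R^m: the product
   rule holds for every finite subfamily and every choice of Borel
   rectangles B i = B i 0 x ... x B i (m-1) (a pi-system generating the
   Borel sigma-algebra of R^m). *)
Definition mutually_independent (I : eqType) (m : nat) (X : I -> T -> 'rV[R]_m) :=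
  forall (J : seq I) (B : I -> 'I_m -> set R),
    uniq J -> (forall i l, measurable (B i l)) ->
    fine (P (\big[setI/setT]_(i <- J) [set w | forall l, B i l (X i w 0 l)]))
    = \prod_(i <- J) fine (P [set w | forall l, B i l (X i w 0 l)]).

(* Y ~ N(m, s^2) (s = standard deviation > 0). *)
Definition normal_law (Y : T -> R) (m s : R) :=
  forall A : set R, measurable A -> P (Y @^-1` A) = normal_prob m s A.

(* X ~ N_m(mu, S), via the Cramer-Wold characterisation: every non-trivial
   linear combination v X^T is N(v mu^T, v S v^T). *)
Definition mv_normal_law (m : nat) (X : T -> 'rV[R]_m) (mu : 'rV[R]_m)
    (S : 'M[R]_m) :=
  forall v : 'rV[R]_m, v != 0 ->
    normal_law (fun w => (X w *m v^T) 0 0) ((mu *m v^T) 0 0)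
               (Num.sqrt ((v *m S *m v^T) 0 0)).

End prob_defs.

Definition cvg_in_distribution {R : realType} {dsp dsp' : measure_display}
    (Omega : nat -> measurableType dsp) (P : forall k, probability (Omega k) R)
    (W : forall k, Omega k -> R)
    (Omega' : measurableType dsp') (P' : probability Omega' R) (L : Omega' -> R) :=
  forall f : R -> R, continuous f -> (exists M : R, forall x, `|f x| <= M) ->
    ((fun k => 'E_(P k)[f \o W k]) @ \oo --> 'E_P'[f \o L])%E.

Definition nat_bounded (u : nat -> nat) := exists M, forall k, (u k <= M)%N.
Definition nat_diverges (u : nat -> nat) :=
  forall M, exists k0, forall k, (k0 <= k)%N -> (M <= u k)%N.

Record design (R : realType) := Design {
  a : nat;                          (* number of groups *)
  dimd : nat;
  nsz : 'I_a -> nat;                (* group sizes n_i *)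
  Sigma : 'M[R]_dimd;
  mu : 'M[R]_(a, dimd);              (* row i = mu_i^T *)
  TW : 'M[R]_a;
  TS : 'M[R]_dimd
}.
Arguments a {R} d.
Arguments dimd {R} d.
Arguments nsz {R} d i.
Arguments Sigma {R} d.
Arguments mu {R} d.
Arguments TW {R} d.
Arguments TS {R} d.

Section design_defs.
Context {R : realType} (D : design R).

Definition Ntot : nat := \sum_(i < a D) nsz D i.
Definition nmax : nat := \max_(i < a D) nsz D i.

Definition orth_proj_mx (m : nat) (A : 'M[R]_m) := A^T = A /\ A *m A = A.
Definition posdef_mx (m : nat) (A : 'M[R]_m) :=
  A^T = A /\ forall v : 'rV[R]_m, v != 0 -> 0 < (v *m A *m v^T) 0 0.

(* stacking the rows of an (a x d) matrix into a column vector of R^(ad),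
   consistently with the Kronecker product *t of mxtens *)
Definition stack (M : 'M[R]_(a D, dimd D)) : 'cV[R]_(a D * dimd D) :=
  \col_k M (mxtens_unindex k).1 (mxtens_unindex k).2.

Definition Tmx : 'M[R]_(a D * dimd D) := TW D *t TS D.

(* V_N = (+)_i (N/n_i) Sigma *)
Definition VN : 'M[R]_(a D * dimd D) :=
  diag_mx (\row_i ((Ntot%:R) / (nsz D i)%:R)) *t Sigma D.

Definition TVT : 'M[R]_(a D * dimd D) := Tmx *m VN *m Tmx.

Definition H0 := Tmx *m stack (mu D) = 0.

Definition EQ0 : R :=
  \tr (TS D *m Sigma D) *
  \sum_(i < a D) (Ntot%:R / (nsz D i)%:R) * TW D i i.

Definition VarQ0 : R :=
  2 * \tr ((TS D *m Sigma D) ^+ 2) *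
  \sum_(i < a D) \sum_(r < a D)
     ((Ntot ^ 2)%:R / ((nsz D i)%:R * (nsz D r)%:R)) * TW D i r ^+ 2.

Section stat.
Context {dsp : measure_display} {T : measurableType dsp}.
Variable X : forall i : 'I_(a D), 'I_(nsz D i) -> T -> 'rV[R]_(dimd D).

Definition Xbar (w : T) : 'M[R]_(a D, dimd D) :=
  \matrix_(i, l) ((nsz D i)%:R^-1 * \sum_(j < nsz D i) X j w 0 l).

Definition QN (w : T) : R :=
  Ntot%:R * ((stack (Xbar w))^T *m Tmx *m stack (Xbar w)) 0 0.

Definition Wtilde (w : T) : R := (QN w - EQ0) / Num.sqrt VarQ0.
End stat.

End design_defs.

(* beta_s (0-based: beta k s corresponds to beta_{s+1} of the paper) *)
Definition beta {R : realType} (ad : nat) (lam : nat -> R) (s : nat) : R :=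
  if (s < ad)%N then lam s / Num.sqrt (\sum_(t < ad) lam t ^+ 2) else 0.

(* Main.v *)
Require Import Defs.
From HB Require Import structures.
From mathcomp Require Import all_boot all_order all_algebra.
From mathcomp Require Import mxtens ring lra.
From mathcomp Require Import all_classical all_reals all_analysis.
From mathcomp Require Import measurable_realfun.

Import Order.TTheory GRing.Theory Num.Theory.
Import numFieldNormedType.Exports.
Local Open Scope classical_set_scope.
Local Open Scope ring_scope.

Set Implicit Arguments.
Unset Strict Implicit.
Unset Printing Implicit Defensive.

(** If G is a centred Gaussian vector with covariance eigenvalues lambda_s and Y is
    an independent standard Gaussian vector, then exp (- t |G|^2) is the conditional
    expectation of cos (sqrt (2 t) <G, Y>); exchanging the two expectations gives
    the Laplace transform of sum_s lambda_s Y_s^2.  Hence Wtilde has the law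
    of S = sum_s beta_s xi_s with xi_s = (Y_s^2 - 1) / sqrt 2, and only the
    spectrum beta matters, whatever the asymptotic framework.

    If beta_s -> b_s, the terms of S of index at least m have weights at most
    beta_m, so Lindeberg's replacement in E cos (t S + u) costs
    O (beta_m) and turns them into one Gaussian term of variance
    1 - sum_{s<m} beta_s^2; together with the bounded second moment this gives
    convergence in law.

    Conversely, convergence in law passes to E exp (- t S) because
    E exp (- 2 t S) is bounded.  The logarithm of this Laplace transform is, up to
    t^2 / 2, half of sum_s log_rem (sqrt 2 t beta_s), whose Taylor expansion yields
    the convergence of all power sums of beta of order at least 3, and
    these determine the limits of beta_0, beta_1, and so on successively. *)

(** Everything stays real. A law is tested on the family [cos (t * x + u)], whose free phase also
    yields the sine, so the family carries the same information as the characteristic function. The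
    converse uses Laplace transforms because they are positive and have a real logarithm.

    The statistics live on a space that changes with [k]. Equality of laws moves all of them to the
    one space that carries [Y] and [Z]; there the sums for different [k] share their variables and
    can be compared pointwise.

    The difficulty is that pointwise convergence of the weights does not keep the mass
    [sum_s beta_s ^+ 2 = 1]: part of it may spread over many vanishing weights. The escaping mass
    becomes the variance of the Gaussian term. This is why the power sum of order two carries no
    information on the limit, whereas those of order at least three are insensitive to small
    weights. In the logarithm of the Laplace transform the retained and the escaped mass contribute
    [t ^+ 2 / 2] together, however they are split, so this term cancels between the sequence and its
    limit. *)

Local Notation L1 P f := (P.-integrable setT (EFin \o f)).

(** * Taylor bounds for the trigonometric and exponential functions *)

Section taylor_bounds.
Context (R : realType).
Implicit Types (f : R -> R) (x : R).

(** The mean value theorem replaces integration, so the factor [1 / k.+1] is not gained; hence the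
    constants [1] in the bounds that follow. *)
Lemma derive_bound_ge0 f f' (C : R) k :
  (forall y : R, 0 <= y -> is_derive y (1 : R) f (f' y)) -> f 0 = 0 ->
  (forall y, 0 <= y -> `|f' y| <= C * y ^+ k) ->
  forall x, 0 <= x -> `|f x| <= C * x ^+ k.+1.
Proof.
move=> df f0 fC x x0.
have C0 : 0 <= C by have := fC 1 ler01; rewrite expr1n mulr1; exact: le_trans.
have [||c + fE] := @MVT_segment R f f' 0 x x0.
- by move=> y; rewrite in_itv/= => /andP[y0 _]; exact/df/ltW.
- apply: derivable_within_continuous => y; rewrite in_itv/= => /andP[y0 _].
  by have [] := df y y0.
rewrite in_itv/= => /andP[c0 cx].
move: fE; rewrite f0 !subr0 => ->; rewrite normrM (ger0_norm x0) exprSr mulrA.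
by rewrite ler_wpM2r// (le_trans (fC c c0))// ler_wpM2l// lerXn2r.
Qed.

Lemma derive_bound f f' (C : R) k :
  (forall y : R, is_derive y (1 : R) f (f' y)) -> f 0 = 0 ->
  (forall y, `|f' y| <= C * `|y| ^+ k) ->
  forall x, `|f x| <= C * `|x| ^+ k.+1.
Proof.
move=> df f0 fC x; have [x0|x0] := leP 0 x.
  rewrite (ger0_norm x0); apply: (@derive_bound_ge0 f f') => // y y0.
  by have := fC y; rewrite (ger0_norm y0).
have -> : f x = (f \o -%R) (- x) by rewrite /= opprK.
rewrite (ltr0_norm x0).
apply: (@derive_bound_ge0 (f \o -%R) (fun z => - f' (- z))) => //=.
- move=> y _; have dfy := df (- y).
  apply: is_derive_eq.
  by rewrite /GRing.scale/= mulrN mulr1.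
- by rewrite oppr0.
- by move=> y y0; have := fC (- y); rewrite !normrN (ger0_norm y0).
- by rewrite oppr_ge0 ltW.
Qed.

Lemma sin_lip (x y : R) : `|sin (x + y) - sin x| <= `|y|.
Proof.
rewrite -[leRHS]mul1r -(expr1 `|y|).
apply: (@derive_bound (fun z => sin (x + z) - sin x) (fun z => cos (x + z))).
- by move=> z; apply: is_derive_eq; rewrite /GRing.scale/=; ring.
- by rewrite addr0 subrr.
- by move=> z; rewrite mulr1; exact: cos_max.
Qed.

Lemma cos_taylor1 (x y : R) : `|cos (x + y) - cos x + y * sin x| <= `|y| ^+ 2.
Proof.
rewrite -[leRHS]mul1r.
apply: (@derive_bound (fun z => cos (x + z) - cos x + z * sin x)
  (fun z => - (sin (x + z) - sin x))).
- by move=> z; apply: is_derive_eq; rewrite /GRing.scale/=; ring.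
- by rewrite addr0 subrr mul0r addr0.
- by move=> z; rewrite normrN mul1r expr1; exact: sin_lip.
Qed.

Lemma cos_lip (x y : R) : `|cos (x + y) - cos x| <= `|y|.
Proof.
rewrite -[leRHS]mul1r -(expr1 `|y|).
apply: (@derive_bound (fun z => cos (x + z) - cos x) (fun z => - sin (x + z))).
- by move=> z; apply: is_derive_eq; rewrite /GRing.scale/=; ring.
- by rewrite addr0 subrr.
- by move=> z; rewrite mulr1 normrN; exact: sin_max.
Qed.

Lemma sin_taylor1 (x : R) : `|sin x - x| <= `|x| ^+ 2.
Proof.
rewrite -[leRHS]mul1r.
apply: (@derive_bound (fun z => sin z - z) (fun z => cos z - 1)).
- by rewrite sin0 subrr.
- by move=> z; rewrite mul1r expr1; have := cos_lip 0 z; rewrite add0r cos0.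
Qed.

Lemma cos_taylor2 (x : R) : `|cos x - 1 + x ^+ 2 / 2| <= `|x| ^+ 3.
Proof.
rewrite -[leRHS]mul1r.
apply: (@derive_bound (fun z => cos z - 1 + z ^+ 2 / 2) (fun z => - (sin z - z))).
- by move=> z; apply: is_derive_eq; rewrite /GRing.scale/=; field.
- by rewrite cos0 subrr expr0n mul0r addr0.
- by move=> z; rewrite normrN mul1r; exact: sin_taylor1.
Qed.

Lemma sin_taylor2 (x : R) : `|sin x - x| <= `|x| ^+ 3.
Proof.
rewrite -[leRHS]mul1r.
apply: (@derive_bound (fun z => sin z - z) (fun z => cos z - 1)).
- by rewrite sin0 subrr.
- move=> z; rewrite mul1r; have := cos_taylor1 0 z.
  by rewrite add0r cos0 sin0 mulr0 addr0.
Qed.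

Lemma expR_taylor1 (x : R) : 0 <= x -> `|expR (- x) - 1 + x| <= x ^+ 2.
Proof.
move=> x0; rewrite -[leRHS]mul1r.
apply: (@derive_bound_ge0 (fun z => expR (- z) - 1 + z) (fun z => 1 - expR (- z))) => //.
- by move=> z _; apply: is_derive_eq; rewrite /GRing.scale/=; ring.
- by rewrite oppr0 expR0 subrr addr0.
- move=> z z0; rewrite mul1r expr1 ger0_norm.
    by rewrite lerBlDr -lerBlDl; have := expR_ge1Dx (- z); lra.
  by rewrite subr_ge0 -expR0 ler_expR oppr_le0.
Qed.

End taylor_bounds.

(** * Real-valued expectations *)

Section expectation.
Context d (T : measurableType d) (R : realType) (P : probability T R).
Implicit Types f g : T -> R.

Lemma bounded_integrable f (M : R) :
  measurable_fun setT f -> (forall w, `|f w| <= M) -> L1 P f.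
Proof.
move=> mf fM; apply: measurable_bounded_integrable => //.
  by apply: le_lt_trans (probability_le1 P measurableT) _; rewrite ltry.
exists M; split; first exact: num_real.
by move=> x Mx w _ /=; rewrite (le_trans (fM w))// ltW.
Qed.

Lemma dominated_integrableR f g :
  measurable_fun setT f -> (forall w, `|f w| <= g w) -> L1 P g -> L1 P f.
Proof.
move=> mf fg ig; apply: le_integrable ig => //; first exact/measurable_EFinP.
by move=> w _ /=; rewrite lee_fin (le_trans (fg w)) // ler_norm.
Qed.

Lemma integrable_measurable f : L1 P f -> measurable_fun setT f.
Proof. by move=> /(@measurable_int _ _ _ _ _ _)/measurable_EFinP. Qed.

Lemma integrableRD f g : L1 P f -> L1 P g -> L1 P (fun w => f w + g w).
Proof. by move=> If Ig; exact: (integrableD measurableT If Ig). Qed.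

Lemma integrableRB f g : L1 P f -> L1 P g -> L1 P (fun w => f w - g w).
Proof. by move=> If Ig; exact: (integrableB measurableT If Ig). Qed.

Lemma integrableRZ f c : L1 P f -> L1 P (fun w => c * f w).
Proof. by move=> If; exact: (integrableZl measurableT c If). Qed.

Lemma integrableR_cst c : L1 P (fun=> c).
Proof. exact: (@bounded_integrable _ `|c|). Qed.

Lemma integrableR_sum I (s : seq I) (F : I -> T -> R) :
  (forall i, L1 P (F i)) -> L1 P (fun w => \sum_(i <- s) F i w).
Proof.
move=> IF; elim: s => [|i s IHs].
  by under eq_fun do rewrite big_nil; exact: integrableR_cst.
by under eq_fun do rewrite big_cons; exact: integrableRD.
Qed.

Lemma Rintegral_prob_cst c : \int[P]_w c = c.
Proof.
rewrite Rintegral_cst// -[RHS]mulr1; congr (_ * _).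
exact: (congr1 fine (probability_setT P)).
Qed.

Lemma Rintegral_sum I (s : seq I) (F : I -> T -> R) :
  (forall i, L1 P (F i)) ->
  \int[P]_w (\sum_(i <- s) F i w) = \sum_(i <- s) \int[P]_w F i w.
Proof.
move=> IF; elim: s => [|i s IHs].
  by under eq_Rintegral do rewrite big_nil; rewrite big_nil Rintegral_prob_cst.
under eq_Rintegral do rewrite big_cons.
by rewrite RintegralD ?IHs ?big_cons//; exact: integrableR_sum.
Qed.

Lemma Rintegral_norm_le f g : measurable_fun setT f ->
  (forall w, `|f w| <= g w) -> L1 P g -> `|\int[P]_w f w| <= \int[P]_w g w.
Proof.
move=> mf fg ig; have If := dominated_integrableR mf fg ig.
apply: le_trans (le_normr_Rintegral measurableT If) _.
apply: le_Rintegral => //.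
apply: dominated_integrableR ig; first exact: measurableT_comp.
by move=> w; rewrite normr_id.
Qed.

Lemma Rintegral_dist_le f g h : L1 P f -> L1 P g ->
  (forall w, `|f w - g w| <= h w) -> L1 P h ->
  `|\int[P]_w f w - \int[P]_w g w| <= \int[P]_w h w.
Proof.
move=> If Ig fgh Ih; rewrite -RintegralB//; apply: Rintegral_norm_le => //.
exact/integrable_measurable/integrableRB.
Qed.

Lemma Rintegral_norm_le_cst f M : measurable_fun setT f ->
  (forall w, `|f w| <= M) -> `|\int[P]_w f w| <= M.
Proof.
move=> mf fM; rewrite -[leRHS]Rintegral_prob_cst.
by apply: Rintegral_norm_le => //; exact: integrableR_cst.
Qed.

Lemma expectation_Rintegral f : L1 P f -> ('E_P[f] = (\int[P]_w f w)%:E)%E.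
Proof. by move=> If; rewrite unlock fineK// integrable_fin_num. Qed.

Lemma Rintegral_dominated_cvg (f_ : nat -> T -> R) f g :
  (forall n, measurable_fun setT (f_ n)) -> measurable_fun setT f ->
  {ae P, forall w, (f_ n w) @[n --> \oo] --> f w} ->
  L1 P g -> (forall n w, `|f_ n w| <= g w) ->
  (\int[P]_w f_ n w) @[n --> \oo] --> \int[P]_w f w.
Proof.
move=> mf_ mf fcvg ig fg.
have If_ n : L1 P (f_ n) by exact: dominated_integrableR ig.
have If : {ae P, forall w, [set: T] w -> EFin (f_ n w) @[n --> \oo] --> EFin (f w)}.
  by apply: filterS fcvg => w fw _; apply: cvg_EFin => //; exact: nearW.
have fgE : {ae P, forall w n, [set: T] w -> (`|EFin (f_ n w)| <= EFin (g w))%E}.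
  by apply: nearW => w n _ /=; rewrite lee_fin.
have mE n : measurable_fun setT (EFin \o f_ n) by apply/measurable_EFinP.
have mE' : measurable_fun setT (EFin \o f) by apply/measurable_EFinP.
have [iff _ +] := dominated_convergence measurableT mE mE' If ig fgE.
rewrite -[X in _ --> X -> _]fineK; last exact: integrable_fin_num.
exact: fine_cvg.
Qed.

End expectation.

(** * Gaussian integrals *)

Section normal_density_integral.
Context (R : realType) (m s : R).
Hypothesis s_gt0 : 0 < s.
Local Notation mu := (@lebesgue_measure R).
Local Notation pdf := (normal_pdf m s).

(** The Radon-Nikodym derivative of [normal_prob] and [pdf] have the same integral over every
    measurable set, hence agree almost everywhere. *)
Lemma ge0_integral_normal_prob (f : R -> R) : measurable_fun setT f ->
  (forall x, 0 <= f x) ->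
  (\int[normal_prob m s]_x (f x)%:E = \int[mu]_x (f x * pdf x)%:E)%E.
Proof.
move=> mf f0; have dom := normal_prob_dominates m s.
rewrite -(Radon_Nikodym_SigmaFinite.change_of_variables dom)//=; last first.
  exact/measurable_EFinP.
have If := Radon_Nikodym_SigmaFinite.f_integrable dom.
apply: ae_eq_integral => //=.
- apply: emeasurable_funM; first exact/measurable_EFinP.
  exact: measurable_int If.
- by apply/measurable_EFinP; apply: measurable_funM => //; exact: measurable_normal_pdf.
- under [X in ae_eq _ _ _ X]eq_fun do rewrite EFinM.
  apply: ae_eqe_mul2l; apply: integral_ae_eq => //=.
  + by apply/measurable_EFinP; exact: measurable_normal_pdf.
  + by move=> E _ mE; rewrite -Radon_Nikodym_SigmaFinite.f_integral.
Qed.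

Context d (T : measurableType d) (P : probability T R) (Y : T -> R).
Hypotheses (mY : measurable_fun setT Y) (lawY : normal_law P Y m s).

Lemma ge0_integral_normal_law (f : R -> R) : measurable_fun setT f ->
  (forall x, 0 <= f x) ->
  (\int[P]_w (f (Y w))%:E = \int[mu]_x (f x * pdf x)%:E)%E.
Proof.
move=> mf f0; rewrite -ge0_integral_normal_prob//.
pose Y' : {mfun T >-> measurableTypeR R} :=
  @mfun_Sub _ _ T (measurableTypeR R) Y (mem_set mY).
rewrite -(@ge0_integral_distribution _ _ _ _ _ P Y' (EFin \o f))//; last first.
  exact/measurable_EFinP.
by apply: eq_measure_integral => A mA _; exact: lawY.
Qed.

Lemma integrable_normal_law (f : R -> R) : measurable_fun setT f ->
  L1 mu (fun x => f x * pdf x) -> L1 P (fun w => f (Y w)).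
Proof.
move=> mf /integrableP[_ If]; apply/integrableP; split.
  by apply/measurable_EFinP; exact: measurableT_comp mf mY.
rewrite (ge0_integral_normal_law (f := fun x => `|f x|))//; last first.
  exact: measurableT_comp.
apply: le_lt_trans If; rewrite le_eqVlt; apply/orP; left; apply/eqP.
by apply: eq_integral => x _ /=; rewrite normrM (ger0_norm (normal_pdf_ge0 _ _ _)).
Qed.

Lemma Rintegral_normal_law (f : R -> R) : measurable_fun setT f ->
  L1 mu (fun x => f x * pdf x) ->
  \int[P]_w f (Y w) = \int[mu]_x (f x * pdf x).
Proof.
move=> mf If; have IfP := integrable_normal_law mf If.
have mn : measurable_fun setT (fun x => `|f x|) by exact: measurableT_comp.
have Inf : L1 mu (fun x => `|f x| * pdf x).
  apply: (eq_integrable _ (fun x : measurableTypeR R => `|(f x * pdf x)%:E|%E)) => //.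
    by move=> x _ /=; rewrite normrM (ger0_norm (normal_pdf_ge0 _ _ _)).
  exact: integrable_abse.
have InP := integrable_normal_law mn Inf.
have mfn : measurable_fun setT (fun x => f x + `|f x|) by exact: measurable_funD.
(* Both [f + |f|] and [|f|] are nonnegative, so the transfer formula for nonnegative functions
   applies to each of them. *)
transitivity (\int[P]_w ((f (Y w) + `|f (Y w)|) - `|f (Y w)|)).
  by apply: eq_Rintegral => w _; rewrite addrK.
rewrite RintegralB//; last exact: integrableRD IfP InP.
transitivity (\int[mu]_x ((f x + `|f x|) * pdf x - `|f x| * pdf x)); last first.
  by apply: eq_Rintegral => x _; rewrite -mulrBl addrK.
rewrite RintegralB//; last first.
  rewrite (_ : EFin \o _ = (EFin \o (fun x => (f x * pdf x)%R)) \+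
     (EFin \o (fun x => (`|f x| * pdf x)%R)))%E; first exact: integrableD.
  by apply/funext => x /=; rewrite mulrDl EFinD.
rewrite /Rintegral (ge0_integral_normal_law (f := fun x => f x + `|f x|))//.
  by rewrite (ge0_integral_normal_law (f := fun x => `|f x|)).
by move=> x; rewrite -lerBlDr sub0r lerNl; have := ler_norm (- f x); rewrite normrN.
Qed.

End normal_density_integral.

Section line_integrals.
Context (R : realType).
Local Notation mu := (@lebesgue_measure R).

(** On the interval of radius [n.+1] about [m] the integral is a difference of two values of [h],
    each at most [C / n.+1] in absolute value. *)
Lemma integral_derivative_line (h h' : R -> R) (m C : R) :
  (forall x : R, is_derive x (1 : R) h (h' x)) -> continuous h' ->
  (forall x, `|h x| * `|x - m| <= C) -> L1 mu h' ->
  \int[mu]_x h' x = 0.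
Proof.
move=> dh ch' hC Ih'.
have ch : continuous h.
  by move=> x; apply/differentiable_continuous/derivable1_diffP; have [] := dh x.
pose I n : set R := `[m - n.+1%:R, m + n.+1%:R]%classic.
have FTC n : (\int[mu]_(x in I n) (h' x)%:E =
    (h (m + n.+1%:R))%:E - (h (m - n.+1%:R))%:E)%E.
  apply: continuous_FTC2.
  - by rewrite ltrD2l; apply: lt_trans (_ : 0 < _); rewrite ?oppr_lt0 ltr0n.
  - exact: continuous_subspaceT.
  - split; first by move=> x _; have [] := dh x.
    + exact/cvg_at_right_filter/ch.
    + exact/cvg_at_left_filter/ch.
  - by move=> x _; rewrite derive1E; have [_ ->] := dh x.
have mh' : measurable_fun setT h' by exact: continuous_measurable_fun.
have mI n : measurable (I n) by exact: measurable_itv.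
have lim1 : ((\int[mu]_x ((h' \_ (I n)) x)%:E)%E @[n --> \oo] --> (\int[mu]_x (h' x)%:E)%E).
  have [|||||_ _ //] := @dominated_convergence _ _ _ mu setT measurableT
     (fun n x => ((h' \_ (I n)) x)%:E) (EFin \o h') (fun x => `|(h' x)%:E|%E).
  - move=> n; apply/measurable_EFinP; exact: (iffLR (measurable_restrictT h' (mI n)) (measurable_funTS mh')).
  - exact/measurable_EFinP.
  - apply: aeW => x _; apply: cvg_near_cst.
    exists (Num.truncn `|x - m|) => // n /= hn; rewrite patchE mem_set//.
    have : `|x - m| <= n.+1%:R.
      by apply/ltW/(lt_le_trans (Num.Theory.truncnS_gt _)); rewrite ler_nat ltnS.
    by rewrite /I/= in_itv/= ler_norml => /andP[? ?]; apply/andP; split; lra.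
  - exact: integrable_abse.
  - apply: aeW => x n _; rewrite lee_fin patchE; case: ifP => // _.
    by rewrite normr0.
have lim2 : ((\int[mu]_x ((h' \_ (I n)) x)%:E)%E @[n --> \oo] --> 0%E).
  have -> : (fun n => (\int[mu]_x ((h' \_ (I n)) x)%:E)%E) =
    (fun n => (h (m + n.+1%:R) - h (m - n.+1%:R))%:E).
    apply/funext => n; rewrite EFinB -FTC [RHS]integral_mkcond.
    by apply: eq_integral => x _; rewrite restrict_EFin.
  apply: cvg_EFin; first exact: nearW.
  apply/norm_cvg0P; apply: (@squeeze_cvgr _ _ _ _ (cst 0) (fun n => 2 * C * n.+1%:R^-1)).
  - apply: nearW => n; rewrite normr_ge0/=.
    have n0 : (0 : R) < n.+1%:R by rewrite ltr0n.
    have := hC (m + n.+1%:R); have := hC (m - n.+1%:R).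
    have -> : m + n.+1%:R - m = n.+1%:R by lra.
    have -> : m - n.+1%:R - m = - n.+1%:R by lra.
    rewrite normrN (ger0_norm (ltW n0)).
    rewrite -!ler_pdivlMr// => h1 h2.
    apply: le_trans (ler_normB _ _) _.
    rewrite [leRHS](_ : _ = C / n.+1%:R + C / n.+1%:R); first exact: lerD.
    by rewrite -mulrDl -mulr2n mulr_natl.
  - exact: cvg_cst.
  - rewrite -[X in _ --> X](mulr0 (2 * C)); apply: cvgMr; exact: cvg_harmonic.
by rewrite /Rintegral (cvg_unique _ lim1 lim2).
Qed.

End line_integrals.

Section normal_moments.
Context (R : realType) (m s : R).
Hypothesis s_gt0 : 0 < s.
Local Notation mu := (@lebesgue_measure R).
Local Notation pdf := (normal_pdf m s).
Local Notation growth x := (1 + (x - m) ^+ 6).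

Lemma growth_ge1 (x : R) : 1 <= growth x.
Proof. by rewrite lerDl exprn_even_ge0. Qed.

(** Half of the Gaussian exponent absorbs the polynomial: with [u] equal to that half,
    [(u / 3) ^+ 3 <= expR u]. The other half is, up to a constant, the density with doubled
    variance. Degree six suffices for all moments used, the largest being the third absolute moment
    of a centred square. *)
Lemma normal_pdf_growth : exists2 K : R, 0 <= K &
  forall x, growth x * pdf x <= K * normal_pdf m (Num.sqrt 2 * s) x + pdf x.
Proof.
pose s' := Num.sqrt 2 * s.
have s'_gt0 : 0 < s' by rewrite mulr_gt0// sqrtr_gt0.
have pk0 := normal_peak_gt0 (lt0r_neq0 s_gt0).
have pk'0 := normal_peak_gt0 (lt0r_neq0 s'_gt0).
exists ((4 * s ^+ 2) ^+ 3 * 27 * (normal_peak s / normal_peak s')).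
  by rewrite !mulr_ge0 ?invr_ge0 ?exprn_ge0 ?mulr_ge0 ?sqr_ge0// ltW.
move=> x; rewrite mulrDl mul1r addrC lerD2r.
rewrite !normal_pdfE ?gt_eqF//.
pose u := (x - m) ^+ 2 / (4 * s ^+ 2).
have s2 : 0 < 4 * s ^+ 2 by rewrite mulr_gt0// exprn_gt0.
have u0 : 0 <= u by rewrite divr_ge0 ?sqr_ge0// ltW.
have -> : normal_fun m s' x = expR (- u).
  rewrite /normal_fun; congr expR; rewrite /u exprMn sqr_sqrtr// mulNr.
  by congr (- (_ / _)); ring.
have -> : normal_fun m s x = expR (- u) * expR (- u).
  rewrite /normal_fun -expRD; congr expR; rewrite /u; field.
  by rewrite gt_eqF.
have u3 : u ^+ 3 <= 27 * expR u.
  have -> : expR u = expR (u / 3) ^+ 3.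
    by rewrite -expRM_natl; congr expR; field.
  rewrite [leLHS](_ : _ = 27 * (u / 3) ^+ 3); last by field.
  rewrite ler_pM2l// ler_pXn2r ?nnegrE ?expR_ge0//; last exact: divr_ge0.
  by apply: (le_trans _ (expR_ge1Dx _)); rewrite lerDr.
have u6 : (x - m) ^+ 6 <= (4 * s ^+ 2) ^+ 3 * 27 * expR u.
  rewrite [leLHS](_ : _ = (4 * s ^+ 2) ^+ 3 * u ^+ 3).
    by rewrite -[leRHS]mulrA ler_pM2l; [exact: u3|exact: exprn_gt0].
  by rewrite -exprMn /u mulrC divfK ?gt_eqF// -exprM.
have := ler_wpM2r (mulr_ge0 (ltW pk0) (mulr_ge0 (expR_ge0 (-u)) (expR_ge0 (-u)))) u6.
move=> /le_trans; apply; rewrite le_eqVlt; apply/orP; left; apply/eqP.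
have : expR u * expR (- u) = 1 by rewrite -expRD subrr expR0.
move: (expR u) (expR (- u)) => e f ef1.
rewrite -[RHS]mulr1 -[X in _ = _ * X]ef1 -/s'; field.
by rewrite gt_eqF.
Qed.

Lemma integrable_growth : L1 mu (fun x => growth x * pdf x).
Proof.
have [K K0 hK] := normal_pdf_growth.
have mg : measurable_fun setT (fun x : R => growth x * pdf x).
  apply: measurable_funM; last exact: measurable_normal_pdf.
  by apply: measurable_funD => //; apply: measurable_funX; exact: measurable_funB.
have s'_gt0 : Num.sqrt 2 * s != 0 by rewrite gt_eqF// mulr_gt0// sqrtr_gt0.
have I1 := @integrable_normal_pdf R m (Num.sqrt 2 * s).
have I2 := @integrable_normal_pdf R m s.
apply: le_integrable (integrableD measurableT (integrableZl measurableT K I1) I2) => //.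
  exact/measurable_EFinP.
move=> x _ /=; rewrite lee_fin ger0_norm ?mulr_ge0 ?normal_pdf_ge0//; last first.
  exact: le_trans ler01 (growth_ge1 x).
exact: le_trans (hK x) (ler_norm _).
Qed.

Lemma integrable_normal_growth (f : R -> R) (A : R) : measurable_fun setT f ->
  (forall x, `|f x| <= A * growth x) -> L1 mu (fun x => f x * pdf x).
Proof.
move=> mf fA.
apply: le_integrable (integrableZl measurableT A integrable_growth) => //.
  by apply/measurable_EFinP; apply: measurable_funM => //; exact: measurable_normal_pdf.
move=> x _ /=; rewrite lee_fin normrM (ger0_norm (normal_pdf_ge0 _ _ _)).
by apply: (le_trans _ (ler_norm _)); rewrite mulrA ler_wpM2r// normal_pdf_ge0.
Qed.

Lemma growth_pdf_bounded : exists C : R, forall x, growth x * pdf x <= C.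
Proof.
have [K K0 hK] := normal_pdf_growth.
exists (K * normal_peak (Num.sqrt 2 * s) + normal_peak s) => x.
apply: le_trans (hK x) _; apply: lerD; last by rewrite normal_pdf_ub// gt_eqF.
by rewrite ler_wpM2l// normal_pdf_ub// gt_eqF// mulr_gt0// sqrtr_gt0.
Qed.

Lemma is_derive_normal_pdf (x : R) :
  is_derive x (1 : R) pdf (- (x - m) / s ^+ 2 * pdf x).
Proof.
rewrite normal_pdfE ?gt_eqF//.
have s0 : s != 0 by rewrite gt_eqF.
have -> : (fun x : R => normal_peak s * normal_fun m s x) =
  (normal_peak s) *: (expR \o (fun x => - (x - m) ^+ 2 / (s ^+ 2 *+ 2))).
  by apply/funext => y; rewrite /normal_fun.
apply: is_derive_eq.
by rewrite /= /GRing.scale/= /normal_fun; field.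
Qed.

(** Integration by parts: the derivative of [g * pdf] is [g' * pdf - s ^- 2 * ((x - m) * g * pdf)],
    and [g * pdf] decays fast enough for its derivative to integrate to zero. *)
Lemma stein_density (g g' : R -> R) (A : R) :
  (forall x : R, is_derive x (1 : R) g (g' x)) -> continuous g' ->
  (forall x, `|g x| * `|x - m| <= A * growth x) ->
  (forall x, `|g' x| <= A * growth x) ->
  s ^+ 2 * (\int[mu]_x (g' x * pdf x)) = \int[mu]_x ((x - m) * g x * pdf x).
Proof.
move=> dg cg' gA g'A.
have s0 : s != 0 by rewrite gt_eqF.
have cg : continuous g.
  by move=> x; apply/differentiable_continuous/derivable1_diffP; have [] := dg x.
have cf : continuous (fun x => (x - m) * g x).
  by move=> x; apply: cvgM; [apply: cvgB => //; exact: cvg_cst|exact: cg].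
have I1 : L1 mu (fun x => g' x * pdf x).
  by apply: integrable_normal_growth g'A; exact: continuous_measurable_fun.
have I2 : L1 mu (fun x => (x - m) * g x * pdf x).
  apply: (@integrable_normal_growth _ A); first exact: continuous_measurable_fun.
  by move=> x; rewrite normrM mulrC.
have [C hC] := growth_pdf_bounded.
have I2' : L1 mu (fun x => - s ^- 2 * ((x - m) * g x * pdf x)).
  exact: (integrableZl measurableT (- s ^- 2) I2).
have FE : (\int[mu]_x (g' x * pdf x)) -
    s ^- 2 * (\int[mu]_x ((x - m) * g x * pdf x)) = 0; last first.
  by move/subr0_eq : FE => ->; rewrite mulrA mulfV ?mul1r// expf_neq0.
rewrite -mulNr -RintegralZl// -RintegralD//.
apply: (@integral_derivative_line R (fun x => g x * pdf x) _ m (A * C)); last first.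
- exact: (integrableD measurableT I1 I2').
- move=> x; rewrite normrM (ger0_norm (normal_pdf_ge0 _ _ _)) mulrAC.
  apply: (@le_trans _ _ (A * growth x * pdf x)).
    by rewrite ler_wpM2r// normal_pdf_ge0.
  rewrite -mulrA ler_wpM2l//.
  have := gA m; rewrite subrr normr0 mulr0 expr0n addr0 mulr1; exact.
- move=> x; apply: cvgD.
    by apply: cvgM; [exact: cg'|exact: continuous_normal_pdf].
  apply: cvgM; first exact: cvg_cst.
  by apply: cvgM; [exact: cf|exact: continuous_normal_pdf].
- move=> x; have d1 := dg x; have d2 := is_derive_normal_pdf x.
  rewrite (_ : (fun x => g x * pdf x) = g * pdf)//.
  apply: is_derive_eq.
  by rewrite /GRing.scale/=; field.
Qed.

End normal_moments.

(** Turns a quadratic remainder bound, which survives integration, into differentiability; this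
    allows differentiating under an expectation. *)
Lemma is_derive_quad (R : realType) (f : R -> R) (x l C : R) :
  (forall h, `|f (x + h) - f x - h * l| <= C * h ^+ 2) -> is_derive x (1 : R) f l.
Proof.
move=> fC.
have C0 : 0 <= C.
  by have := fC 1; rewrite expr1n mulr1; apply: le_trans.
have lim : h^-1 *: (f (h *: (1 : R) + x) - f x) @[h --> (0 : R)^'] --> l.
  apply/cvgrPdist_le => e e0.
  have d0 : 0 < e / (C + 1) by rewrite divr_gt0// ltr_wpDl.
  near=> h.
  have h0 : h != 0 by near: h; exact: nbhs_dnbhs_neq.
  rewrite /GRing.scale/= mulr1 [h + x]addrC distrC.
  have -> : h^-1 * (f (x + h) - f x) - l = h^-1 * (f (x + h) - f x - h * l).
    by rewrite [RHS]mulrBr mulKf.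
  rewrite normrM normfV ler_pdivrMl ?normr_gt0//.
  apply: le_trans (fC h) _; rewrite -(real_normK (num_real h)) expr2.
  rewrite [leLHS]mulrCA ler_wpM2l//.
  have : `|h| <= e / (C + 1).
    near: h; apply: dnbhs0_le => //.
  rewrite ler_pdivlMr ?ltr_wpDl// => he.
  by apply: (le_trans _ he); rewrite mulrC ler_wpM2l// lerDl.
by apply: DeriveDef; [apply/cvg_ex; exists l | exact: cvg_lim].
Unshelve. all: by end_near. Qed.

Section normal_variable.
Context (R : realType) (m s : R).
Hypothesis s_gt0 : 0 < s.
Context d (T : measurableType d) (P : probability T R) (Y : T -> R).
Hypotheses (mY : measurable_fun setT Y) (lawY : normal_law P Y m s).
Local Notation growth x := (1 + (x - m) ^+ 6).

Lemma integrable_normal_poly (f : R -> R) (A : R) : measurable_fun setT f ->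
  (forall x, `|f x| <= A * growth x) -> L1 P (fun w => f (Y w)).
Proof.
move=> mf fA; apply: (integrable_normal_law mY lawY mf).
exact: (integrable_normal_growth s_gt0 mf fA).
Qed.

Lemma stein_normal (g g' : R -> R) (A : R) :
  (forall x : R, is_derive x (1 : R) g (g' x)) -> continuous g' ->
  (forall x, `|g x| * `|x - m| <= A * growth x) ->
  (forall x, `|g' x| <= A * growth x) ->
  s ^+ 2 * (\int[P]_w g' (Y w)) = \int[P]_w ((Y w - m) * g (Y w)).
Proof.
move=> dg cg' gA g'A.
have cg : continuous g.
  by move=> x; apply/differentiable_continuous/derivable1_diffP; have [] := dg x.
have mg' : measurable_fun setT g' by exact: continuous_measurable_fun.
have mg : measurable_fun setT (fun x : R => (x - m) * g x).
  apply: measurable_funM; first exact: measurable_funB.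
  exact: continuous_measurable_fun.
rewrite (Rintegral_normal_law mY lawY mg'); last first.
  exact: integrable_normal_growth g'A.
rewrite (stein_density s_gt0 dg cg' gA g'A).
rewrite (Rintegral_normal_law mY lawY mg)//.
apply: (@integrable_normal_growth _ _ _ s_gt0 _ A) => // x.
by rewrite normrM mulrC.
Qed.

(** As a function of [t] the expectation [F] solves [F' = - s ^+ 2 * t * F], so
    [F t * expR (t ^+ 2 * s ^+ 2 / 2)] is constant and equals its value at [0]. *)
Lemma Rintegral_cos_normal (t u : R) :
  \int[P]_w cos (t * (Y w - m) + u) = cos u * expR (- (t ^+ 2 * s ^+ 2 / 2)).
Proof.
pose F (t : R) := \int[P]_w cos (t * (Y w - m) + u).
pose E2 := \int[P]_w (growth (Y w)).
have gsq (x : R) : (x - m) ^+ 2 <= growth x.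
  have y0 : 0 <= (x - m) ^+ 2 by exact: sqr_ge0.
  rewrite (exprM (x - m) 2 3); move: y0; move: ((x - m) ^+ 2) => y y0.
  by have := sqr_ge0 (y - 1); nra.
have Ig : L1 P (fun w => growth (Y w)).
  apply: (@integrable_normal_poly (fun x => growth x) 1).
    by apply: measurable_funD => //; apply: measurable_funX; exact: measurable_funB.
  by move=> x; rewrite mul1r ger0_norm// (le_trans ler01 (growth_ge1 _ _)).
have cosm c : measurable_fun setT (fun w => cos (c * (Y w - m) + u)).
  apply: measurableT_comp; first exact: continuous_measurable_fun (@continuous_cos R).
  apply: measurable_funD => //; apply: measurable_funM => //.
  exact: measurable_funB.
have Ic c : L1 P (fun w => cos (c * (Y w - m) + u)).
  by apply: (@bounded_integrable _ _ _ _ _ 1) => // w; exact: cos_max.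
have dF t0 : is_derive t0 (1 : R) F (- (s ^+ 2 * t0) * F t0).
  apply: (@is_derive_quad _ _ _ _ E2) => h.
  pose G w := sin (t0 * (Y w - m) + u).
  have mG : measurable_fun setT (fun x : R => (x - m) * sin (t0 * (x - m) + u)).
    apply: measurable_funM; first exact: measurable_funB.
    apply: measurableT_comp; first exact: continuous_measurable_fun (@continuous_sin R).
    by apply: measurable_funD => //; apply: measurable_funM => //; exact: measurable_funB.
  have IG : L1 P (fun w => (Y w - m) * G w).
    apply: (@integrable_normal_poly (fun x => (x - m) * sin (t0 * (x - m) + u)) 1) => // x.
    rewrite normrM mul1r; apply: (@le_trans _ _ `|x - m|).
      by rewrite ler_piMr// sin_max.
    have [h1|h1] := leP `|x - m| 1; first exact: le_trans h1 (growth_ge1 _ _).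
    apply: le_trans (gsq x); rewrite -(real_normK (num_real (x - m))) expr2.
    by rewrite ler_peMl// ltW.
  (* Differentiation produces minus the expectation of [(Y - m)] times a sine; Stein's identity for
     that sine gives back [F]. *)
  have stein : s ^+ 2 * (t0 * F t0) = \int[P]_w ((Y w - m) * G w).
    rewrite /F -RintegralZl//.
    apply: (@stein_normal (fun x => sin (t0 * (x - m) + u))
      (fun x => t0 * cos (t0 * (x - m) + u)) (1 + `|t0|)).
    - by move=> x; apply: is_derive_eq; rewrite /GRing.scale/=; ring.
    - move=> x; apply: cvgM; first exact: cvg_cst.
      apply: continuous_comp; last exact: continuous_cos.
      apply: cvgD; last exact: cvg_cst.
      by apply: cvgM; [exact: cvg_cst|apply: cvgB => //; exact: cvg_cst].
    - move=> x; rewrite mulrDl mul1r ler_wpDr ?mulr_ge0 ?(le_trans ler01 (growth_ge1 _ _))//.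
      apply: (@le_trans _ _ `|x - m|).
        by rewrite ler_piMl// sin_max.
      have [h1|h1] := leP `|x - m| 1; first exact: le_trans h1 (growth_ge1 _ _).
      apply: le_trans (gsq x); rewrite -(real_normK (num_real (x - m))) expr2.
      by rewrite ler_peMl// ltW.
    - move=> x; rewrite normrM; apply: ler_pM => //; last first.
        exact: le_trans (cos_max _) (growth_ge1 _ _).
      by rewrite lerDr.
  rewrite [- _ * F t0]mulNr mulrN opprK -mulrA stein -RintegralZl// -RintegralB//.
  rewrite -RintegralD//; [|exact: integrableRB|exact: integrableRZ].
  rewrite mulrC -RintegralZl//.
  apply: Rintegral_norm_le; last exact: integrableRZ.
    apply: measurable_funD; first exact: measurable_funB.
    exact: integrable_measurable (integrableRZ _ IG).
  move=> w; rewrite (_ : (t0 + h) * (Y w - m) + u =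
    (t0 * (Y w - m) + u) + h * (Y w - m)); last by ring.
  have := cos_taylor1 (t0 * (Y w - m) + u) (h * (Y w - m)).
  rewrite mulrA => /le_trans; apply.
  by rewrite normrM exprMn !real_normK ?num_real// ler_wpM2l// sqr_ge0.
have [FE F0E] : F t * expR (t ^+ 2 * s ^+ 2 / 2) = F 0 /\ F 0 = cos u.
  split; last first.
    rewrite /F; under eq_Rintegral do rewrite mul0r add0r.
    by rewrite Rintegral_prob_cst.
  have -> : F 0 = F 0 * expR (0 ^+ 2 * s ^+ 2 / 2).
    by rewrite expr0n /= !mul0r expR0 mulr1.
  pose H (r : R) := F r * expR (r ^+ 2 * s ^+ 2 / 2).
  apply: (@is_derive_0_is_cst _ H) => r; have dFr := dF r.
  rewrite /H; apply: is_derive_eq.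
  by rewrite /GRing.scale/=; field.
by rewrite -F0E -FE -[RHS]mulrA -expRD subrr expR0 mulr1.
Qed.

End normal_variable.

Section standard_normal.
Context (R : realType) d (T : measurableType d) (P : probability T R) (Y : T -> R).
Hypotheses (mY : measurable_fun setT Y) (lawY : normal_law P Y 0 1).
Local Notation mu := (@lebesgue_measure R).

Definition xi (y : R) : R := (y ^+ 2 - 1) / Num.sqrt 2.

Lemma continuous_xi : continuous xi.
Proof.
move=> x; apply: cvgM; last exact: cvg_cst.
by apply: cvgB; [exact: exprn_continuous|exact: cvg_cst].
Qed.

Lemma measurable_xi : measurable_fun setT xi.
Proof. exact: continuous_measurable_fun continuous_xi. Qed.

Lemma integrable_std_poly (f : R -> R) (A : R) : continuous f ->
  (forall x, `|f x| <= A * (1 + x ^+ 6)) -> L1 P (fun w => f (Y w)).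
Proof.
move=> cf fA; apply: (integrable_normal_poly ltr01 mY lawY (A := A)).
  exact: continuous_measurable_fun.
by move=> x; rewrite subr0.
Qed.

(** Stein's identity for [g x = x]; the fourth moment comes in the same way from [g x = x ^+ 3]. *)
Lemma std_moment2 : \int[P]_w (Y w ^+ 2) = 1.
Proof.
have := @stein_normal R 0 1 ltr01 _ _ P Y mY lawY id (cst 1) 1.
rewrite expr1n mul1r Rintegral_prob_cst => ->.
- by apply: eq_Rintegral => w _; rewrite subr0.
- by move=> x; exact: cvg_cst.
- move=> x; rewrite subr0 mul1r -normrM -expr2 ger0_norm ?sqr_ge0//.
  rewrite (exprM x 2 3); move: (sqr_ge0 x); move: (x ^+ 2) => y y0.
  by have := sqr_ge0 (y - 1); nra.
- by move=> x; rewrite normr1 mul1r growth_ge1.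
Qed.

Lemma std_moment4 : \int[P]_w (Y w ^+ 4) = 3.
Proof.
have c2 : continuous (fun x : R => 3 * x ^+ 2).
  by move=> x; apply: cvgM; [exact: cvg_cst|exact: exprn_continuous].
have I2 : L1 P (fun w => Y w ^+ 2).
  apply: (@integrable_std_poly (fun x => x ^+ 2) 1); first exact: exprn_continuous.
  move=> x; rewrite mul1r ger0_norm ?sqr_ge0//.
  rewrite (exprM x 2 3); move: (sqr_ge0 x); move: (x ^+ 2) => y y0.
  by have := sqr_ge0 (y - 1); nra.
have stein : 1 ^+ 2 * (\int[P]_w (3 * Y w ^+ 2)) = \int[P]_w ((Y w - 0) * Y w ^+ 3).
  apply: (@stein_normal R 0 1 ltr01 _ _ P Y mY lawY (fun x => x ^+ 3)
    (fun x => 3 * x ^+ 2) 3) => //.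
  - by move=> x; apply: is_derive_eq; rewrite /GRing.scale/=; ring.
  - move=> x; rewrite subr0 -normrM -exprSr ger0_norm ?exprn_even_ge0//.
    rewrite (exprM x 2 3) (exprM x 2 2).
    move: (sqr_ge0 x); move: (x ^+ 2) => y y0.
    by have := sqr_ge0 (y - 1); nra.
  - move=> x; rewrite subr0 ger0_norm; last by rewrite mulr_ge0 ?sqr_ge0.
    rewrite ler_pM2l; last by rewrite ltr0n.
    rewrite (exprM x 2 3); move: (sqr_ge0 x); move: (x ^+ 2) => y y0.
    by have := sqr_ge0 (y - 1); nra.
rewrite expr1n mul1r RintegralZl// std_moment2 mulr1 in stein.
by rewrite stein; apply: eq_Rintegral => w _; rewrite subr0 -exprS.
Qed.

Lemma integrable_sqr : L1 P (fun w => Y w ^+ 2).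
Proof.
apply: (@integrable_std_poly (fun x => x ^+ 2) 1); first exact: exprn_continuous.
move=> x; rewrite mul1r ger0_norm ?sqr_ge0//.
rewrite (exprM x 2 3); move: (sqr_ge0 x); move: (x ^+ 2) => y y0.
by have := sqr_ge0 (y - 1); nra.
Qed.

Lemma integrable_pow4 : L1 P (fun w => Y w ^+ 4).
Proof.
apply: (@integrable_std_poly (fun x => x ^+ 4) 1); first exact: exprn_continuous.
move=> x; rewrite mul1r ger0_norm ?exprn_even_ge0//.
rewrite (exprM x 2 3) (exprM x 2 2).
move: (sqr_ge0 x); move: (x ^+ 2) => y y0.
by have := sqr_ge0 (y - 1); nra.
Qed.

Lemma integrable_xi : L1 P (fun w => xi (Y w)).
Proof.
have := integrableRZ (Num.sqrt 2)^-1 (integrableRB integrable_sqr (integrableR_cst P 1)).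
by apply: eq_integrable => // w _ /=; rewrite mulrC.
Qed.

Lemma Rintegral_xi : \int[P]_w xi (Y w) = 0.
Proof.
rewrite RintegralZr//; last exact: integrableRB integrable_sqr (integrableR_cst P 1).
rewrite RintegralB//; [|exact: integrable_sqr|exact: integrableR_cst].
by rewrite std_moment2 Rintegral_prob_cst subrr mul0r.
Qed.

Let xi2E w : xi (Y w) ^+ 2 = 2^-1 * Y w ^+ 4 - Y w ^+ 2 + 2^-1.
Proof. by rewrite /xi expr_div_n sqr_sqrtr//; field. Qed.

Lemma integrable_xi2 : L1 P (fun w => xi (Y w) ^+ 2).
Proof.
under eq_fun do rewrite xi2E.
apply: integrableRD; last exact: integrableR_cst.
by apply: integrableRB; [apply: integrableRZ; exact: integrable_pow4|exact: integrable_sqr].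
Qed.

Lemma Rintegral_xi2 : \int[P]_w (xi (Y w) ^+ 2) = 1.
Proof.
under eq_Rintegral do rewrite xi2E.
have I4 := integrableRZ 2^-1 integrable_pow4.
rewrite RintegralD//; [|exact: integrableRB I4 integrable_sqr|exact: integrableR_cst].
rewrite RintegralB//; last exact: integrable_sqr.
rewrite RintegralZl//; last exact: integrable_pow4.
by rewrite std_moment4 std_moment2 Rintegral_prob_cst; field.
Qed.

Lemma integrable_xi3 : L1 P (fun w => `|xi (Y w)| ^+ 3).
Proof.
apply: (@integrable_std_poly (fun x => `|xi x| ^+ 3) 8).
  move=> x; apply: (@continuous_comp _ _ _ (fun z => `|xi z|) (fun z => z ^+ 3)).
    by apply: continuous_comp; [exact: continuous_xi|exact: norm_continuous].
  exact: exprn_continuous.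
move=> x; rewrite ger0_norm ?exprn_ge0// /xi normrM (ger0_norm (x := (Num.sqrt 2)^-1))//.
rewrite exprMn; apply: (@le_trans _ _ (`|x ^+ 2 - 1| ^+ 3)).
  rewrite ler_piMr ?exprn_ge0// exprn_ile1// invf_le1 ?sqrtr_gt0//.
  by rewrite -[leLHS]sqrtr1 ler_sqrt// ler1n.
rewrite (exprM x 2 3); move: (sqr_ge0 x); move: (x ^+ 2) => y y0.
have : `|y - 1| <= y + 1 by rewrite ler_norml; apply/andP; split; lra.
move: (normr_ge0 (y - 1)); move: `|y - 1| => z z0 zy.
apply: (@le_trans _ _ ((y + 1) ^+ 3)); first by rewrite lerXn2r// nnegrE; lra.
(* Three times this product is [4 * (1 + y ^+ 3) - (y + 1) ^+ 3]. *)
have y3 : 0 <= (y - 1) ^+ 2 * (y + 1) by rewrite mulr_ge0 ?sqr_ge0//; lra.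
by nra.
Qed.

(** The exponential times the standard density is [s] times the centred density with standard
    deviation [s], where [s ^+ 2 = (1 + 2 * t)^-1]. *)
Lemma Rintegral_exp_sqr (t : R) : 0 <= t ->
  \int[P]_w expR (- (t * Y w ^+ 2)) = (Num.sqrt (1 + 2 * t))^-1.
Proof.
move=> t0; pose s := (Num.sqrt (1 + 2 * t))^-1.
have t1 : 0 < 1 + 2 * t by rewrite ltr_wpDr// mulr_ge0.
have s0 : 0 < s by rewrite invr_gt0 sqrtr_gt0.
have s2 : s ^+ 2 = (1 + 2 * t)^-1 by rewrite exprVn sqr_sqrtr// ltW.
have pdfE x : expR (- (t * x ^+ 2)) * normal_pdf 0 1 x = s * normal_pdf 0 s x.
  rewrite !normal_pdfE ?oner_eq0 ?gt_eqF// /normal_fun /normal_peak.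
  rewrite expr1n mul1r subr0 s2 -mulrnAr sqrtrM ?invr_ge0 ?(ltW t1)//.
  rewrite sqrtrV ?(ltW t1)// invfM invrK -/s mulrCA -expRD !mulrA.
  rewrite [s * _](_ : _ = 1) ?mul1r; last first.
    by rewrite mulVf// gt_eqF// sqrtr_gt0.
  congr (_ * expR _); field.
  by rewrite gt_eqF.
have mf : measurable_fun setT (fun x : R => expR (- (t * x ^+ 2))).
  apply: measurableT_comp => //; apply: measurableT_comp => //.
  by apply: measurable_funM => //; exact: measurable_funX.
have IF : L1 mu (fun x => expR (- (t * x ^+ 2)) * normal_pdf 0 1 x).
  apply: (eq_integrable measurableT (fun x : measurableTypeR R => (s%:E * (normal_pdf 0 s x)%:E)%E)).
    by move=> x _ /=; rewrite pdfE.
  by apply: integrableZl => //; exact: integrable_normal_pdf.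
rewrite (Rintegral_normal_law mY lawY mf IF).
under eq_Rintegral do rewrite pdfE.
rewrite RintegralZl//; last exact: integrable_normal_pdf.
by rewrite /Rintegral integral_normal_pdf mulr1.
Qed.

(** Completing the square gives the density centred at [- c]. *)
Lemma mgf_normal (c : R) : L1 P (fun w => expR (- (c * Y w))) /\
  \int[P]_w expR (- (c * Y w)) = expR (c ^+ 2 / 2).
Proof.
have pdfE x : expR (- (c * x)) * normal_pdf 0 1 x = expR (c ^+ 2 / 2) * normal_pdf (- c) 1 x.
  rewrite !normal_pdfE ?oner_eq0// /normal_fun mulrCA -expRD.
  rewrite [RHS]mulrCA -expRD; by congr (_ * expR _); field.
have mf : measurable_fun setT (fun x : R => expR (- (c * x))).
  by apply: measurableT_comp => //; apply: measurableT_comp => //; exact: measurable_funM.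
have IF : L1 mu (fun x => expR (- (c * x)) * normal_pdf 0 1 x).
  apply: (eq_integrable measurableT
    (fun x : measurableTypeR R => ((expR (c ^+ 2 / 2))%:E * (normal_pdf (- c) 1 x)%:E)%E)).
    by move=> x _ /=; rewrite pdfE.
  by apply: integrableZl => //; exact: integrable_normal_pdf.
split; first exact: (integrable_normal_law mY lawY mf IF).
rewrite (Rintegral_normal_law mY lawY mf IF).
under eq_Rintegral do rewrite pdfE.
rewrite RintegralZl//; last exact: integrable_normal_pdf.
by rewrite /Rintegral integral_normal_pdf mulr1.
Qed.

End standard_normal.

(** * Independence *)

Section pi_lambda.
Context d (T : measurableType d) (R : realType) (P : probability T R).

Lemma probability_finK (A : set T) : measurable A -> P A = (fine (P A))%:E.
Proof. by move=> mA; rewrite fineK// fin_num_measure. Qed.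

Lemma lambda_system_indep (B : set T) : measurable B ->
  lambda_system setT [set A | measurable A /\ P (A `&` B) = (P A * P B)%E].
Proof.
move=> mB; split => //.
- by split => //; rewrite setTI probability_setT mul1e.
- move=> A C AC /= [mA PA] [mC PC]; split; first exact: measurableD.
  have -> : (A `\` C) `&` B = (A `&` B) `\` (C `&` B).
    apply/seteqP; split => w /=; first by move=> [[Aw Cw] Bw]; split => // -[].
    by move=> [[Aw Bw]] CBw; split => //; split => // Cw; apply: CBw.
  have finP D : measurable D -> (P D < +oo)%E.
    by move=> mD; apply: le_lt_trans (probability_le1 P mD) _; rewrite ltry.
  rewrite !measureD ?finP//; try exact: measurableI.
  have -> : (A `&` B `&` (C `&` B)) = C `&` B.
    apply/seteqP; split => w /=; first by move=> [_ []].
    by move=> [Cw Bw]; do 2 split => //; exact: AC.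
  have -> : A `&` C = C by apply/seteqP; split => w //=; [case|split => //; exact: AC].
  rewrite [LHS](_ : _ = (P (A `&` B) - P (C `&` B))%E)//.
  rewrite [RHS](_ : _ = ((P A - P C) * P B)%E)//.
  rewrite PA PC (probability_finK mA) (probability_finK mB) (probability_finK mC).
  by rewrite -!EFinM -!EFinB mulrBl.
- move=> F ndF /= mF.
  have mFn n : measurable (F n) by case: (mF n).
  split; first exact: bigcupT_measurable.
  have c1 : P (F n) @[n --> \oo] --> P (\bigcup_n F n).
    by apply: nondecreasing_cvg_mu => //; exact: bigcupT_measurable.
  have c2 : P (F n `&` B) @[n --> \oo] --> P (\bigcup_n F n `&` B).
    rewrite setI_bigcupl; apply: (@nondecreasing_cvg_mu _ _ _ P (fun n => F n `&` B)).
    + by move=> n; exact: measurableI.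
    + by apply: bigcupT_measurable => n; exact: measurableI.
    + by move=> n k nk; apply/subsetPset; apply: setSI; apply/subsetPset; exact: ndF.
  have c3 : (P (F n) * P B)%E @[n --> \oo] --> (P (\bigcup_n F n) * P B)%E.
    by rewrite (probability_finK mB); apply: cvgeZr.
  apply: cvg_unique c2 _ => //=.
  by under eq_fun do rewrite (proj2 (mF _)).
Qed.

(** Dynkin's pi-lambda argument, applied to the first factor with the second one fixed in [H], then
    to the second with the first one fixed in the generated sigma-algebra. *)
Lemma indep_generated (G H : set (set T)) : setI_closed G -> setI_closed H ->
  G `<=` measurable -> H `<=` measurable ->
  (forall A B, G A -> H B -> P (A `&` B) = (P A * P B)%E) ->
  forall A B, <<s G >> A -> <<s H >> B -> P (A `&` B) = (P A * P B)%E.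
Proof.
move=> GI HI Gm Hm GH.
have Hm' B : <<s H >> B -> measurable B.
  by apply: smallest_sub => //; exact: sigma_algebra_measurable.
have GH' A B : <<s G >> A -> H B -> P (A `&` B) = (P A * P B)%E.
  move=> GA HB; have mB := Hm _ HB.
  have := @lambda_system_subset _ G GI setT _ (lambda_system_indep mB).
  move=> /(_ _ (fun _ _ => @subsetT _ _) _ GA); case => // C GC /=.
  by split; [exact: Gm|exact: GH].
move=> A B GA HB.
have mA : measurable A.
  by move: A GA; apply: smallest_sub => //; exact: sigma_algebra_measurable.
have := @lambda_system_subset _ H HI setT _ (lambda_system_indep mA).
move=> /(_ _ (fun _ _ => @subsetT _ _) _ HB) [C HC /=|_].
  by split; [exact: Hm|rewrite setIC GH'// muleC].
by rewrite setIC muleC.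
Qed.

End pi_lambda.

Section blocks.
Context d (T : measurableType d) (R : realType) (P : probability T R).
Context (I : eqType) (m : nat) (X : I -> T -> 'rV[R]_m).

Definition cylinder (B : I -> 'I_m -> set R) (i : I) :=
  [set w | forall l, B i l (X i w 0 l)].

Definition rectangles (J : seq I) : set (set T) :=
  [set A | exists2 B : I -> 'I_m -> set R, (forall i l, measurable (B i l)) &
     A = \big[setI/setT]_(i <- J) cylinder B i].

(** The space [T] with the sigma-algebra generated by the vectors of index in [J]. That a function
    depends measurably on these vectors alone is then expressed by a type ascription on its
    domain. *)
Definition block (J : seq I) := g_sigma_algebraType (rectangles J).

Hypothesis mX : forall i, random_vector (X i).
Hypothesis indX : mutually_independent P X.

Lemma rectanglesP J B w : (\big[setI/setT]_(i <- J) cylinder B i) w <->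
  forall i, i \in J -> cylinder B i w.
Proof.
elim: J => [|j J IHJ]; first by rewrite big_nil.
rewrite big_cons; split => [[jw /IHJ Jw] i|Jw].
  by rewrite inE => /predU1P[->//|]; exact: Jw.
split; first by apply: Jw; rewrite mem_head.
by apply/IHJ => i iJ; apply: Jw; rewrite inE iJ orbT.
Qed.

Lemma measurable_cylinder B i : (forall l, measurable (B i l)) ->
  measurable (cylinder B i).
Proof.
move=> mB.
rewrite (_ : cylinder B i = \big[setI/setT]_(l <- enum 'I_m)
    ((fun w => X i w 0 l) @^-1` B i l)).
  by apply: bigsetI_measurable => l _; rewrite -[_ @^-1` _]setTI; exact: mX.
rewrite -bigcap_seq; apply/seteqP; split => w /=; first by move=> h l _; exact: h.
by move=> h l; apply: h; rewrite /= mem_enum.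
Qed.

Lemma measurable_rectangles J : rectangles J `<=` measurable.
Proof.
move=> _ [B mB ->]; apply: bigsetI_measurable => i _.
exact: measurable_cylinder.
Qed.

Lemma setI_closed_rectangles J : setI_closed (rectangles J).
Proof.
move=> _ _ [B mB ->] [C mC ->]; exists (fun i l => B i l `&` C i l).
  by move=> i l; exact: measurableI.
apply/seteqP; split => w.
  move=> [/rectanglesP Bw /rectanglesP Cw]; apply/rectanglesP => i iJ l.
  by split; [exact: Bw|exact: Cw].
move/rectanglesP => h; split; apply/rectanglesP => i iJ l;
  by have [] := h i iJ l.
Qed.

Lemma indep_rectangles J K A B : uniq (J ++ K) ->
  rectangles J A -> rectangles K B -> P (A `&` B) = (P A * P B)%E.
Proof.
move=> uJK rA rB.
have mA := measurable_rectangles rA; have mB := measurable_rectangles rB.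
rewrite (probability_finK _ mA) (probability_finK _ mB).
rewrite (probability_finK _ (measurableI _ _ mA mB)) -EFinM; congr EFin.
move: rA rB => {mA mB} [B1 mB1 ->] [B2 mB2 ->].
move: (uJK); rewrite cat_uniq => /and3P[uJ JK uK].
rewrite (indX uJ mB1) (indX uK mB2).
(* Since [J] and [K] are disjoint, the two families of Borel sets merge into one, to which the
   product rule over [J ++ K] applies. *)
pose B3 i := if i \in J then B1 i else B2 i.
have mB3 i l : measurable (B3 i l) by rewrite /B3; case: ifP.
have KJ i : i \in K -> (i \in J) = false.
  by move=> iK; apply: contraNF JK => iJ; apply/hasP; exists i.
rewrite [\prod_(i <- J) _](eq_big_seq (fun i => fine (P (cylinder B3 i)))); last first.
  by move=> i iJ; rewrite /cylinder /B3 iJ.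
rewrite [\prod_(i <- K) _](eq_big_seq (fun i => fine (P (cylinder B3 i)))); last first.
  by move=> i iK; rewrite /cylinder /B3 KJ.
rewrite -big_cat/= -(indX uJK mB3) big_cat/=; congr (fine (P (_ `&` _))).
  by apply: eq_big_seq => i iJ; rewrite /cylinder /B3 iJ.
by apply: eq_big_seq => i iK; rewrite /cylinder /B3 KJ.
Qed.

Lemma indep_blocks J K (A : set (block J)) (B : set (block K)) : uniq (J ++ K) ->
  measurable A -> measurable B -> P (A `&` B) = (P A * P B)%E.
Proof.
move=> uJK; apply: indep_generated; try exact: setI_closed_rectangles;
  try exact: measurable_rectangles.
by move=> C D rC rD; exact: (indep_rectangles uJK).
Qed.

Lemma measurable_block J (A : set T) :
  measurable (A : set (block J)) -> measurable A.
Proof.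
apply: smallest_sub; first exact: sigma_algebra_measurable.
exact: measurable_rectangles.
Qed.

Lemma measurable_fun_block J d' (U : measurableType d') (f : T -> U) :
  measurable_fun setT (f : block J -> U) -> measurable_fun setT f.
Proof.
by move=> mf _ B mB; apply: (@measurable_block J); exact: mf.
Qed.

Lemma measurable_coord J i l : i \in J ->
  measurable_fun setT (fun w : block J => X i w 0 l).
Proof.
move=> iJ _ B mB; rewrite setTI; apply: sub_sigma_algebra.
(* The rectangle that constrains only the coordinate [l] of the vector [i]. *)
exists (fun i' l' => if (i' == i) && (l' == l) then B else setT).
  by move=> i' l'; case: ifP.
apply/seteqP; split => w /=.
  move=> Bw; apply/rectanglesP => i' i'J l'.
  by have [/andP[/eqP-> /eqP->]//|_] := ifPn.
by move/rectanglesP => /(_ i iJ l); rewrite !eqxx.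
Qed.

End blocks.

Section product_rule.
Context d (T : measurableType d) (R : realType) (P : probability T R).

(** The law of [(U, V)] agrees with the product of the marginal laws on measurable rectangles, hence
    everywhere, and Fubini's theorem applies. *)
Lemma Rintegral_indep_mul (U V : T -> R) : L1 P U -> L1 P V ->
  (forall A B : set R, measurable A -> measurable B ->
     P ((U @^-1` A) `&` (V @^-1` B)) = (P (U @^-1` A) * P (V @^-1` B))%E) ->
  L1 P (fun w => U w * V w) /\
  \int[P]_w (U w * V w) = (\int[P]_w U w) * (\int[P]_w V w).
Proof.
move=> IU IV indUV.
have mU := integrable_measurable IU; have mV := integrable_measurable IV.
pose U' : {mfun T >-> R} := mfun_Sub (mem_set mU).
pose V' : {mfun T >-> R} := mfun_Sub (mem_set mV).
have mW : measurable_fun setT (fun w => (U w, V w)) by exact: measurable_fun_pair.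
pose W' : {mfun T >-> (R * R)%type} :=
  mfun_Sub (mem_set mW).
pose m1 := distribution P U'; pose m2 := distribution P V'.
pose m := distribution P W'.
have m12 A : measurable A -> (m1 \x m2)%E A = m A.
  apply: product_measure_unique => B C mB mC.
  exact: indUV.
pose g (z : R * R) : \bar R := (z.1 * z.2)%:E.
have mg : measurable_fun setT g.
  apply/measurable_EFinP; apply: measurable_funM; first exact: measurable_fst.
  exact: measurable_snd.
have finE (f : T -> R) : L1 P f -> (\int[P]_w `|(f w)%:E| < +oo)%E.
  by case/integrableP.
have EE (X : {mfun T >-> R}) (c : R) : L1 P X ->
    (\int[distribution P X]_y `|(c * y)%:E| = `|c|%:E * \int[P]_w `|(X w)%:E|)%E.
  move=> IX; rewrite ge0_integral_distribution//=; last first.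
    by apply/measurable_EFinP; apply: measurableT_comp => //; exact: measurable_funM.
  under eq_integral do rewrite normrM EFinM.
  rewrite ge0_integralZl//=; apply/measurable_EFinP; apply: measurableT_comp => //.
(* Tonelli's theorem for the absolute value gives integrability on the product, which Fubini's
   theorem needs. *)
have absg : (\int[m1]_x \int[m2]_y `|g (x, y)| =
    \int[P]_w `|(U w)%:E| * \int[P]_w `|(V w)%:E|)%E.
  under eq_integral => x _ do rewrite (EE V' x IV).
  rewrite ge0_integralZr//=; last 2 first.
  - by apply/measurable_EFinP; exact: normr_measurable.
  - by apply: integral_ge0.
  by congr (_ * _)%E; under eq_integral do rewrite -[X in `|X|]mul1r;
    rewrite (EE U' 1 IU) normr1 mul1e.
have ig12 : (m1 \x m2)%E.-integrable setT g.
  apply/integrable12ltyP => //; rewrite absg.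
  by rewrite lte_mul_pinfty ?finE// ?integral_ge0// ge0_fin_numE ?finE// integral_ge0.
have igP : L1 P (fun w => U w * V w).
  apply/integrableP; split; first by apply/measurable_EFinP; exact: measurable_funM.
  have -> : (\int[P]_w `|(EFin \o (fun w => (U w * V w)%R)) w| =
             \int[m]_z `|g z|)%E.
    rewrite ge0_integral_distribution//; exact: measurableT_comp.
  rewrite (eq_measure_integral (m1 \x m2)%E); last by move=> A mA _; apply/esym; exact: m12.
  by case/integrableP : ig12.
split => //; rewrite /Rintegral -fineM; [|exact: integrable_fin_num..].
congr fine.
have -> : (\int[P]_w (U w * V w)%:E = \int[m]_z g z)%E.
  by rewrite integral_distribution.
rewrite (eq_measure_integral (m1 \x m2)%E); last by move=> A mA _; apply/esym; exact: m12.
rewrite -(integral12_prod_meas1 ig12) /fubini_F /g/=.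
have I2 : m2.-integrable setT (EFin : R -> \bar R).
  by apply: integrable_pushforward => //; exact: measurable_funTS.
have EV : (\int[m2]_y y%:E = \int[P]_w (V w)%:E)%E.
  by rewrite integral_distribution.
have EU : (\int[m1]_y y%:E = \int[P]_w (U w)%:E)%E.
  by rewrite integral_distribution.
under eq_integral => x _.
  under eq_integral do rewrite EFinM.
  rewrite integralZl// EV.
  over.
have I1 : m1.-integrable setT (EFin : R -> \bar R).
  by apply: integrable_pushforward => //; exact: measurable_funTS.
rewrite -[X in (\int[_]_x (_ * X))%E](@fineK _ (\int[P]_w (V w)%:E)%E).
  rewrite integralZr// EU fineK//; exact: integrable_fin_num.
exact: integrable_fin_num.
Qed.

End product_rule.

Section block_product.
Context d (T : measurableType d) (R : realType) (P : probability T R).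
Context (I : eqType) (m : nat) (X : I -> T -> 'rV[R]_m).
Hypothesis mX : forall i, random_vector (X i).
Hypothesis indX : mutually_independent P X.

Lemma Rintegral_block_mul (J K : seq I) (U V : T -> R) : uniq (J ++ K) ->
  measurable_fun setT (U : block X J -> R) ->
  measurable_fun setT (V : block X K -> R) -> L1 P U -> L1 P V ->
  L1 P (fun w => U w * V w) /\
  \int[P]_w (U w * V w) = (\int[P]_w U w) * (\int[P]_w V w).
Proof.
move=> uJK mU mV IU IV; apply: Rintegral_indep_mul => // A B mA mB.
apply: (indep_blocks mX indX uJK).
  by rewrite -[_ @^-1` _]setTI; exact: mU.
by rewrite -[_ @^-1` _]setTI; exact: mV.
Qed.

End block_product.

Lemma Rintegral_swap d1 d2 (T1 : measurableType d1) (T2 : measurableType d2)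
  (R : realType) (P1 : probability T1 R) (P2 : probability T2 R)
  (F : T1 * T2 -> R) (M : R) :
  measurable_fun setT F -> (forall z, `|F z| <= M) ->
  \int[P1]_x \int[P2]_y F (x, y) = \int[P2]_y \int[P1]_x F (x, y).
Proof.
move=> mF FM.
have iF : (P1 \x P2)%E.-integrable setT (EFin \o F).
  apply/integrable12ltyP; first exact/measurable_EFinP.
  apply: (@le_lt_trans _ _ (\int[P1]_x \int[P2]_y M%:E)%E).
    apply: ge0_le_integral => //=.
    - by move=> x _; apply: integral_ge0.
    - apply: (measurable_fun_fubini_tonelli_F (fun z => `|F z|%:E)) => //.
      by apply/measurable_EFinP; exact: measurableT_comp.
    - move=> x _; apply: ge0_le_integral => //=.
      + apply/measurable_EFinP; apply: measurableT_comp => //.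
        exact: measurableT_comp mF (pair1_measurable x).
      + by move=> y _; rewrite lee_fin.
  have cstE d (T : measurableType d) (P : probability T R) (c : \bar R) :
      (\int[P]_x c = c)%E.
    by rewrite (integral_cst P measurableT) [X in (_ * X)%E]probability_setT mule1.
  by under eq_integral do rewrite cstE; rewrite cstE ltry.
rewrite /Rintegral.
have /= F12 := Fubini iF.
transitivity (fine (\int[P1]_x \int[P2]_y (F (x, y))%:E)%E); last rewrite F12.
  congr fine; apply: eq_integral => x _; rewrite fineK//.
  apply: integrable_fin_num => //.
  apply: (@bounded_integrable _ _ _ P2 (fun y => F (x, y)) M) => //.
  exact: measurableT_comp mF (pair1_measurable x).
congr fine; apply: eq_integral => y _; rewrite fineK//.
apply: integrable_fin_num => //.
apply: (@bounded_integrable _ _ _ P1 (fun x => F (x, y)) M) => //.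
exact: measurableT_comp mF (pair2_measurable y).
Qed.

(** * Polynomial approximation and transforms determining laws *)

Section weierstrass.
Context (R : realType).

Lemma uniform_continuity_segment (f : R -> R) (a b e : R) :
  continuous f -> 0 < e ->
  exists2 dl : R, 0 < dl & forall x y, x \in `[a, b] -> `|y - x| < dl ->
    `|f y - f x| <= e.
Proof.
move=> cf e0.
have /compact_near_coveringP cK := @segment_compact R a b.
pose Q (dl x : R) := forall y, `|y - x| < dl -> `|f y - f x| <= e.
have : \forall dl \near (0 : R)^'+, `[a, b]%classic `<=` Q dl.
  apply: cK => x _.
  have e20 : 0 < e / 2 by rewrite divr_gt0.
  have /cvgrPdist_le/(_ _ e20) [eta /= eta0 heta] := cf x.
  have eta2 : 0 < eta / 2 by rewrite divr_gt0.
  near=> x' dl => y /= yx'.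
  have x'x : `|x - x'| < eta / 2 by near: x'; exact: cvgr_dist_lt.
  have dle : dl < eta / 2 by near: dl; exact: nbhs_right_lt.
  have h1 : `|f x - f x'| <= e / 2 by apply: heta => /=; lra.
  have h2 : `|f x - f y| <= e / 2.
    apply: heta => /=; apply: (@le_lt_trans _ _ (`|x - x'| + `|y - x'|)).
      by rewrite (_ : x - y = (x - x') - (y - x')) ?ler_normB//; ring.
    lra.
  rewrite (_ : f y - f x' = (f x - f x') - (f x - f y)); last by ring.
  by apply: le_trans (ler_normB _ _) _; lra.
move=> H; have [dl [dl0 hdl]] := filter_ex (filterI (@nbhs_right_gt R 0) H).
by exists dl => // x y xab; apply: hdl.
Unshelve. all: by end_near. Qed.

(* De Casteljau's recursion, so that no binomial sum has to be manipulated. *)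
Fixpoint bernstein (n : nat) (g : nat -> R) : {poly R} :=
  if n is n'.+1 then (1 - 'X) * bernstein n' g + 'X * bernstein n' (fun k => g k.+1)
  else (g 0%N)%:P.

Lemma bernsteinS n g (x : R) : (bernstein n.+1 g).[x] =
  (1 - x) * (bernstein n g).[x] + x * (bernstein n (fun k => g k.+1)).[x].
Proof. by rewrite /= !hornerE. Qed.

Lemma bernstein_le n g h (x : R) : 0 <= x <= 1 ->
  (forall k, (k <= n)%N -> g k <= h k) -> (bernstein n g).[x] <= (bernstein n h).[x].
Proof.
move=> /andP[x0 x1]; elim: n g h => [|n IHn] g h gh; first by rewrite !hornerE gh.
rewrite !bernsteinS lerD// ler_wpM2l ?subr_ge0//; apply: IHn => k kn; apply: gh => //.
exact: leqW.
Qed.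

(** Mean and variance of the binomial law in one identity. The centre [c] has to stay free: the
    shifted sequence of the recursion is the same quadratic centred at [c - 1]. *)
Lemma bernstein_quadratic n (c A B x : R) :
  (bernstein n (fun k => A + B * (k%:R - c) ^+ 2)).[x] =
  A + B * (n%:R * x * (1 - x) + (n%:R * x - c) ^+ 2).
Proof.
elim: n c => [|n IHn] c; first by rewrite /= hornerE; ring.
rewrite bernsteinS IHn.
have -> : (fun k => A + B * (k.+1%:R - c) ^+ 2) = (fun k => A + B * (k%:R - (c - 1)) ^+ 2).
  by apply/funext => k; rewrite -natr1; congr (_ + _ * _ ^+ 2); ring.
by rewrite IHn -natr1; ring.
Qed.

(** The oscillation of [f] is at most [e / 2 + K * (u - v) ^+ 2]: uniform continuity handles close
    points, the bound [2 * M] distant ones. The Bernstein operator is monotone and known on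
    quadratics, so its error at [x] is at most [e / 2 + K / N]. *)
Lemma weierstrass (f : R -> R) (e : R) : continuous f -> 0 < e ->
  exists p : {poly R}, forall x, 0 <= x <= 1 -> `|p.[x] - f x| <= e.
Proof.
move=> cf e0.
have e20 : 0 < e / 2 by rewrite divr_gt0.
have [dl dl0 fdl] := uniform_continuity_segment 0 1 cf e20.
have [M M0 fM] : exists2 M, 0 <= M & forall x, 0 <= x <= 1 -> `|f x| <= M.
  have cnf : {within `[(0:R), 1], continuous (fun x => `|f x|)}.
    apply: continuous_subspaceT => x; apply: continuous_comp; first exact: cf.
    exact: norm_continuous.
  have [c _ hc] := EVT_max ler01 cnf.
  by exists `|f c| => // x x01; apply: hc; rewrite in_itv.
pose K := 2 * M / dl ^+ 2.
have K0 : 0 <= K by apply: divr_ge0; [exact: mulr_ge0|exact: sqr_ge0].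
have fK u v : 0 <= u <= 1 -> 0 <= v <= 1 -> `|f u - f v| <= e / 2 + K * (u - v) ^+ 2.
  move=> u01 v01; have [uv|uv] := ltP `|u - v| dl.
    apply: (le_trans (fdl v u _ uv)); first by rewrite in_itv.
    by rewrite lerDl mulr_ge0 ?sqr_ge0.
  apply: (@le_trans _ _ (2 * M)).
    by apply: le_trans (ler_normB _ _) _; have := fM u u01; have := fM v v01; lra.
  apply: (@le_trans _ _ (K * dl ^+ 2)); first by rewrite /K divfK// expf_neq0// gt_eqF.
  apply: (@le_trans _ _ (K * (u - v) ^+ 2)); last by rewrite lerDr ltW.
  rewrite ler_wpM2l// -[leRHS]real_normK ?num_real// lerXn2r// nnegrE.
  exact: ltW.
pose N := (Num.truncn (K / (e / 2))).+1.
have N0 : (0 : R) < N%:R by rewrite ltr0n.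
have KN : K <= e / 2 * N%:R.
  rewrite mulrC -ler_pdivrMr//; apply/ltW; exact: Num.Theory.truncnS_gt.
exists (bernstein N (fun k => f (k%:R / N%:R))) => x /andP[x0 x1].
have x01 : 0 <= x <= 1 by rewrite x0.
have kN k : (k <= N)%N -> 0 <= (k%:R / N%:R : R) <= 1.
  by move=> kN; rewrite divr_ge0//= ler_pdivrMr// mul1r ler_nat.
have NE k : K * (k%:R / N%:R - x) ^+ 2 = K / N%:R ^+ 2 * (k%:R - N%:R * x) ^+ 2.
  by field; rewrite gt_eqF.
have bnd : K / N%:R ^+ 2 * (N%:R * x * (1 - x) + (N%:R * x - N%:R * x) ^+ 2) <= e / 2.
  rewrite subrr expr0n addr0.
  have -> : K / N%:R ^+ 2 * (N%:R * x * (1 - x)) = K / N%:R * (x * (1 - x)).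
    by field; rewrite gt_eqF.
  apply: (@le_trans _ _ (K / N%:R)); last by rewrite ler_pdivrMr.
  by rewrite ler_piMr ?divr_ge0 ?(ltW N0)//; nra.
rewrite ler_norml; apply/andP; split.
  have : (bernstein N (fun k => (f x - e / 2) + (- (K / N%:R ^+ 2)) * (k%:R - N%:R * x) ^+ 2)).[x]
    <= (bernstein N (fun k => f (k%:R / N%:R))).[x].
    apply: bernstein_le => // k /kN k01; rewrite mulNr -NE.
    by have := fK _ _ k01 x01; rewrite ler_norml => /andP[? _]; lra.
  rewrite bernstein_quadratic mulNr; lra.
have : (bernstein N (fun k => f (k%:R / N%:R))).[x] <=
  (bernstein N (fun k => (f x + e / 2) + (K / N%:R ^+ 2) * (k%:R - N%:R * x) ^+ 2)).[x].
  apply: bernstein_le => // k /kN k01; rewrite -NE.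
  by have := fK _ _ k01 x01; rewrite ler_norml => /andP[_ ?]; lra.
rewrite bernstein_quadratic; lra.
Qed.

End weierstrass.

Section test_functions.
Context (R : realType).

Lemma integrable_bounded_comp d (T : measurableType d) (P : probability T R)
  (W : T -> R) (f : R -> R) (B : R) : measurable_fun setT W ->
  continuous f -> (forall x, `|f x| <= B) -> L1 P (fun w => f (W w)).
Proof.
move=> mW cf fB; apply: (@bounded_integrable _ _ _ _ _ B) => //.
by apply: measurableT_comp mW; exact: continuous_measurable_fun.
Qed.

(* A bounded continuous function of Q is approximated by polynomials in expR (- Q). *)
Lemma laplace_law d1 (T1 : measurableType d1) (P1 : probability T1 R)
  d2 (T2 : measurableType d2) (P2 : probability T2 R) (Q1 : T1 -> R) (Q2 : T2 -> R) :
  measurable_fun setT Q1 -> measurable_fun setT Q2 ->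
  (forall w, 0 <= Q1 w) -> (forall w, 0 <= Q2 w) ->
  (forall n : nat, \int[P1]_w expR (- (n%:R * Q1 w)) = \int[P2]_w expR (- (n%:R * Q2 w))) ->
  forall (f : R -> R) (B : R), continuous f -> (forall x, `|f x| <= B) ->
  \int[P1]_w f (Q1 w) = \int[P2]_w f (Q2 w).
Proof.
move=> mQ1 mQ2 Q1_ge0 Q2_ge0 LQ f B cf fB.
(* [f] in the variable [expR (- x)]; cutting the argument at [expR (- M)] makes [g M] continuous on
   the whole line and amounts to replacing [x] by its minimum with [M]. *)
pose g (M u : R) := f (- ln (Num.max u (expR (- M)))).
have cg M : continuous (g M).
  move=> u; apply: continuous_comp; last exact: cf.
  apply: cvgN; apply: continuous_comp.
    by apply: continuous_max; [exact: cvg_id|exact: cvg_cst].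
  by apply: continuous_ln; rewrite lt_max expR_gt0 orbT.
have gE M x : g M (expR (- x)) = f (Num.min x M).
  rewrite /g; congr f; case: (leP x M) => xM.
    by rewrite max_l ?ler_expR ?lerN2// expRK opprK.
  by rewrite max_r ?ler_expR ?lerN2 ?ltW// expRK opprK.
have cont_min M : continuous (fun x : R => f (Num.min x M)).
  move=> u; apply: continuous_comp; last exact: cf.
  by apply: continuous_min; [exact: cvg_id|exact: cvg_cst].
have eq_min (M : R) : \int[P1]_w f (Num.min (Q1 w) M) = \int[P2]_w f (Num.min (Q2 w) M).
  apply/eqP; rewrite -subr_eq0 -normr_le0; apply/ler_addgt0Pl => e e0; rewrite addr0.
  have e20 : 0 < e / 2 by rewrite divr_gt0.
  have [p hp] := weierstrass (cg M) e20.
  have bnd d (T : measurableType d) (P : probability T R) (Q : T -> R) :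
      measurable_fun setT Q -> (forall w, 0 <= Q w) ->
      `|\int[P]_w f (Num.min (Q w) M) -
        \sum_(i < size p) p`_i * \int[P]_w expR (- (i%:R * Q w))| <= e / 2.
    move=> mQ Q0.
    have Ie (i : nat) : L1 P (fun w => expR (- (i%:R * Q w))).
      apply: (@bounded_integrable _ _ _ _ _ 1).
        by apply: measurableT_comp => //; apply: measurableT_comp => //; exact: measurable_funM.
      move=> w; rewrite ger0_norm ?expR_ge0// -expR0 ler_expR oppr_le0 mulr_ge0//.
    have -> : \sum_(i < size p) p`_i * \int[P]_w expR (- (i%:R * Q w)) =
        \int[P]_w p.[expR (- Q w)].
      under [RHS]eq_Rintegral => w _ do rewrite horner_coef.
      rewrite Rintegral_sum => [|i]; last first.
        apply: integrableRZ; have := Ie i; apply: eq_integrable => // w _ /=.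
        by rewrite -expRM_natl mulrN.
      apply: eq_bigr => i _; rewrite -RintegralZl//; apply: eq_Rintegral => w _.
      by rewrite -expRM_natl mulrN.
    rewrite -[leRHS](Rintegral_prob_cst P); apply: Rintegral_dist_le.
    - exact: (integrable_bounded_comp P mQ (cont_min M) (fun=> fB _)).
    - have := @integrableR_sum _ _ _ P _ (index_enum 'I_(size p)) (fun i w => p`_i * expR (- (i%:R * Q w)))
        (fun i => integrableRZ _ (Ie i)).
      apply: eq_integrable => // w _ /=; rewrite horner_coef; congr EFin.
      by apply: eq_bigr => i _; rewrite -expRM_natl mulrN.
    - move=> w; rewrite -gE distrC; apply: hp.
      by rewrite expR_ge0/= -expR0 ler_expR oppr_le0.
    - exact: integrableR_cst.
  have h1 := bnd _ _ P1 _ mQ1 Q1_ge0; have h2 := bnd _ _ P2 _ mQ2 Q2_ge0.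
  rewrite -(eq_bigr _ (fun (i : 'I_(size p)) _ => congr1 (fun z => p`_i * z) (LQ i))) in h2.
  rewrite (splitr e); apply: le_trans (lerD h1 h2).
  by rewrite [X in _ <= _ + X]distrC; exact: ler_distD.
have lim d (T : measurableType d) (P : probability T R) (Q : T -> R) :
    measurable_fun setT Q ->
    (\int[P]_w f (Num.min (Q w) n%:R)) @[n --> \oo] --> \int[P]_w f (Q w).
  move=> mQ; apply: (@Rintegral_dominated_cvg _ _ _ _ _ _ (fun=> B)).
  - move=> n; exact: (integrable_measurable (integrable_bounded_comp P mQ (cont_min n%:R) (fun=> fB _))).
  - exact: (integrable_measurable (integrable_bounded_comp P mQ cf fB)).
  - apply: aeW => w; apply: cvg_near_cst.
    exists (Num.truncn (Q w)).+1 => // n /= hn; rewrite min_l//.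
    by apply/ltW/(lt_le_trans (Num.Theory.truncnS_gt _)); rewrite ler_nat.
  - exact: integrableR_cst.
  - by move=> n w; exact: fB.
have lim1 := lim _ _ P1 _ mQ1; have lim2 := lim _ _ P2 _ mQ2.
have E12 : (fun n : nat => \int[P1]_w f (Num.min (Q1 w) n%:R)) =
    (fun n : nat => \int[P2]_w f (Num.min (Q2 w) n%:R)).
  by apply/funext => n; exact: eq_min.
by rewrite E12 in lim1; exact: (cvg_unique _ lim1 lim2).
Qed.

End test_functions.

(** * A continuity theorem for trigonometric test functions and bounded second moments *)

Section levy.
Context (R : realType) (dsp : measure_display) (T : nat -> measurableType dsp)
  (P : forall k, probability (T k) R) (W : forall k, T k -> R)
  (dsp' : measure_display) (T' : measurableType dsp') (P' : probability T' R)
  (L : T' -> R) (C : R).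
Arguments W k _ : clear implicits.
Hypotheses (mW : forall k, measurable_fun setT (W k)) (mL : measurable_fun setT L).
Hypothesis W2 : forall k, L1 (P k) (fun w => W k w ^+ 2).
Hypothesis W2C : forall k, \int[P k]_w (W k w ^+ 2) <= C.
Hypothesis cvg_cos : forall t u : R,
  \int[P k]_w cos (t * W k w + u) @[k --> \oo] --> \int[P']_w cos (t * L w + u).

Let good (F : R -> R) := [/\ continuous F, (exists B, forall x, `|F x| <= B) &
  \int[P k]_w F (W k w) @[k --> \oo] --> \int[P']_w F (L w)].

Let good_cos t u : good (fun x => cos (t * x + u)).
Proof.
split; last exact: cvg_cos; last by exists 1 => x; exact: cos_max.
move=> x; apply: continuous_comp; last exact: continuous_cos.
by apply: cvgD; [apply: cvgM => //; exact: cvg_cst|exact: cvg_cst].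
Qed.

Let good_lin a F b G : good F -> good G -> good (fun x => a * F x + b * G x).
Proof.
move=> [cF [BF hF] lF] [cG [BG hG] lG]; split.
- by move=> x; apply: cvgD; apply: cvgM; [exact: cvg_cst|exact: cF|exact: cvg_cst|exact: cG].
- exists (`|a| * BF + `|b| * BG) => x; apply: le_trans (ler_normD _ _) _.
  by rewrite !normrM lerD// ler_wpM2l.
- have IF d (S : measurableType d) (p : probability S R) V :
    measurable_fun setT V -> \int[p]_w (a * F (V w) + b * G (V w)) =
      a * \int[p]_w F (V w) + b * \int[p]_w G (V w).
    move=> mV; have I1 := integrable_bounded_comp p mV cF hF.
    have I2 := integrable_bounded_comp p mV cG hG.
    rewrite RintegralD//; [|exact: integrableRZ|exact: integrableRZ].
    by rewrite !RintegralZl.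
  rewrite IF//; under eq_fun do rewrite IF//.
  by apply: cvgD; apply: cvgM => //; exact: cvg_cst.
Qed.

(* On |x| <= M the function sn M is injective, so that polynomials in sn M,
   which are trigonometric, approximate continuous functions there. *)
Let sn (M x : R) := (1 + sin (x / M)) / 2.

(** Multiplying by [sn M x] stays within cosines because [2 * sin a * cos c = sin (a + c) + sin (a -
    c)], with each sine written as a cosine shifted by [pi / 2]. The cosine factor with free [t] and
    [u] makes the statement inductive. *)
Let good_poly M (p : {poly R}) : forall t u, good (fun x => p.[sn M x] * cos (t * x + u)).
Proof.
elim/poly_ind: p => [|p c IHp] t u.
  have := good_lin 0 0 (good_cos t u) (good_cos t u).
  by congr good; apply/funext => x /=; rewrite horner0; ring.
have := good_lin 1 1 (good_lin (2^-1) c (IHp t u) (good_cos t u))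
  (good_lin (4^-1) (4^-1) (IHp (M^-1 + t) (u - pi / 2)) (IHp (M^-1 - t) (- u - pi / 2))).
congr good; apply/funext => x /=; rewrite hornerMXaddC.
rewrite (_ : (M^-1 + t) * x + (u - pi / 2) = (x / M + (t * x + u)) - pi / 2); last by ring.
rewrite (_ : (M^-1 - t) * x + (- u - pi / 2) = (x / M - (t * x + u)) - pi / 2); last by ring.
rewrite !cosBpihalf sinD sinB [in RHS]/sn.
by field.
Qed.

(** A trigonometric polynomial [F] approximates [f] on [|x| <= M]. Outside, the error is bounded and
    its weight is small: by the second moments for [W k], uniformly in [k], and by dominated
    convergence for [L]. *)
Lemma levy_continuity (f : R -> R) (B : R) : continuous f -> (forall x, `|f x| <= B) ->
  \int[P k]_w f (W k w) @[k --> \oo] --> \int[P']_w f (L w).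
Proof.
move=> cf fB; apply/cvgrPdist_le => e e0.
have B0 : 0 <= B by apply: le_trans (fB 0).
have C0 : 0 <= C.
  by apply: le_trans (@W2C 0); apply: Rintegral_ge0 => w _; exact: sqr_ge0.
(* A continuous majorant of the indicator of [|x| > n.+1], itself dominated by a multiple of
   [x ^+ 2]. *)
pose h (n : nat) (x : R) := Num.min 1 ((x / n.+1%:R) ^+ 2).
have h_ge0 n x : 0 <= h n x by rewrite le_min ler01 sqr_ge0.
have h_le1 n x : h n x <= 1 by rewrite ge_min lexx.
have ch n : continuous (h n).
  move=> x; rewrite /h; apply: (@continuous_min R R (cst 1) (fun z => (z / n.+1%:R) ^+ 2)).
    exact: cvg_cst.
  apply: (@continuous_comp _ _ _ (fun z : R => z / n.+1%:R) (fun z => z ^+ 2)).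
    by apply: cvgM => //; exact: cvg_cst.
  exact: exprn_continuous.
have h_norm n x : `|h n x| <= 1 by rewrite ger0_norm.
have hL : \int[P']_w h n (L w) @[n --> \oo] --> (0 : R).
  rewrite -(Rintegral_prob_cst P' 0).
  apply: (@Rintegral_dominated_cvg _ _ _ _ _ _ (fun=> 1)) => //.
  - by move=> n; apply: (integrable_measurable (integrable_bounded_comp P' mL (ch n) (h_norm n))).
  - apply: aeW => w; apply: (@squeeze_cvgr _ _ _ _ (cst 0) (fun n => (L w / n.+1%:R) ^+ 2)).
    + by apply: nearW => n; rewrite h_ge0/= ge_min lexx orbT.
    + exact: cvg_cst.
    + rewrite [X in _ --> X](_ : _ = (L w * 0) ^+ 2); last by rewrite mulr0 expr0n.
      under eq_fun do rewrite expr2; rewrite expr2.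
      by apply: cvgM; apply: cvgM; [exact: cvg_cst|exact: cvg_harmonic|
        exact: cvg_cst|exact: cvg_harmonic].
  - exact: integrableR_cst.
pose e' := e / 6.
have e'0 : 0 < e' by rewrite divr_gt0.
(* Bounds [|f - F|] everywhere: [|f| <= B], and [F] is within [e'] of a function bounded by [B]. *)
pose K := 2 * B + e'.
have K0 : 0 < K by rewrite ltr_wpDl// mulr_ge0.
have [n hn1 hn2] : exists2 n, K * \int[P']_w h n (L w) <= e' & K * C / n.+1%:R ^+ 2 <= e'.
  have ev1 : \forall n \near \oo, \int[P']_w h n (L w) <= e' / K.
    have e'K : 0 < e' / K by rewrite divr_gt0.
    move/cvgrPdist_le : hL => /(_ _ e'K); apply: filterS => n.
    by rewrite sub0r normrN ger0_norm// Rintegral_ge0.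
  have ev2 : \forall n \near \oo, K * C / n.+1%:R ^+ 2 <= e'.
    exists (Num.truncn (K * C / e')).+1 => // n /= hn.
    rewrite ler_pdivrMr ?exprn_gt0 ?ltr0n// [leRHS]mulrC -ler_pdivrMr//.
    have h1 : K * C / e' <= n.+1%:R.
      by apply/ltW/(lt_le_trans (Num.Theory.truncnS_gt _)); rewrite ler_nat ltnW.
    by apply: le_trans h1 _; rewrite expr2 ler_peMl// ler1n.
  have [n [h1 h2]] := filter_ex (filterI ev1 ev2).
  by exists n => //; rewrite mulrC -ler_pdivlMr.
pose M : R := n.+1%:R.
have M0 : 0 < M by rewrite ltr0n.
pose s1 : R := sin 1.
have pi21 : 1 <= pi / 2 :> R by exact: pihalf_ge1.
have s1_lt1 : s1 < 1.
  rewrite lt_neqAle sin_le1 andbT; apply/eqP => s11.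
  have := @cos1_gt0 R; rewrite sin1cos0 ?ltxx//.
  by rewrite -/s1 s11 normr1.
have s1_ge0 : 0 <= s1 by apply: sin_ge0_pi; rewrite ler01/=; lra.
(* [asin] inverts [sn]; the clamp at [sin 1] keeps its argument away from [-1] and [1], and has no
   effect when [|x| <= M]. *)
pose g (u : R) := f (M * asin (Num.max (- s1) (Num.min (2 * u - 1) s1))).
have cg : continuous g.
  move=> u; apply: continuous_comp; last exact: cf.
  apply: cvgM; first exact: cvg_cst.
  apply: continuous_comp; last first.
    apply: continuous_asin; rewrite lt_max gt_max gt_min s1_lt1 orbT andbT.
    by apply/andP; split; [apply/orP; left|]; lra.
  apply: (@continuous_max _ _ (cst (- s1)) (fun u : R => Num.min (2 * u - 1) s1)).
    exact: cvg_cst.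
  apply: (@continuous_min _ _ (fun u : R => 2 * u - 1) (cst s1)); last exact: cvg_cst.
  by apply: cvgB; [apply: cvgM => //; exact: cvg_cst|exact: cvg_cst].
have gB u : `|g u| <= B by exact: fB.
have gE x : `|x| <= M -> g (sn M x) = f x.
  move=> xM; rewrite /g /sn.
  have -> : 2 * ((1 + sin (x / M)) / 2) - 1 = sin (x / M) by field.
  have xM1 : - 1 <= x / M <= 1.
    by rewrite ler_pdivlMr// ler_pdivrMr// mulN1r mul1r -ler_norml.
  have inpi (z : R) : -1 <= z <= 1 -> z \in `[- (pi / 2), pi / 2].
    by move=> /andP[? ?]; rewrite in_itv/=; apply/andP; split; lra.
  have i1 : 1 \in `[- (pi / 2), pi / 2 : R] by apply: inpi; apply/andP; split; lra.
  have iN1 : -1 \in `[- (pi / 2), pi / 2 : R] by apply: inpi; apply/andP; split; lra.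
  have hi : sin (x / M) <= s1.
    have [xl|xl] := ltP (x / M) 1; first by rewrite ltW// ltr_sin// inpi.
    by have -> : x / M = 1 by case/andP: xM1 => ? ?; apply/le_anti/andP.
  have lo : - s1 <= sin (x / M).
    rewrite -sinN; have [xl|xl] := ltP (-1) (x / M).
      by rewrite ltW// ltr_sin// inpi.
    by have -> : x / M = -1 by case/andP: xM1 => ? ?; apply/le_anti/andP.
  rewrite min_l// max_r// sinK ?inpi//.
  by congr f; field; rewrite gt_eqF.
have [p hp] := weierstrass cg e'0.
have sn01 x : 0 <= sn M x <= 1.
  rewrite /sn; have := sin_geN1 (x / M); have := sin_le1 (x / M) => ? ?.
  by apply/andP; split; lra.
pose F x := p.[sn M x].
have [cF [BF FB] lF] : good F.
  have := good_poly M p 0 0; congr good; apply/funext => x.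
  by rewrite mul0r addr0 cos0 mulr1.
have fF x : `|f x - F x| <= e' + K * h n x.
  have [xM|xM] := leP `|x| M.
    rewrite -gE// distrC; apply: le_trans (hp _ (sn01 x)) _.
    by rewrite lerDl mulr_ge0// ltW.
  have -> : h n x = 1.
    rewrite /h min_l// -real_normK ?num_real// expr_ge1 ?normr_ge0//.
    by rewrite normrM normfV (gtr0_norm M0) ler_pdivlMr// mul1r ltW.
  rewrite mulr1; have := hp _ (sn01 x); have := gB (sn M x); have := fB x.
  have := ler_normB (f x) (F x); have := ler_normD (F x - g (sn M x)) (g (sn M x)).
  rewrite subrK /K -/(F x); lra.
have hW x : h n x <= x ^+ 2 / M ^+ 2 by rewrite /h ge_min expr_div_n lexx orbT.
have bnd d (S : measurableType d) (Q : probability S R) V : measurable_fun setT V ->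
    `|\int[Q]_w f (V w) - \int[Q]_w F (V w)| <= e' + K * \int[Q]_w h n (V w).
  move=> mV; have Ih := integrable_bounded_comp Q mV (ch n) (h_norm n).
  rewrite -[e' in leRHS](Rintegral_prob_cst Q) -RintegralZl// -RintegralD//; last 2 first.
  - exact: integrableR_cst.
  - exact: integrableRZ.
  apply: Rintegral_dist_le; [exact: (integrable_bounded_comp Q mV cf fB)|
    exact: (integrable_bounded_comp Q mV cF FB)| by move=> w; exact: fF|].
  by apply: integrableRD; [exact: integrableR_cst|exact: integrableRZ].
near=> k.
have bW : `|\int[P k]_w f (W k w) - \int[P k]_w F (W k w)| <= 2 * e'.
  have bk := bnd _ _ (P k) _ (@mW k); apply: (le_trans bk).
  have : \int[P k]_w h n (W k w) <= C / M ^+ 2.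
    apply: (@le_trans _ _ (\int[P k]_w (W k w ^+ 2 / M ^+ 2))).
      apply: le_Rintegral => //.
      - exact: (integrable_bounded_comp (P k) (@mW k) (ch n) (h_norm n)).
      - by have := integrableRZ (M ^- 2) (@W2 k); apply: eq_integrable => // w _ /=; rewrite mulrC.
    by rewrite RintegralZr// ler_pM2r// invr_gt0 exprn_gt0.
  move=> /(ler_wpM2l (ltW K0)); rewrite mulrA => /le_trans /(_ hn2); lra.
have bL : `|\int[P']_w f (L w) - \int[P']_w F (L w)| <= 2 * e'.
  by apply: le_trans (bnd _ _ P' _ mL) _; lra.
have bF : `|\int[P']_w F (L w) - \int[P k]_w F (W k w)| <= e'.
  by near: k; exact: cvgr_dist_le lF _ e'0.
have e'E : e = 6 * e' by rewrite /e'; field.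
move: bW bL bF.
move: (\int[P k]_w f (W k w)) (\int[P k]_w F (W k w)) (\int[P']_w f (L w))
  (\int[P']_w F (L w)) => x1 x2 x3 x4.
rewrite !ler_norml => /andP[? ?] /andP[? ?] /andP[? ?]; apply/andP; split; lra.
Unshelve. all: by end_near. Qed.

End levy.

(** * Weighted sums of centred chi-square variables *)

Section gaussian_sequence.
Context (R : realType) (d : measure_display) (T : measurableType d)
  (P : probability T R) (Y : nat -> T -> R) (Z : T -> R).
Hypotheses (mY : forall s, measurable_fun setT (Y s)) (mZ : measurable_fun setT Z).
Hypotheses (lawY : forall s, normal_law P (Y s) 0 1) (lawZ : normal_law P Z 0 1).

Definition joint (o : option nat) (w : T) : 'rV[R]_1 :=
  (match o with None => Z w | Some s => Y s w end)%:M.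

Hypothesis indYZ : mutually_independent P joint.

Let jointE o w l : joint o w 0 l = match o with None => Z w | Some s => Y s w end.
Proof. by rewrite /joint mxE (ord1 l) eqxx mulr1n. Qed.

Let mjoint o : random_vector (joint o).
Proof. by move=> l; under eq_fun do rewrite jointE; case: o. Qed.

(** The blocks on [past n] form the natural filtration of [Y]; each induction on the number of terms
    multiplies a function of the past by one of [Y n]. *)
Definition past (n : nat) : seq (option nat) := [seq Some s | s <- iota 0 n].

Local Notation pastT n := (block joint (past n)).

Lemma measurable_past_Y n s : (s < n)%N -> measurable_fun setT (Y s : pastT n -> R).
Proof.
move=> sn; have sp : Some s \in past n.
  by rewrite (mem_map (@Some_inj _)) mem_iota.
by have := @measurable_coord _ T R _ _ joint (past n) (Some s) 0 sp;
  under eq_fun do rewrite jointE.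
Qed.

Lemma past_mul_Y n (U : T -> R) (g : R -> R) :
  measurable_fun setT (U : pastT n -> R) -> measurable_fun setT g ->
  L1 P U -> L1 P (fun w => g (Y n w)) ->
  L1 P (fun w => U w * g (Y n w)) /\
  \int[P]_w (U w * g (Y n w)) = (\int[P]_w U w) * (\int[P]_w g (Y n w)).
Proof.
move=> mU mg IU Ig.
apply: (Rintegral_block_mul mjoint indYZ (J := past n) (K := [:: Some n])) => //.
  rewrite cats1 rcons_uniq (map_inj_uniq (@Some_inj _)) iota_uniq andbT.
  by rewrite (mem_map (@Some_inj _)) mem_iota ltnn.
apply: (measurableT_comp (g := (Y n : block joint [:: Some n] -> R)) mg).
have := @measurable_coord _ T R _ _ joint [:: Some n] (Some n) 0 (mem_head _ _).
by under eq_fun do rewrite jointE.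
Qed.

Lemma past_mul_Z n (U : T -> R) (g : R -> R) :
  measurable_fun setT (U : pastT n -> R) -> measurable_fun setT g ->
  L1 P U -> L1 P (fun w => g (Z w)) ->
  L1 P (fun w => U w * g (Z w)) /\
  \int[P]_w (U w * g (Z w)) = (\int[P]_w U w) * (\int[P]_w g (Z w)).
Proof.
move=> mU mg IU Ig.
apply: (Rintegral_block_mul mjoint indYZ (J := past n) (K := [:: None])) => //.
  rewrite cats1 rcons_uniq (map_inj_uniq (@Some_inj _)) iota_uniq andbT.
  by apply/mapP => -[].
apply: (measurableT_comp (g := (Z : block joint [:: None] -> R)) mg).
have := @measurable_coord _ T R _ _ joint [:: None] None 0 (mem_head _ _).
by under eq_fun do rewrite jointE.
Qed.

Lemma past_measurable n (U : T -> R) :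
  measurable_fun setT (U : pastT n -> R) -> measurable_fun setT U.
Proof. by move=> h; exact: (measurable_fun_block mjoint h). Qed.

Definition xsum (be : nat -> R) (n : nat) (w : T) : R := \sum_(s < n) be s * xi (Y s w).

Lemma measurable_past_xsum be n m : (n <= m)%N ->
  measurable_fun setT (xsum be n : pastT m -> R).
Proof.
move=> nm; apply: measurable_sum => s; apply: measurable_funM => //.
apply: (measurableT_comp (g := (Y s : pastT m -> R)) (@measurable_xi R)).
by apply: measurable_past_Y; exact: leq_trans nm.
Qed.

Lemma measurable_xsum be n : measurable_fun setT (xsum be n).
Proof. exact: past_measurable (measurable_past_xsum be (leqnn n)). Qed.

Lemma xsumS be n w : xsum be n.+1 w = xsum be n w + be n * xi (Y n w).
Proof. by rewrite /xsum big_ord_recr. Qed.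

(** In the addition formula the sine of the new term has expectation zero by symmetry, so only the
    product of the cosines remains. *)
Lemma Rintegral_cos_lin (g : nat -> R) n (c : R) :
  \int[P]_w cos (c * \sum_(s < n) g s * Y s w) = expR (- (c ^+ 2 * (\sum_(s < n) g s ^+ 2) / 2)).
Proof.
elim: n => [|n IHn].
  under eq_Rintegral do rewrite big_ord0 mulr0 cos0.
  by rewrite Rintegral_prob_cst big_ord0 mulr0 mul0r oppr0 expR0.
have mS : measurable_fun setT ((fun w => \sum_(s < n) g s * Y s w) : pastT n -> R).
  apply: measurable_sum => s; apply: measurable_funM => //; exact: measurable_past_Y.
have mcos (h : R -> R) : continuous h ->
    measurable_fun setT ((fun w => h (c * \sum_(s < n) g s * Y s w)) : pastT n -> R).
  move=> ch; apply: (measurableT_comp (continuous_measurable_fun ch)).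
  exact: measurable_funM.
have cG h : continuous h -> continuous (fun y : R => h (c * (g n * y)) : R).
  move=> ch y; apply: continuous_comp; last exact: ch.
  by apply: cvgM; [exact: cvg_cst|apply: cvgM => //; exact: cvg_cst].
have bound (h : R -> R) : continuous h -> (forall x, `|h x| <= 1) ->
    L1 P (fun w => h (c * \sum_(s < n) g s * Y s w)) /\
    L1 P (fun w => h (c * (g n * Y n w))).
  move=> ch h1; split.
    apply: (@bounded_integrable _ _ _ _ _ 1) => //.
    exact: past_measurable (mcos h ch).
  apply: (@integrable_bounded_comp _ _ _ _ _ (fun y => h (c * (g n * y))) 1) => //.
  exact: cG.
have [Ic1 Ic2] := bound _ (@continuous_cos R) (@cos_max R).
have [Is1 Is2] := bound _ (@continuous_sin R) (@sin_max R).
have [Icc Ecc] := past_mul_Y (mcos _ (@continuous_cos R))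
  (continuous_measurable_fun (cG _ (@continuous_cos R))) Ic1 Ic2.
have [Iss Ess] := past_mul_Y (mcos _ (@continuous_sin R))
  (continuous_measurable_fun (cG _ (@continuous_sin R))) Is1 Is2.
under eq_Rintegral do rewrite big_ord_recr mulrDr cosD.
rewrite RintegralB// Ecc Ess IHn.
have cn t u : \int[P]_w cos (t * Y n w + u) = cos u * expR (- (t ^+ 2 / 2)).
  have := Rintegral_cos_normal ltr01 (mY n) (lawY n) t u.
  rewrite expr1n mulr1 => <-; apply: eq_Rintegral => w _; by rewrite subr0.
have -> : \int[P]_w cos (c * (g n * Y n w)) = expR (- ((c * g n) ^+ 2 / 2)).
  have := cn (c * g n) 0; rewrite cos0 mul1r => <-.
  by apply: eq_Rintegral => w _; rewrite addr0 mulrA.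
have -> : \int[P]_w sin (c * (g n * Y n w)) = 0.
  have := cn (c * g n) (- (pi / 2)); rewrite cosN cos_pihalf mul0r => <-.
  by apply: eq_Rintegral => w _; rewrite cosBpihalf mulrA.
by rewrite mulr0 subr0 -expRD; congr expR; rewrite big_ord_recr /= exprMn; field.
Qed.

Lemma Rintegral_exp_quad (la : nat -> R) n (t : R) : 0 <= t -> (forall s, 0 <= la s) ->
  \int[P]_w expR (- (t * \sum_(s < n) la s * Y s w ^+ 2)) =
  \prod_(s < n) (Num.sqrt (1 + 2 * (t * la s)))^-1.
Proof.
move=> t0 la0.
have c2 a : continuous (fun y : R => expR (- (a * y ^+ 2)) : R).
  move=> y; apply: continuous_comp; last exact: continuous_expR.
  by apply: cvgN; apply: cvgM; [exact: cvg_cst|exact: exprn_continuous].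
elim: n => [|n IHn].
  under eq_Rintegral do rewrite big_ord0 mulr0 oppr0 expR0.
  by rewrite Rintegral_prob_cst big_ord0.
under eq_Rintegral do rewrite big_ord_recr/= mulrDr opprD expRD mulrA.
have mS : measurable_fun setT
    ((fun w => expR (- (t * \sum_(s < n) la s * Y s w ^+ 2))) : pastT n -> R).
  apply: measurableT_comp => //; apply: measurableT_comp => //.
  apply: measurable_funM => //; apply: measurable_sum => s; apply: measurable_funM => //.
  by apply: measurable_funX; exact: measurable_past_Y.
have [|||_ ->] := @past_mul_Y n _ (fun y => expR (- (t * la n * y ^+ 2))) mS.
- exact: continuous_measurable_fun.
- apply: (@bounded_integrable _ _ _ _ _ 1); first exact: past_measurable mS.
  move=> w; rewrite ger0_norm ?expR_ge0// -expR0 ler_expR oppr_le0 mulr_ge0//.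
  by apply: sumr_ge0 => s _; rewrite mulr_ge0 ?sqr_ge0.
- apply: (@integrable_bounded_comp _ _ _ _ _ (fun y => expR (- (t * la n * y ^+ 2))) 1) => //.
  move=> y; rewrite ger0_norm ?expR_ge0// -expR0 ler_expR oppr_le0.
  by rewrite mulr_ge0 ?sqr_ge0// mulr_ge0.
- by rewrite IHn big_ord_recr/= (Rintegral_exp_sqr (mY n) (lawY n))// mulr_ge0.
Qed.

End gaussian_sequence.

Section gaussian_sums.
Context (R : realType) (d : measure_display) (T : measurableType d)
  (P : probability T R) (Y : nat -> T -> R) (Z : T -> R).
Hypotheses (mY : forall s, measurable_fun setT (Y s)) (mZ : measurable_fun setT Z).
Hypotheses (lawY : forall s, normal_law P (Y s) 0 1) (lawZ : normal_law P Z 0 1).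
Hypothesis indYZ : mutually_independent P (joint Y Z).

Local Notation S := (xsum Y).
Local Notation pastT n := (block (joint Y Z) (past n)).

Let mS be n : measurable_fun setT (S be n).
Proof. exact: (measurable_xsum mY mZ). Qed.

Let mpS be n : measurable_fun setT (S be n : pastT n -> R).
Proof. exact: measurable_past_xsum. Qed.

Lemma xsum_moment2 be n : L1 P (fun w => S be n w ^+ 2) /\
  \int[P]_w (S be n w ^+ 2) = \sum_(s < n) be s ^+ 2.
Proof.
elim: n => [|n [IHI IHE]].
  have S0 w : S be 0 w ^+ 2 = 0 by rewrite /S big_ord0 expr0n.
  under eq_fun do rewrite S0.
  by rewrite Rintegral_prob_cst big_ord0; split => //; exact: integrableR_cst.
have IS : L1 P (S be n).
  (* The elementary bound [|x| <= 1 + x ^+ 2] makes the sum integrable, as the product rule for the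
     cross term requires. *)
  apply: (@dominated_integrableR _ _ _ _ _ (fun w => 1 + S be n w ^+ 2)) => //.
    move=> w; rewrite ler_norml; have := sqr_ge0 (S be n w + 1).
    by have := sqr_ge0 (S be n w - 1) => ? ?; apply/andP; split; nra.
  by apply: integrableRD => //; exact: integrableR_cst.
have Ix := integrable_xi (mY n) (lawY n).
have Ix2 := integrable_xi2 (mY n) (lawY n).
have [ISx ESx] := past_mul_Y mY mZ indYZ (@mpS be n) (@measurable_xi R) IS Ix.
have E w : S be n.+1 w ^+ 2 =
    S be n w ^+ 2 + 2 * be n * (S be n w * xi (Y n w)) + be n ^+ 2 * xi (Y n w) ^+ 2.
  by rewrite xsumS; ring.
under eq_fun do rewrite E.
have I1 : L1 P (fun w => S be n w ^+ 2 + 2 * be n * (S be n w * xi (Y n w))).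
  by apply: integrableRD => //; exact: integrableRZ.
have I2 := integrableRZ (be n ^+ 2) Ix2.
split; first exact: integrableRD.
rewrite RintegralD// RintegralD//; last exact: integrableRZ.
rewrite !RintegralZl// ESx IHE (Rintegral_xi (mY n) (lawY n)) (Rintegral_xi2 (mY n) (lawY n)).
by rewrite big_ord_recr/=; ring.
Qed.

Definition kappa := \int[P]_w (`|xi (Y 0%N w)| ^+ 3).

Lemma kappaE s : \int[P]_w (`|xi (Y s w)| ^+ 3) = kappa.
Proof.
have mf : measurable_fun setT (fun x : R => `|xi x| ^+ 3).
  by apply: measurable_funX; apply: measurableT_comp => //; exact: measurable_xi.
by rewrite /kappa /Rintegral !(ge0_integral_normal_law (mY _) (lawY _) mf)// => x;
  exact: exprn_ge0.
Qed.

Lemma kappa_ge0 : 0 <= kappa.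
Proof. by apply: Rintegral_ge0 => w _; exact: exprn_ge0. Qed.

Let mxi (h : R -> R) c s : continuous h ->
  measurable_fun setT (fun w => h (c * xi (Y s w))).
Proof.
move=> ch; apply: (measurableT_comp (continuous_measurable_fun ch)).
apply: measurable_funM => //; exact: (measurableT_comp (@measurable_xi R)).
Qed.

(** Both quantities are compared with [1 - c ^+ 2 / 2]: the cosine because [xi] has unit variance,
    with error its third moment, the exponential with error of order [c ^+ 4]. *)
Lemma cos_xi_bound (c : R) s : 0 <= c ->
  `|\int[P]_w cos (c * xi (Y s w)) - expR (- (c ^+ 2 / 2))| <= kappa * c ^+ 3 + c ^+ 4.
Proof.
move=> c0; have Ix2 := integrable_xi2 (mY s) (lawY s).
have Ix3 := integrable_xi3 (mY s) (lawY s).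
have Ic : L1 P (fun w => cos (c * xi (Y s w))).
  apply: (@bounded_integrable _ _ _ _ _ 1); first exact: (mxi _ _ (@continuous_cos R)).
  by move=> w; exact: cos_max.
have Iq : L1 P (fun w => 1 - c ^+ 2 / 2 * xi (Y s w) ^+ 2).
  by apply: integrableRB; [exact: integrableR_cst|exact: integrableRZ].
have Eq : \int[P]_w (1 - c ^+ 2 / 2 * xi (Y s w) ^+ 2) = 1 - c ^+ 2 / 2.
  rewrite RintegralB//; [|exact: integrableR_cst|exact: integrableRZ].
  by rewrite RintegralZl// Rintegral_prob_cst (Rintegral_xi2 (mY s) (lawY s)) mulr1.
have B1 : `|\int[P]_w cos (c * xi (Y s w)) - (1 - c ^+ 2 / 2)| <= kappa * c ^+ 3.
  rewrite -Eq -(kappaE s) [leRHS]mulrC -RintegralZl//.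
  apply: Rintegral_dist_le => //; last exact: integrableRZ.
  move=> w; have := cos_taylor2 (c * xi (Y s w)).
  rewrite (_ : cos (c * xi (Y s w)) - 1 + (c * xi (Y s w)) ^+ 2 / 2 =
    cos (c * xi (Y s w)) - (1 - c ^+ 2 / 2 * xi (Y s w) ^+ 2)); last by field.
  by rewrite [`|c * _|]normrM (ger0_norm c0) [(c * _) ^+ 3]exprMn.
have u0 : 0 <= c ^+ 2 / 2 by rewrite divr_ge0 ?sqr_ge0.
have B2 : `|expR (- (c ^+ 2 / 2)) - (1 - c ^+ 2 / 2)| <= c ^+ 4.
  have := expR_taylor1 u0; rewrite opprB addrA [_ + _ - 1]addrAC => /le_trans; apply.
  by rewrite expr_div_n -exprM ler_pdivrMr ?exprn_gt0// ler_peMr ?exprn_ge0// -natrX ler1n.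
apply: le_trans (ler_distD (1 - c ^+ 2 / 2) _ _) _; apply: lerD => //.
by rewrite distrC.
Qed.

Lemma sin_xi_bound (c : R) s : 0 <= c ->
  `|\int[P]_w sin (c * xi (Y s w))| <= kappa * c ^+ 3.
Proof.
move=> c0; have Ix := integrable_xi (mY s) (lawY s).
have Ix3 := integrable_xi3 (mY s) (lawY s).
have Is : L1 P (fun w => sin (c * xi (Y s w))).
  apply: (@bounded_integrable _ _ _ _ _ 1); first exact: (mxi _ _ (@continuous_sin R)).
  by move=> w; exact: sin_max.
have E0 : \int[P]_w (c * xi (Y s w)) = 0.
  by rewrite RintegralZl// (Rintegral_xi (mY s) (lawY s)) mulr0.
rewrite -[X in `|X|]subr0 -E0 -(kappaE s) [leRHS]mulrC -RintegralZl//.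
apply: Rintegral_dist_le => //; [exact: integrableRZ| |exact: integrableRZ].
move=> w; have := sin_taylor2 (c * xi (Y s w)).
by rewrite normrM exprMn (ger0_norm c0).
Qed.

Lemma cos_integrable (t u : R) (V : T -> R) : measurable_fun setT V ->
  L1 P (fun w => cos (t * V w + u)).
Proof.
move=> mV; apply: (@bounded_integrable _ _ _ _ _ 1); last by move=> w; exact: cos_max.
apply: (measurableT_comp (continuous_measurable_fun (@continuous_cos R))).
by apply: measurable_funD => //; exact: measurable_funM.
Qed.

(** With [c = t * be n], the cosine and the sine of the replaced term each cost [kappa * c ^+ 3];
    the last summand is the [c ^+ 4] of the exponential, where [be n <= 1] lowers the power of the
    weight to three. *)
Definition lindeberg (t : R) := 2 * kappa * `|t| ^+ 3 + t ^+ 4.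

(* One Lindeberg replacement: the term of index n becomes a Gaussian of the same variance. *)
Lemma cos_xsum_step be n t u : 0 <= be n <= 1 -> 0 <= t ->
  `|\int[P]_w cos (t * S be n.+1 w + u) -
    (\int[P]_w cos (t * S be n w + u)) * expR (- (t ^+ 2 * be n ^+ 2 / 2))|
  <= lindeberg t * be n ^+ 3.
Proof.
move=> /andP[b0 b1] t0.
pose c := t * be n; have c0 : 0 <= c by rewrite mulr_ge0.
have cosE w : cos (t * S be n.+1 w + u) =
    cos (t * S be n w + u) * cos (c * xi (Y n w)) -
    cos (t * S be n w + (u - pi / 2)) * sin (c * xi (Y n w)).
  rewrite [cos (_ + (u - _))](_ : _ = sin (t * S be n w + u)); last by rewrite addrA cosBpihalf.
  by rewrite -cosD xsumS /c; congr cos; ring.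
have mU v : measurable_fun setT ((fun w => cos (t * S be n w + v)) : pastT n -> R).
  apply: (measurableT_comp (continuous_measurable_fun (@continuous_cos R))).
  by apply: measurable_funD => //; exact: measurable_funM.
have cg (h : R -> R) : continuous h -> measurable_fun setT (fun y : R => h (c * xi y)).
  move=> ch; apply: (measurableT_comp (continuous_measurable_fun ch)).
  by apply: measurable_funM => //; exact: measurable_xi.
have Ig (h : R -> R) : continuous h -> (forall x, `|h x| <= 1) ->
    L1 P (fun w => h (c * xi (Y n w))).
  by move=> ch h1; apply: (@bounded_integrable _ _ _ _ _ 1) => //; exact: mxi.
have Icos := Ig _ (@continuous_cos R) (@cos_max R).
have Isin := Ig _ (@continuous_sin R) (@sin_max R).
have [I1 E1] := past_mul_Y mY mZ indYZ (mU u) (cg _ (@continuous_cos R))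
  (cos_integrable t u (@mS be n)) Icos.
have [I2 E2] := past_mul_Y mY mZ indYZ (mU (u - pi / 2)) (cg _ (@continuous_sin R))
  (cos_integrable t _ (@mS be n)) Isin.
under eq_Rintegral do rewrite cosE.
rewrite RintegralB// E1 E2.
have := cos_xi_bound n c0; have := sin_xi_bound n c0.
have c3 : c ^+ 3 = t ^+ 3 * be n ^+ 3 by rewrite /c exprMn.
have c4 : c ^+ 4 <= t ^+ 4 * be n ^+ 3.
  by rewrite /c exprMn ler_wpM2l ?exprn_ge0// [leLHS]exprS ler_piMl// exprn_ge0.
have -> : t ^+ 2 * be n ^+ 2 / 2 = c ^+ 2 / 2 by rewrite /c exprMn.
set a := \int[P]_w cos (c * _); set b := \int[P]_w sin (c * _); set e := expR _.
have bcos v : `|\int[P]_w cos (t * S be n w + v)| <= 1.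
  apply: Rintegral_norm_le_cst; last by move=> w; exact: cos_max.
  exact: integrable_measurable (cos_integrable t v (@mS be n)).
move: (bcos u) (bcos (u - pi / 2)).
set A := \int[P]_w _; set B := \int[P]_w _ => A1 B1 hb ha.
rewrite (_ : A * a - B * b - A * e = A * (a - e) - B * b); last by ring.
apply: (@le_trans _ _ (`|a - e| + `|b|)).
  apply: le_trans (ler_normB _ _) _; rewrite !normrM.
  by apply: lerD; rewrite ler_piMl.
apply: le_trans (lerD ha hb) _; rewrite /lindeberg (ger0_norm t0) c3.
by move: c4; rewrite !mulrDl; lra.
Qed.

(** The Gaussian factors are at most one, so the errors of the successive replacements add up
    without amplification. *)
Lemma cos_xsum_telescope be m n t u : (forall s, 0 <= be s <= 1) -> 0 <= t -> (m <= n)%N ->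
  `|\int[P]_w cos (t * S be n w + u) -
    (\int[P]_w cos (t * S be m w + u)) *
      expR (- (t ^+ 2 * (\sum_(m <= s < n) be s ^+ 2) / 2))|
  <= lindeberg t * \sum_(m <= s < n) be s ^+ 3.
Proof.
move=> be01 t0; elim: n => [|n IHn].
  rewrite leqn0 => /eqP ->; rewrite !big_geq// !mulr0 mul0r oppr0 expR0 mulr1.
  by rewrite subrr normr0.
rewrite leq_eqVlt => /predU1P[->|].
  by rewrite !big_geq// !mulr0 mul0r oppr0 expR0 mulr1 subrr normr0.
rewrite ltnS => mn; rewrite !big_nat_recr//=.
have h2 := cos_xsum_step (n := n) u (be01 n) t0; have h1 := IHn mn.
rewrite [X in expR X](_ : _ = - (t ^+ 2 * (\sum_(m <= s < n) be s ^+ 2) / 2) +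
  - (t ^+ 2 * be n ^+ 2 / 2)); last by field.
rewrite expRD; move: h1 h2.
set e2 := expR (- (t ^+ 2 * be n ^+ 2 / 2)).
set c1 := \int[P]_w _; set c0 := \int[P]_w _; set e1 := expR _.
set c2 := \int[P]_w _ => h1 h2.
have e21 : 0 <= e2 <= 1.
  by rewrite expR_ge0 -expR0 ler_expR oppr_le0 divr_ge0// mulr_ge0// sqr_ge0.
rewrite (_ : c2 - c0 * (e1 * e2) = (c2 - c1 * e2) + (c1 - c0 * e1) * e2); last by ring.
apply: le_trans (ler_normD _ _) _; rewrite mulrDr addrC; apply: lerD => //.
apply: le_trans h1; rewrite normrM [`|e2|]ger0_norm; last by case/andP: e21.
by rewrite ler_piMr//; case/andP: e21.
Qed.

Lemma cos_xsum_Z be n (sg t u : R) :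
  \int[P]_w cos (t * (S be n w + sg * Z w) + u) =
  (\int[P]_w cos (t * S be n w + u)) * expR (- (t ^+ 2 * sg ^+ 2 / 2)).
Proof.
pose c := t * sg.
have cosE w : cos (t * (S be n w + sg * Z w) + u) =
    cos (t * S be n w + u) * cos (c * Z w) -
    cos (t * S be n w + (u - pi / 2)) * sin (c * Z w).
  rewrite [cos (_ + (u - _))](_ : _ = sin (t * S be n w + u)); last by rewrite addrA cosBpihalf.
  by rewrite -cosD /c; congr cos; ring.
have mU v : measurable_fun setT ((fun w => cos (t * S be n w + v)) : pastT n -> R).
  apply: (measurableT_comp (continuous_measurable_fun (@continuous_cos R))).
  by apply: measurable_funD => //; exact: measurable_funM.
have cg (h : R -> R) : continuous h -> measurable_fun setT (fun y : R => h (c * y)).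
  by move=> ch; apply: (measurableT_comp (continuous_measurable_fun ch)); exact: measurable_funM.
have Ig (h : R -> R) : continuous h -> (forall x, `|h x| <= 1) ->
    L1 P (fun w => h (c * Z w)).
  move=> ch h1; apply: (@bounded_integrable _ _ _ _ _ 1) => //.
  exact: (measurableT_comp (cg h ch)).
have [I1 E1] := past_mul_Z mY mZ indYZ (mU u) (cg _ (@continuous_cos R))
  (cos_integrable t u (@mS be n)) (Ig _ (@continuous_cos R) (@cos_max R)).
have [I2 E2] := past_mul_Z mY mZ indYZ (mU (u - pi / 2)) (cg _ (@continuous_sin R))
  (cos_integrable t _ (@mS be n)) (Ig _ (@continuous_sin R) (@sin_max R)).
under eq_Rintegral do rewrite cosE.
rewrite RintegralB// E1 E2.
have cn v : \int[P]_w cos (c * Z w + v) = cos v * expR (- (c ^+ 2 / 2)).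
  have := Rintegral_cos_normal ltr01 mZ lawZ c v.
  by rewrite expr1n mulr1 => <-; apply: eq_Rintegral => w _; rewrite subr0.
have -> : \int[P]_w cos (c * Z w) = expR (- (c ^+ 2 / 2)).
  have := cn 0; rewrite cos0 mul1r => <-.
  by apply: eq_Rintegral => w _; rewrite addr0.
have -> : \int[P]_w sin (c * Z w) = 0.
  have := cn (- (pi / 2)); rewrite cosN cos_pihalf mul0r => <-.
  by apply: eq_Rintegral => w _; rewrite cosBpihalf.
by rewrite mulr0 subr0 /c exprMn.
Qed.

End gaussian_sums.

Lemma cvg_sum_ord (R : realType) (f : nat -> nat -> R) (g : nat -> R) m :
  (forall s, f k s @[k --> \oo] --> g s) ->
  \sum_(s < m) f k s @[k --> \oo] --> \sum_(s < m) g s.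
Proof.
move=> fg; elim: m => [|m IHm].
  by under eq_fun do rewrite big_ord0; rewrite big_ord0; exact: cvg_cst.
under eq_fun do rewrite big_ord_recr; rewrite big_ord_recr.
exact: cvgD IHm (fg m).
Qed.

Section weighted_sum_limits.
Context (R : realType) (d : measure_display) (T : measurableType d)
  (P : probability T R) (Y : nat -> T -> R) (Z : T -> R).
Hypotheses (mY : forall s, measurable_fun setT (Y s)) (mZ : measurable_fun setT Z).
Hypotheses (lawY : forall s, normal_law P (Y s) 0 1) (lawZ : normal_law P Z 0 1).
Hypothesis indYZ : mutually_independent P (joint Y Z).
Local Notation S := (xsum Y).

Context (be : nat -> nat -> R) (n : nat -> nat) (b : nat -> R).
Hypothesis be01 : forall k s, 0 <= be k s <= 1.
Hypothesis be_dec : forall k s t, (s <= t)%N -> be k t <= be k s.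
Hypothesis be_out : forall k s, (n k <= s)%N -> be k s = 0.
Hypothesis be_norm : forall k, \sum_(s < n k) be k s ^+ 2 = 1.
Hypothesis be_cvg : forall s, be k s @[k --> \oo] --> b s.

Let be_sum k N (f : R -> R) : f 0 = 0 -> (n k <= N)%N ->
  \sum_(s < N) f (be k s) = \sum_(s < n k) f (be k s).
Proof.
move=> f0 nN; rewrite -!(big_mkord xpredT (fun s => f (be k s))).
rewrite (big_cat_nat (n := n k))//= [X in _ + X]big_nat_cond [X in _ + X]big1 ?addr0// => s.
by move=> /andP[/andP[ns _] _]; rewrite be_out.
Qed.

(** Padding with zero weights allows the cut [m] to exceed [n k]: both are compared inside
    [maxn (n k) m] terms. *)
Lemma xsum_stable k N w : (n k <= N)%N -> S (be k) N w = S (be k) (n k) w.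
Proof.
move=> nN; rewrite /S -!(big_mkord xpredT (fun s => be k s * xi (Y s w))).
rewrite (big_cat_nat (n := n k))//= [X in _ + X]big_nat_cond [X in _ + X]big1 ?addr0// => s.
by move=> /andP[/andP[ns _] _]; rewrite be_out// mul0r.
Qed.

Lemma cos_xsum_cvg m t u :
  \int[P]_w cos (t * S (be k) m w + u) @[k --> \oo] --> \int[P]_w cos (t * S b m w + u).
Proof.
have mS := measurable_xsum mY mZ.
have mc be' : measurable_fun setT (fun w => cos (t * S be' m w + u)).
  exact: integrable_measurable (cos_integrable P t u (mS be' m)).
apply: (@Rintegral_dominated_cvg _ _ _ _ _ _ (fun=> 1)) => //.
- apply: aeW => w; apply: cvg_comp; last exact: continuous_cos.
  apply: cvgD; last exact: cvg_cst.
  apply: cvgM; first exact: cvg_cst.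
  rewrite /S; apply: (cvg_sum_ord (f := fun k s => be k s * xi (Y s w))
    (g := fun s => b s * xi (Y s w))) => s.
  by apply: cvgM; [exact: be_cvg|exact: cvg_cst].
- exact: integrableR_cst.
- by move=> k w; exact: cos_max.
Qed.

Lemma cos_xsum_near m (t u e : R) : 0 <= t -> 0 < e ->
  \forall k \near \oo,
    `|\int[P]_w cos (t * S (be k) (n k) w + u) -
      (\int[P]_w cos (t * S b m w + u)) *
        expR (- (t ^+ 2 * (1 - \sum_(s < m) b s ^+ 2) / 2))|
    <= lindeberg P Y t * b m + e.
Proof.
move=> t0 e0.
have K0 : 0 <= lindeberg P Y t.
  rewrite /lindeberg addr_ge0 ?exprn_ge0// mulr_ge0 ?exprn_ge0// mulr_ge0//.
  exact: kappa_ge0.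
pose g k := (\int[P]_w cos (t * S (be k) m w + u)) *
  expR (- (t ^+ 2 * (1 - \sum_(s < m) be k s ^+ 2) / 2)).
have g_cvg : g k @[k --> \oo] --> (\int[P]_w cos (t * S b m w + u)) *
    expR (- (t ^+ 2 * (1 - \sum_(s < m) b s ^+ 2) / 2)).
  apply: cvgM; first exact: cos_xsum_cvg.
  apply: cvg_comp; last exact: continuous_expR.
  apply: cvgN; apply: cvgM; last exact: cvg_cst.
  apply: cvgM; first exact: cvg_cst.
  apply: cvgB; first exact: cvg_cst.
  apply: (cvg_sum_ord (f := fun k s => be k s ^+ 2) (g := fun s => b s ^+ 2)) => s.
  by under eq_fun do rewrite expr2; rewrite expr2; apply: cvgM; exact: be_cvg.
have main k : `|\int[P]_w cos (t * S (be k) (n k) w + u) - g k| <= lindeberg P Y t * be k m.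
  pose N := maxn (n k) m.
  have nN : (n k <= N)%N by exact: leq_maxl.
  have mN : (m <= N)%N by exact: leq_maxr.
  have := cos_xsum_telescope mY mZ lawY indYZ u (be01 k) t0 mN.
  under [X in `|X - _|]eq_Rintegral do rewrite xsum_stable//.
  have sumE (f : R -> R) : \sum_(m <= s < N) f (be k s) =
      \sum_(s < N) f (be k s) - \sum_(s < m) f (be k s).
    rewrite -!(big_mkord xpredT (fun s => f (be k s))).
    by rewrite [X in _ = X - _](big_cat_nat (n := m))//= [RHS]addrC addKr.
  rewrite (sumE (fun x => x ^+ 2)) (@be_sum k N (fun x => x ^+ 2)) ?expr0n// be_norm.
  move=> /le_trans; apply; rewrite ler_wpM2l//.
  (* By monotonicity one factor of each cube is at most [be k m], and the remaining squares sum to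
     at most one. *)
  apply: (@le_trans _ _ (\sum_(m <= s < N) be k m * be k s ^+ 2)).
    rewrite big_nat_cond [leRHS]big_nat_cond; apply: ler_sum => s /andP[/andP[ms _] _].
    by rewrite exprS ler_wpM2r ?sqr_ge0// be_dec.
  rewrite -mulr_sumr ler_piMr//; first by case/andP: (be01 k m).
  rewrite (sumE (fun x => x ^+ 2)) (@be_sum k N (fun x => x ^+ 2)) ?expr0n// be_norm.
  by rewrite lerBlDr lerDl sumr_ge0// => s _; exact: sqr_ge0.
have e20 : 0 < e / 2 by rewrite divr_gt0.
have bm_cvg : lindeberg P Y t * be k m @[k --> \oo] --> lindeberg P Y t * b m.
  by apply: cvgM; [exact: cvg_cst|exact: be_cvg].
near=> k.
have h1 : `|(\int[P]_w cos (t * S b m w + u)) *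
    expR (- (t ^+ 2 * (1 - \sum_(s < m) b s ^+ 2) / 2)) - g k| <= e / 2.
  by near: k; exact: cvgr_dist_le g_cvg _ e20.
have h2 : `|lindeberg P Y t * b m - lindeberg P Y t * be k m| <= e / 2.
  by near: k; exact: cvgr_dist_le bm_cvg _ e20.
have h3 := main k.
apply: le_trans (ler_distD (g k) _ _) _.
move: h2; rewrite ler_norml => /andP[h2 _].
by rewrite [X in _ + X]distrC; move: h1 h2 h3; lra.
Unshelve. all: by end_near. Qed.

Lemma law_of_cos (L : T -> R) : measurable_fun setT L ->
  (forall t u, 0 <= t -> \int[P]_w cos (t * S (be k) (n k) w + u) @[k --> \oo] -->
     \int[P]_w cos (t * L w + u)) ->
  forall (f : R -> R) (B : R), continuous f -> (forall x, `|f x| <= B) ->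
  \int[P]_w f (S (be k) (n k) w) @[k --> \oo] --> \int[P]_w f (L w).
Proof.
move=> mL cvgc f B cf fB.
apply: (@levy_continuity R d (fun=> T) (fun=> P) (fun k => S (be k) (n k)) _ T P L 1 _ _ _ _ _ f B) => //.
- by move=> k; exact: (measurable_xsum mY mZ).
- by move=> k; case: (xsum_moment2 mY mZ lawY indYZ (be k) (n k)).
- by move=> k; rewrite (proj2 (xsum_moment2 mY mZ lawY indYZ (be k) (n k))) be_norm.
(* The cosine is even, so a negative [t] reduces to [- t] with phase [- u]. *)
- move=> t u; have [t0|t0] := leP 0 t; first exact: cvgc.
  have flip V : \int[P]_w cos (t * V w + u) = \int[P]_w cos ((- t) * V w + (- u)).
    by apply: eq_Rintegral => w _; rewrite -cosN; congr cos; ring.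
  rewrite flip; under eq_fun do rewrite flip.
  by apply: cvgc; rewrite oppr_ge0 ltW.
Qed.

(** Cutting at [m = r] suffices: the replacement error is proportional to [b r = 0], and the
    Gaussian factor left over is exactly that of the [Z] term. *)
Lemma law_limit_mixture r : (forall s, (r <= s)%N -> b s = 0) ->
  \sum_(s < r) b s ^+ 2 <= 1 ->
  forall (f : R -> R) (B : R), continuous f -> (forall x, `|f x| <= B) ->
  \int[P]_w f (S (be k) (n k) w) @[k --> \oo] -->
  \int[P]_w f (S b r w + Num.sqrt (1 - \sum_(s < r) b s ^+ 2) * Z w).
Proof.
move=> br b1; apply: law_of_cos.
  by apply: measurable_funD; [exact: (measurable_xsum mY mZ)|exact: measurable_funM].
move=> t u t0; apply/cvgrPdist_le => e e0.
rewrite (cos_xsum_Z mY mZ lawZ indYZ) sqr_sqrtr ?subr_ge0//.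
have := @cos_xsum_near r t u e t0 e0; apply: filterS => k.
by rewrite br// mulr0 add0r distrC.
Qed.

(** Here the cut [m] must grow: the error vanishes with [b m], and the variance of the Gaussian
    replacement vanishes because the squares sum to one. *)
Lemma law_limit_series (L : T -> R) : measurable_fun setT L ->
  {ae P, forall w, S b m w @[m --> \oo] --> L w} ->
  b s @[s --> \oo] --> (0 : R) ->
  \sum_(s < m) b s ^+ 2 @[m --> \oo] --> (1 : R) ->
  forall (f : R -> R) (B : R), continuous f -> (forall x, `|f x| <= B) ->
  \int[P]_w f (S (be k) (n k) w) @[k --> \oo] --> \int[P]_w f (L w).
Proof.
move=> mL aeL b0 b1; apply: law_of_cos => // t u t0; apply/cvgrPdist_le => e e0.
have e30 : 0 < e / 3 by rewrite divr_gt0.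
have lim1 : (\int[P]_w cos (t * S b m w + u)) *
   expR (- (t ^+ 2 * (1 - \sum_(s < m) b s ^+ 2) / 2)) @[m --> \oo] -->
   (\int[P]_w cos (t * L w + u)) * expR (- (t ^+ 2 * (1 - 1) / 2)).
  apply: cvgM; last first.
    apply: cvg_comp; last exact: continuous_expR.
    apply: cvgN; apply: cvgM; last exact: cvg_cst.
    by apply: cvgM; [exact: cvg_cst|apply: cvgB => //; exact: cvg_cst].
  apply: (@Rintegral_dominated_cvg _ _ _ _ _ _ (fun=> 1)).
  - move=> m; exact: integrable_measurable (cos_integrable P t u (measurable_xsum mY mZ b m)).
  - exact: integrable_measurable (cos_integrable P t u mL).
  - apply: filterS aeL => w Lw; apply: cvg_comp; last exact: continuous_cos.
    by apply: cvgD; [apply: cvgM => //; exact: cvg_cst|exact: cvg_cst].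
  - exact: integrableR_cst.
  - by move=> m w; exact: cos_max.
rewrite subrr mulr0 mul0r oppr0 expR0 mulr1 in lim1.
have lim2 : lindeberg P Y t * b m @[m --> \oo] --> (0 : R).
  by rewrite -(mulr0 (lindeberg P Y t)); apply: cvgM => //; exact: cvg_cst.
have /cvgrPdist_le/(_ _ e30) ev1 := lim1; have /cvgrPdist_le/(_ _ e30) ev2 := lim2.
have [m [h1 h2]] := filter_ex (filterI ev1 ev2).
have := @cos_xsum_near m t u (e / 3) t0 e30; apply: filterS => k h3.
apply: le_trans (ler_distD ((\int[P]_w cos (t * S b m w + u)) *
   expR (- (t ^+ 2 * (1 - \sum_(s < m) b s ^+ 2) / 2))) _ _) _.
rewrite [X in _ + X]distrC; move: h1 h2 h3; rewrite sub0r normrN => h1 h2 h3.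
have := ler_norm (lindeberg P Y t * b m); move: h1 h2 h3; lra.
Qed.

End weighted_sum_limits.

(** * Almost sure convergence of the series *)

Section almost_sure_convergence.
Context (R : realType) (d : measure_display) (T : measurableType d)
  (P : probability T R) (Y : nat -> T -> R) (Z : T -> R).
Hypotheses (mY : forall s, measurable_fun setT (Y s)) (mZ : measurable_fun setT Z).
Hypotheses (lawY : forall s, normal_law P (Y s) 0 1).
Hypothesis indYZ : mutually_independent P (joint Y Z).
Local Notation S := (xsum Y).
Local Notation pastT n := (block (joint Y Z) (past n)).
Context (b : nat -> R).

(* The increments of [S b] after time [m], frozen as soon as they reach [eps]:
   the final value alone witnesses that the level was reached, which gives the
   maximal inequality without decomposing according to the first passage. *)
Fixpoint frozen (m : nat) (eps : R) (k : nat) (w : T) : R :=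
  if k is k'.+1 then
    frozen m eps k' w + (if `|frozen m eps k' w| < eps
      then b (m + k')%N * xi (Y (m + k')%N w) else 0)
  else 0.

Let ind (m : nat) (eps : R) (k : nat) (w : T) : R :=
  if `|frozen m eps k w| < eps then 1 else 0.

Let frozenS m eps k w : frozen m eps k.+1 w =
  frozen m eps k w + ind m eps k w * (b (m + k)%N * xi (Y (m + k)%N w)).
Proof. by rewrite /ind /=; case: ifP => _; rewrite ?mul1r ?mul0r. Qed.

Lemma measurable_past_frozen m eps k : forall n, (m + k <= n)%N ->
  measurable_fun setT (frozen m eps k : pastT n -> R).
Proof.
elim: k => [|k IHk] n mkn; first exact: measurable_cst.
have mk := IHk n (ltnW (leq_trans (eq_leq (esym (addnS m k))) mkn)).
apply: measurable_funD => //; apply: measurable_fun_ifT => //.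
- apply: measurable_fun_ltr => //; exact: measurableT_comp.
- apply: measurable_funM => //.
  apply: (measurableT_comp (g := (Y (m + k)%N : pastT n -> R)) (@measurable_xi R)).
  by apply: measurable_past_Y; rewrite -addnS.
Qed.

Let mpind m eps k : measurable_fun setT (ind m eps k : pastT (m + k) -> R).
Proof.
apply: measurable_fun_ifT => //; apply: measurable_fun_ltr => //.
by apply: measurableT_comp => //; exact: measurable_past_frozen.
Qed.

(** Whether the process is still moving at time [k] is decided by the past, so the next centred
    increment is orthogonal to it and freezing can only lower the variance. *)
Lemma frozen_moment2 m eps k : 0 < eps -> L1 P (fun w => frozen m eps k w ^+ 2) /\
  \int[P]_w (frozen m eps k w ^+ 2) <= \sum_(i < k) b (m + i)%N ^+ 2.
Proof.
move=> eps0; elim: k => [|k [IHI IHE]].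
  rewrite big_ord0 /=; under eq_fun do rewrite expr0n.
  by rewrite Rintegral_prob_cst; split => //; exact: integrableR_cst.
pose x w := xi (Y (m + k)%N w).
have Ix := integrable_xi (mY (m + k)) (lawY (m + k)).
have Ix2 := integrable_xi2 (mY (m + k)) (lawY (m + k)).
have mpU : measurable_fun setT ((fun w => ind m eps k w * frozen m eps k w) : pastT (m + k) -> R).
  by apply: measurable_funM; [exact: mpind|exact: measurable_past_frozen].
have IU : L1 P (fun w => ind m eps k w * frozen m eps k w).
  apply: (@bounded_integrable _ _ _ _ _ eps); first exact: (past_measurable mY mZ mpU).
  by move=> w; rewrite /ind; case: ifP => [h|_]; rewrite ?mul1r ?mul0r ?normr0 ltW.
have [IUx EUx] := past_mul_Y mY mZ indYZ mpU (@measurable_xi R) IU Ix.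
have mind : measurable_fun setT (ind m eps k) by exact: (past_measurable mY mZ (@mpind m eps k)).
have ind_bound w : `|ind m eps k w * x w ^+ 2| <= x w ^+ 2.
  by rewrite /ind; case: ifP => _; rewrite ?mul1r ?mul0r ?normr0 ?sqr_ge0// ger0_norm ?sqr_ge0.
have mx2 : measurable_fun setT (fun w => ind m eps k w * x w ^+ 2).
  apply: measurable_funM => //; exact: integrable_measurable Ix2.
have Iix : L1 P (fun w => ind m eps k w * x w ^+ 2) by exact: dominated_integrableR Ix2.
have Eix : \int[P]_w (ind m eps k w * x w ^+ 2) <= 1.
  rewrite -(Rintegral_xi2 (mY (m + k)) (lawY (m + k))).
  by apply: le_trans (ler_norm _) _; exact: Rintegral_norm_le.
have E w : frozen m eps k.+1 w ^+ 2 = frozen m eps k w ^+ 2 +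
    2 * b (m + k)%N * (ind m eps k w * frozen m eps k w * x w) +
    b (m + k)%N ^+ 2 * (ind m eps k w * x w ^+ 2).
  rewrite frozenS; have : ind m eps k w ^+ 2 = ind m eps k w.
    by rewrite /ind; case: ifP => _; rewrite ?expr1n ?expr0n.
  by rewrite -/(x w) => i2; rewrite -[in X in _ = _ + X]i2; ring.
under eq_fun do rewrite E.
have I1 : L1 P (fun w => frozen m eps k w ^+ 2 +
    2 * b (m + k)%N * (ind m eps k w * frozen m eps k w * x w)).
  by apply: integrableRD => //; exact: integrableRZ.
have I2 := integrableRZ (b (m + k)%N ^+ 2) Iix.
split; first exact: integrableRD.
rewrite RintegralD// RintegralD//; last exact: integrableRZ.
rewrite !RintegralZl// EUx (Rintegral_xi (mY (m + k)) (lawY (m + k))) !mulr0 addr0.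
by rewrite big_ord_recr/= lerD// ler_piMr// sqr_ge0.
Qed.

Lemma frozen_reached m eps k j w : (j <= k)%N -> eps <= `|frozen m eps j w| ->
  eps <= `|frozen m eps k w|.
Proof.
move=> jk h; rewrite -(subnKC jk); elim: (k - j)%N => [|i IHi]; first by rewrite addn0.
by rewrite addnS /= ltNge IHi/= addr0.
Qed.

Lemma frozen_xsum m eps k w : (forall j, (j < k)%N -> `|S b (m + j) w - S b m w| < eps) ->
  frozen m eps k w = S b (m + k) w - S b m w.
Proof.
elim: k => [|k IHk] h; first by rewrite addn0 subrr.
rewrite /= IHk; last by move=> j jk; apply: h; exact: ltnW.
by rewrite h// addnS xsumS; ring.
Qed.

(** At the first time the increments reach [eps] nothing has been frozen yet, so [frozen] equals the
    increment there; from then on it stays put. *)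
Lemma frozen_max m eps k w : eps <= `|S b (m + k) w - S b m w| ->
  eps <= `|frozen m eps k w|.
Proof.
move=> hk; pose p j := eps <= `|S b (m + j) w - S b m w|.
have exp : exists j, p j by exists k.
case: (ex_minnP exp) => j pj jmin.
apply: (@frozen_reached _ _ _ j); first exact: jmin.
rewrite frozen_xsum// => i ij; rewrite ltNge; apply/negP => /jmin.
by rewrite leqNgt ij.
Qed.

Let hit m eps k : set T := [set w | eps <= `|frozen m eps k w|].

Let mfrozen m eps k : measurable_fun setT (frozen m eps k).
Proof. exact: (past_measurable mY mZ (@measurable_past_frozen m eps k _ (leqnn _))). Qed.

Let mhit m eps k : measurable (hit m eps k).
Proof.
rewrite -[hit m eps k]setTI.
have mf : measurable_fun setT (fun w => eps <= `|frozen m eps k w|).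
  by apply: measurable_fun_ler => //; exact: measurableT_comp.
by have := mf measurableT [set true] I; apply.
Qed.

Let nd_hit m eps : nondecreasing_seq (hit m eps).
Proof.
by move=> j k jk; apply/subsetPset => w /= h; exact: frozen_reached jk h.
Qed.

Variable tau : nat -> R.
Hypothesis tail_b : forall m k, \sum_(i < k) b (m + i)%N ^+ 2 <= tau m.
Hypothesis tau0 : tau m @[m --> \oo] --> (0 : R).

Lemma maximal_inequality m eps : 0 < eps ->
  (P (\bigcup_k hit m eps k) <= (tau m / eps ^+ 2)%:E)%E.
Proof.
move=> eps0.
have bnd k : (P (hit m eps k) <= (tau m / eps ^+ 2)%:E)%E.
  have [I2 E2] := frozen_moment2 m k eps0.
  have Ie : L1 P (fun w => eps ^- 2 * frozen m eps k w ^+ 2) by exact: integrableRZ.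
  apply: (@le_trans _ _ (\int[P]_w (eps ^- 2 * frozen m eps k w ^+ 2)%:E)%E).
    have -> : P (hit m eps k) = (\int[P]_w (\1_(hit m eps k) w)%:E)%E.
      by rewrite integral_indic// setIT.
    apply: ge0_le_integral => //=.
    - exact/measurable_EFinP/measurable_indic.
    - by case/integrableP : Ie.
    - move=> w _; rewrite lee_fin indicE; case: (boolP (w \in hit m eps k)) => [|_] /=; last first.
        by rewrite mulr_ge0 ?sqr_ge0// invr_ge0 exprn_ge0// ltW.
      rewrite inE /hit /= => h; rewrite mulrC ler_pdivlMr ?exprn_gt0// mul1r.
      by rewrite -[leRHS]real_normK ?num_real// lerXn2r ?nnegrE// ltW.
  rewrite -[leLHS]fineK; last exact: integrable_fin_num.
  have EZ : \int[P]_w (eps ^- 2 * frozen m eps k w ^+ 2) =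
    eps ^- 2 * \int[P]_w (frozen m eps k w ^+ 2) by rewrite RintegralZl.
  rewrite lee_fin [leLHS]EZ mulrC ler_wpM2r//.
    by rewrite invr_ge0 exprn_ge0// ltW.
  exact: le_trans E2 (tail_b _ _).
have mU : measurable (\bigcup_k hit m eps k) by exact: bigcupT_measurable.
have lim := @nondecreasing_cvg_mu _ _ _ P _ (@mhit m eps) mU (@nd_hit m eps).
by apply: (cvge_to_le lim); exact: nearW.
Qed.

(** The Cauchy criterion written with countable operations only, which makes the set of convergence
    measurable. *)
Let cauchy_set : set T := \bigcap_j \bigcup_m \bigcap_k
  [set w | `|S b (m + k) w - S b m w| <= j.+1%:R^-1].

Let mcauchy_set : measurable cauchy_set.
Proof.
apply: bigcapT_measurable => j; apply: bigcupT_measurable => m.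
apply: bigcapT_measurable => k; rewrite -[X in measurable X]setTI.
have mf : measurable_fun setT (fun w => `|S b (m + k) w - S b m w| <= j.+1%:R^-1).
  apply: measurable_fun_ler => //; apply: measurableT_comp => //.
  by apply: measurable_funB; exact: (measurable_xsum mY mZ).
by have := mf measurableT [set true] I; apply.
Qed.

Let cauchy_setP w : cauchy_set w <-> cvgn (S b ^~ w).
Proof.
split=> [Dw|/cvg_ex[l Sl] j _].
  apply/cauchy_cvgP/cauchyP => e e0.
  have [m _ hm] := Dw (Num.truncn e^-1) I.
  exists (S b m w); exists m => // k /= mk; rewrite /ball/=.
  have := hm (k - m)%N I; rewrite /= subnKC// distrC => /le_lt_trans; apply.
  by rewrite invf_plt ?posrE ?ltr0n//; exact: Num.Theory.truncnS_gt.
have e0 : 0 < j.+1%:R^-1 / 2 :> R by rewrite divr_gt0// invr_gt0 ltr0n.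
have /cvgrPdist_le/(_ _ e0)[m _ hm] := Sl.
exists m => // k _ /=; apply: le_trans (ler_distD l _ _) _.
rewrite (splitr j.+1%:R^-1) distrC; apply: lerD; apply: hm => //=.
exact: leq_addr.
Qed.

(** Where the series diverges, some level [j.+1%:R^-1] is exceeded after every [m]; for fixed [j]
    the probability of this is at most a multiple of [tau m], for all [m]. *)
Lemma xsum_ae_cvg : {ae P, forall w, cvgn (S b ^~ w)}.
Proof.
have e0 (j : nat) : 0 < j.+1%:R^-1 / 2 :> R by rewrite divr_gt0// invr_gt0 ltr0n.
pose N := \bigcup_j \bigcap_m \bigcup_k hit m (j.+1%:R^-1) k.
have nN : P.-negligible N.
  apply: negligible_bigcup => j; exists (\bigcap_m \bigcup_k hit m (j.+1%:R^-1) k).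
  have ej : 0 < j.+1%:R^-1 :> R by rewrite invr_gt0 ltr0n.
  have mN : measurable (\bigcap_m \bigcup_k hit m (j.+1%:R^-1) k).
    by apply: bigcapT_measurable => m; apply: bigcupT_measurable => k; exact: mhit.
  split => //; apply/eqP; rewrite eq_le measure_ge0 andbT.
  have lim : (tau m / (j.+1%:R^-1) ^+ 2)%:E @[m --> \oo] --> 0%:E.
    apply: cvg_EFin; first exact: nearW.
    by rewrite -(mul0r ((j.+1%:R^-1) ^- 2)); apply: cvgM => //; exact: cvg_cst.
  apply: (cvge_to_ge lim); apply: nearW => m.
  apply: le_trans (maximal_inequality m ej); apply: le_measure; rewrite ?inE//.
    by apply: bigcupT_measurable => k; exact: mhit.
  by move=> w Nw; exact: Nw m I.
apply: negligibleS nN => w /= ncvg.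
have : ~ cauchy_set w by move/cauchy_setP.
move=> /existsNP[j /not_implyP[_ nj]]; exists j => // m _.
apply: contrapT => nk; apply: nj; exists m => // k _ /=.
rewrite leNgt; apply/negP => h; apply: nk; exists k => //=.
exact/frozen_max/ltW.
Qed.

Lemma measurable_xsum_lim : measurable_fun setT (fun w => lim (S b n w @[n --> \oo])).
Proof.
(* Off the set of convergence [lim] returns the default [point]; giving the approximations this
   value there makes them converge everywhere. *)
apply: (@measurable_fun_cvg _ _ _ _ (fun n w => if w \in cauchy_set then S b n w else point)).
  move=> n; apply: measurable_fun_ifT => //; last exact: (measurable_xsum mY mZ).
  apply: (@measurable_fun_bool _ _ _ _ true) => //.
  by rewrite setTI (_ : _ @^-1` _ = cauchy_set)//; apply/seteqP; split => w /=; [exact: set_mem|exact: mem_set].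
move=> w _; have [wD|wD] := boolP (w \in cauchy_set).
  by have /set_mem/cauchy_setP := wD.
have : ~ cvgn (S b ^~ w) by move/cauchy_setP/mem_set; rewrite (negbTE wD).
by move/dvgP => ->; exact: cvg_cst.
Qed.

End almost_sure_convergence.

(** * Recovering the weights from the Laplace transform *)

Section power_sums.
Context (R : realType).

(* [log_rem y] starts its Taylor expansion at order three: subtracting the
   quadratic term removes the Gaussian part of the limit. *)
Definition log_rem (y : R) : R := y - y ^+ 2 / 2 - ln (1 + y).

(** The derivative of the remainder is [(1 + y)^-1] minus a partial geometric sum, that is
    [(- y) ^+ k / (1 + y)]. *)
Lemma ln_taylor k (y : R) : 0 <= y ->
  `|ln (1 + y) - \sum_(1 <= j < k.+1) (-1) ^+ j.+1 * y ^+ j / j%:R| <= y ^+ k.+1.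
Proof.
move=> y0; rewrite -[leRHS]mul1r.
apply: (@derive_bound_ge0 R (fun y => ln (1 + y) - \sum_(1 <= j < k.+1) (-1) ^+ j.+1 * y ^+ j / j%:R)
  (fun y => (- y) ^+ k / (1 + y))) => //.
- move=> {y0} y0 y00.
  have -> : (- y0) ^+ k / (1 + y0) = (1 + y0)^-1 - \sum_(0 <= j < k) (- y0) ^+ j.
    have := subrX1 (- y0) k.
    have d0 : 1 + y0 != 0 by rewrite gt_eqF// ltr_wpDr.
    rewrite big_mkord => h; apply/(mulIf d0); rewrite divfK// mulrBl mulVf//.
    by rewrite -[LHS](subrK 1) h; ring.
  elim: k => [|k IHk].
    rewrite (_ : (fun y1 => _) = (fun y1 : R => ln (1 + y1))); last first.
      by apply/funext => z; rewrite big_geq// subr0.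
    rewrite big_geq// subr0.
    have d0 : 0 < 1 + y0 by rewrite ltr_wpDr.
    have d1 : is_derive y0 (1 : R) (fun z : R => 1 + z) 1.
      by apply: is_derive_eq; rewrite add0r mulr1.
    have := @is_derive1_comp R (@ln R) (fun z => 1 + z) y0 _ _ (is_derive1_ln d0) d1.
    by rewrite mulr1.
  rewrite (_ : (fun y1 => _) = (fun y1 : R => (ln (1 + y1) -
    \sum_(1 <= j < k.+1) (-1) ^+ j.+1 * y1 ^+ j / j%:R) -
    ((-1) ^+ k.+2 / k.+1%:R) * y1 ^+ k.+1)); last first.
    by apply/funext => z; rewrite big_nat_recr//= opprD addrA; congr (_ - _); rewrite mulrAC.
  rewrite big_nat_recr//= opprD addrA.
  have d2 : is_derive y0 (1 : R) (fun y1 : R => (-1) ^+ k.+2 / k.+1%:R * y1 ^+ k.+1)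
      ((- y0) ^+ k).
    rewrite (_ : (fun y1 => _) = ((-1) ^+ k.+2 / k.+1%:R) *: ((id : R -> R) ^+ k.+1)); last first.
      by apply/funext => z; rewrite /= exprfctE.
    have dX := is_deriveX k.+1 (is_derive_id y0 (1 : R)).
    apply: is_derive_eq (is_deriveZ _ dX) _; rewrite /GRing.scale/= mulr1.
    have : k.+1%:R != 0 :> R by rewrite pnatr_eq0.
    move: (k.+1%:R : R) => c c0.
    by rewrite [(- y0) ^+ k]exprNn !exprS !mulN1r !opprK /=; field.
  exact: (is_deriveB IHk d2).
- rewrite addr0 ln1 big_nat_cond big1 ?subr0// => j /andP[/andP[j0 _] _].
  by rewrite expr0n gtn_eqF// mulr0 mul0r.
- move=> z z0; rewrite mul1r normrM normrX normrN (ger0_norm z0) normfV.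
  rewrite (ger0_norm (x := 1 + z)) ?addr_ge0// ler_pdivrMr ?ltr_wpDr//.
  by rewrite ler_peMr ?exprn_ge0// lerDl.
Qed.

Lemma log_rem_taylor k (y : R) : (2 <= k)%N -> 0 <= y ->
  `|log_rem y - \sum_(3 <= j < k.+1) (-1) ^+ j * y ^+ j / j%:R| <= y ^+ k.+1.
Proof.
move=> k2 y0; apply: le_trans (ln_taylor k y0); rewrite -normrN.
rewrite (_ : - (log_rem y - _) = ln (1 + y) -
   \sum_(1 <= j < k.+1) (-1) ^+ j.+1 * y ^+ j / j%:R)//.
rewrite [\sum_(1 <= j < k.+1) _](@big_ltn _ _ _ 1)//; last by rewrite ltnS (leq_trans _ k2).
rewrite [\sum_(2 <= j < k.+1) _](@big_ltn _ _ _ 2)//.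
have -> : \sum_(3 <= i < k.+1) (-1) ^+ i.+1 * y ^+ i / i%:R =
  - \sum_(3 <= i < k.+1) (-1) ^+ i * y ^+ i / i%:R.
  by rewrite -sumrN; apply: eq_bigr => i _; rewrite exprS mulN1r !mulNr.
by rewrite /log_rem expr1 !exprS expr0; field.
Qed.

Context (be : nat -> nat -> R) (n : nat -> nat) (b : nat -> R) (r : nat).
Hypothesis be01 : forall k s, 0 <= be k s <= 1.
Hypothesis be_dec : forall k s t, (s <= t)%N -> be k t <= be k s.
Hypothesis be_out : forall k s, (n k <= s)%N -> be k s = 0.
Hypothesis be_norm : forall k, \sum_(s < n k) be k s ^+ 2 <= 1.
Hypothesis b01 : forall s, 0 <= b s <= 1.
Hypothesis b_dec : forall s t, (s <= t)%N -> b t <= b s.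
Hypothesis b_out : forall s, (r <= s)%N -> b s = 0.
Hypothesis b_norm : \sum_(s < r) b s ^+ 2 <= 1.

(** The error does not depend on the number of terms: powers of the weights beyond the square are at
    most the square, and the squares sum to at most one. *)
Let sum_taylor (a : nat -> R) m j t : (forall s, 0 <= a s <= 1) ->
  \sum_(s < m) a s ^+ 2 <= 1 -> (2 <= j)%N -> 0 <= t ->
  `|\sum_(s < m) log_rem (t * a s) -
    \sum_(3 <= i < j.+1) (-1) ^+ i * t ^+ i / i%:R * \sum_(s < m) a s ^+ i| <= t ^+ j.+1.
Proof.
move=> a01 a1 j2 t0.
have -> : \sum_(3 <= i < j.+1) (-1) ^+ i * t ^+ i / i%:R * \sum_(s < m) a s ^+ i =
    \sum_(s < m) \sum_(3 <= i < j.+1) (-1) ^+ i * (t * a s) ^+ i / i%:R.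
  rewrite exchange_big/=; apply: eq_bigr => i _; rewrite mulr_sumr.
  by apply: eq_bigr => s _; rewrite exprMn; ring.
rewrite -sumrB; apply: le_trans (ler_norm_sum _ _ _) _.
apply: (@le_trans _ _ (\sum_(s < m) t ^+ j.+1 * a s ^+ 2)).
  apply: ler_sum => s _; have /andP[as0 as1] := a01 s.
  apply: le_trans (log_rem_taylor j2 (mulr_ge0 t0 as0)) _.
  rewrite exprMn ler_wpM2l ?exprn_ge0//.
  by rewrite -(subnK (leq_trans j2 (leqnSn j))) exprD ler_piMl ?sqr_ge0// exprn_ile1.
by rewrite -mulr_sumr ler_piMr// exprn_ge0.
Qed.

(** Coefficient extraction by strong induction: once the orders below [j] are known to converge,
    they are subtracted, and dividing by [t ^+ j] leaves the power sum of order [j] up to an error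
    of order [t]. *)
Lemma power_sums_cvg :
  (forall t, 0 <= t -> \sum_(s < n k) log_rem (t * be k s) @[k --> \oo] -->
     \sum_(s < r) log_rem (t * b s)) ->
  forall j, (3 <= j)%N ->
    \sum_(s < n k) be k s ^+ j @[k --> \oo] --> \sum_(s < r) b s ^+ j.
Proof.
move=> Hlog; elim/ltn_ind => j IHj j3.
apply/cvgrPdist_le => e e0.
have j0 : 0 < j%:R :> R by rewrite ltr0n (leq_trans _ j3).
(* The two Taylor remainders total [2 * t ^+ j.+1], which this choice makes equal to
   [t ^+ j / j%:R * (e / 2)]. *)
pose t : R := e / (4 * j%:R).
have t0 : 0 < t by rewrite divr_gt0// mulr_gt0.
have tj0 : 0 < t ^+ j by rewrite exprn_gt0.
pose co i : R := (-1) ^+ i * t ^+ i / i%:R.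
pose A k := (\sum_(s < n k) log_rem (t * be k s) - \sum_(s < r) log_rem (t * b s)) -
  \sum_(3 <= i < j) co i * (\sum_(s < n k) be k s ^+ i - \sum_(s < r) b s ^+ i).
have Acvg : A k @[k --> \oo] --> (0 : R).
  rewrite -[X in _ --> X](subr0 0); apply: cvgB.
    by rewrite -[X in _ --> X](subrr (\sum_(s < r) log_rem (t * b s)));
      apply: cvgB; [exact/Hlog/ltW|exact: cvg_cst].
  have : forall m, (m <= j)%N -> \sum_(3 <= i < m) co i * (\sum_(s < n k) be k s ^+ i - \sum_(s < r) b s ^+ i)
      @[k --> \oo] --> (0 : R).
    elim => [|m IHm] mj; first by under eq_fun do rewrite big_geq//; exact: cvg_cst.
    have [m3|m3] := ltnP m 3.
      by under eq_fun do rewrite big_geq//; exact: cvg_cst.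
    have step : (\sum_(3 <= i < m) co i * (\sum_(s < n k) be k s ^+ i - \sum_(s < r) b s ^+ i)) +
        co m * (\sum_(s < n k) be k s ^+ m - \sum_(s < r) b s ^+ m) @[k --> \oo] -->
        0 + co m * (\sum_(s < r) b s ^+ m - \sum_(s < r) b s ^+ m).
      apply: cvgD; first exact/IHm/ltnW.
      apply: cvgM; first exact: cvg_cst.
      by apply: cvgB; [exact: IHj|exact: cvg_cst].
    rewrite subrr mulr0 addr0 in step.
    by under eq_fun do rewrite big_nat_recr//=.
  by apply.
have main k : t ^+ j / j%:R * `|\sum_(s < r) b s ^+ j - \sum_(s < n k) be k s ^+ j|
    <= `|A k| + 2 * t ^+ j.+1.
  have j2 : (2 <= j)%N by exact: ltnW.
  have h1 := sum_taylor (be01 k) (be_norm k) j2 (ltW t0).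
  have h2 := sum_taylor b01 b_norm j2 (ltW t0).
  move: h1 h2; rewrite !big_nat_recr//= -/(co j).
  rewrite (_ : t ^+ j / j%:R * _ = `|co j * (\sum_(s < n k) be k s ^+ j - \sum_(s < r) b s ^+ j)|); last first.
    rewrite normrM distrC; congr (_ * _).
    by rewrite /co !normrM normrX normrN1 expr1n mul1r ger0_norm ?ltW// normfV ger0_norm ?ltW.
  rewrite /A.
  have -> : \sum_(3 <= i < j) co i * (\sum_(s < n k) be k s ^+ i - \sum_(s < r) b s ^+ i) =
     \sum_(3 <= i < j) co i * (\sum_(s < n k) be k s ^+ i) -
     \sum_(3 <= i < j) co i * (\sum_(s < r) b s ^+ i).
    by rewrite -sumrB; apply: eq_bigr => i _; rewrite mulrBr.
  rewrite -/co mulrBr.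
  set G1 := \sum_(s < n k) log_rem _; set G2 := \sum_(s < r) log_rem _.
  set q1 := \sum_(3 <= i < j) _; set q2 := \sum_(3 <= i < j) _.
  set w1 := co j * _; set w2 := co j * _ => h1 h2.
  rewrite (_ : w1 - w2 = (G1 - G2 - (q1 - q2)) - (G1 - (q1 + w1)) + (G2 - (q2 + w2))); last by ring.
  apply: le_trans (ler_normD _ _) _.
  have := ler_normB (G1 - G2 - (q1 - q2)) (G1 - (q1 + w1)); move: h1 h2; lra.
have e1 : 0 < t ^+ j / j%:R * (e / 2) by rewrite mulr_gt0 ?divr_gt0.
move/cvgrPdist_le : Acvg => /(_ _ e1); apply: filterS => k; rewrite sub0r normrN => hA.
have := main k; rewrite exprSr => hm.
have tj : 0 < t ^+ j / j%:R by rewrite divr_gt0.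
rewrite -(ler_pM2l tj); apply: le_trans hm _.
have -> : 2 * (t ^+ j * t) = t ^+ j / j%:R * (e / 2).
  by rewrite {2}/t; field; rewrite gt_eqF.
by rewrite [in leRHS](splitr e) mulrDr lerD2r.
Qed.

End power_sums.

Section points_of_power_sums.
Context (R : realType).

(* Shows that the tail power sums, squeezed by tail_bounds between a_m^(j+3) and a_m^(j+1),
   determine a_m. *)
Lemma exponent_gap (x y : R) : 0 <= x -> x < y -> exists j, x ^+ j.+1 < y ^+ j.+3.
Proof.
move=> x0 xy; have y0 : 0 < y by exact: le_lt_trans xy.
have z1 : `|x / y| < 1.
  by rewrite ger0_norm ?divr_ge0// ?(ltW y0)// ltr_pdivrMr// mul1r.
have y20 : 0 < y ^+ 2 by rewrite exprn_gt0.
have /cvgrPdist_lt/(_ _ y20) ev := cvg_expr z1.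
have [j] := filter_ex ev; rewrite sub0r normrN => hj.
exists j; rewrite (_ : j.+3 = (2 + j.+1)%N)// exprD -ltr_pdivrMr ?exprn_gt0//.
rewrite -expr_div_n exprS; apply: le_lt_trans hj.
rewrite normrX ger0_norm ?divr_ge0// ?(ltW y0)// ler_piMl//.
  by rewrite exprn_ge0// divr_ge0// ltW.
by move: z1; rewrite ger0_norm ?divr_ge0// ?(ltW y0)// => /ltW.
Qed.

Context (be : nat -> nat -> R) (n : nat -> nat) (b : nat -> R) (r : nat).
Hypothesis be01 : forall k s, 0 <= be k s <= 1.
Hypothesis be_dec : forall k s t, (s <= t)%N -> be k t <= be k s.
Hypothesis be_out : forall k s, (n k <= s)%N -> be k s = 0.
Hypothesis be_norm : forall k, \sum_(s < n k) be k s ^+ 2 <= 1.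
Hypothesis b01 : forall s, 0 <= b s <= 1.
Hypothesis b_dec : forall s t, (s <= t)%N -> b t <= b s.
Hypothesis b_out : forall s, (r <= s)%N -> b s = 0.
Hypothesis b_norm : \sum_(s < r) b s ^+ 2 <= 1.

Let tail (a : nat -> R) p m j := \sum_(s < p) a s ^+ j - \sum_(s < m) a s ^+ j.

(** Below, the tail contains its first term; above, all but two factors of each term are replaced by
    [a m] and the remaining squares sum to at most one. *)
Let tail_bounds (a : nat -> R) p m j : (forall s, 0 <= a s <= 1) ->
  (forall s t, (s <= t)%N -> a t <= a s) -> (forall s, (p <= s)%N -> a s = 0) ->
  \sum_(s < p) a s ^+ 2 <= 1 ->
  a m ^+ j.+3 <= tail a p m j.+3 <= a m ^+ j.+1.
Proof.
(* The padding includes the index [m] even when it lies beyond [p]. *)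
move=> a01 adec aout a1; pose N := maxn p m.+1.
have pN : (p <= N)%N by exact: leq_maxl.
have mN : (m < N)%N by exact: leq_maxr.
have sumN i : \sum_(s < p) a s ^+ i.+1 = \sum_(s < N) a s ^+ i.+1.
  rewrite -!(big_mkord xpredT (fun s => a s ^+ i.+1)) [RHS](big_cat_nat (n := p))//=.
  rewrite [X in _ + X]big_nat_cond [X in _ + X]big1 ?addr0// => s.
  by move=> /andP[/andP[ps _] _]; rewrite aout// expr0n.
have tailE i : tail a p m i.+1 = \sum_(m <= s < N) a s ^+ i.+1.
  rewrite /tail sumN -!(big_mkord xpredT (fun s => a s ^+ i.+1)).
  by rewrite [X in X - _ = _](big_cat_nat (n := m))//= ?(ltnW mN)//; ring.
have ge0 s : 0 <= a s by case/andP: (a01 s).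
rewrite tailE; apply/andP; split.
  by rewrite big_ltn// lerDl sumr_ge0// => s _; rewrite exprn_ge0.
apply: (@le_trans _ _ (\sum_(m <= s < N) a m ^+ j.+1 * a s ^+ 2)).
  rewrite big_nat_cond [leRHS]big_nat_cond; apply: ler_sum => s /andP[/andP[ms _] _].
  rewrite (_ : j.+3 = (j.+1 + 2)%N); last by rewrite addn2.
  by rewrite exprD ler_wpM2r ?sqr_ge0// lerXn2r ?nnegrE// adec.
rewrite -mulr_sumr ler_piMr ?exprn_ge0//; apply: le_trans a1.
rewrite (sumN 1%N) -(big_mkord xpredT (fun s => a s ^+ 2)) [leRHS](big_cat_nat (n := m))//= ?(ltnW mN)//.
by rewrite lerDr sumr_ge0// => s _; exact: sqr_ge0.
Qed.

(** Once the earlier weights converge, so do the tails from [m] on. A deviation of [be k m] from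
    [b m] by [e] contradicts the convergence of the tail for the exponent supplied by
    [exponent_gap]. *)
Lemma points_cvg :
  (forall j, (3 <= j)%N ->
    \sum_(s < n k) be k s ^+ j @[k --> \oo] --> \sum_(s < r) b s ^+ j) ->
  forall s, be k s @[k --> \oo] --> b s.
Proof.
move=> Hp; elim/ltn_ind => m IHm.
have tail_cvg j : tail (be k) (n k) m j.+3 @[k --> \oo] --> tail b r m j.+3.
  apply: cvgB; first exact: Hp.
  rewrite -!(big_mkord xpredT (fun s => b s ^+ j.+3)).
  under eq_fun do rewrite -(big_mkord xpredT (fun s => be _ s ^+ j.+3)).
  have : forall p, (p <= m)%N -> \sum_(0 <= s < p) be k s ^+ j.+3 @[k --> \oo] -->
      \sum_(0 <= s < p) b s ^+ j.+3.
    elim => [|p IHp] pm.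
      by under eq_fun do rewrite big_geq//; rewrite big_geq//; exact: cvg_cst.
    under eq_fun do rewrite big_nat_recr//=; rewrite big_nat_recr//=.
    apply: cvgD; first exact/IHp/ltnW.
    apply: (@cvg_comp _ _ _ _ (fun z : R => z ^+ j.+3)); last exact: exprn_continuous.
    exact: IHm.
  by apply.
have be_b k j := tail_bounds m j (be01 k) (@be_dec k) (be_out (k := k)) (be_norm k).
have b_b j := tail_bounds m j b01 b_dec b_out b_norm.
have bm0 : 0 <= b m by case/andP: (b01 m).
have bem0 k : 0 <= be k m by case/andP: (be01 k m).
apply/cvgrPdist_le => e e0.
have up : \forall k \near \oo, be k m <= b m + e.
  have [j hj] : exists j, b m ^+ j.+1 < (b m + e) ^+ j.+3.
    by apply: exponent_gap => //; rewrite ltrDl.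
  have lt : tail b r m j.+3 < (b m + e) ^+ j.+3.
    by apply: le_lt_trans hj; case/andP: (b_b j).
  have ev : \forall k \near \oo, tail (be k) (n k) m j.+3 < (b m + e) ^+ j.+3.
    exact: cvgr_lt (tail_cvg j) _ lt.
  apply: filterS ev => k hk.
  have /andP[h1 _] := be_b k j; have h2 := le_lt_trans h1 hk.
  rewrite leNgt; apply/negP => h3; have : (b m + e) ^+ j.+3 <= be k m ^+ j.+3.
    by rewrite lerXn2r ?nnegrE ?addr_ge0 ?(ltW e0)// ltW.
  by rewrite leNgt h2.
have lo : \forall k \near \oo, b m - e <= be k m.
  have [be'|be'] := leP (b m) e.
    by apply: nearW => k; apply: le_trans (bem0 k); rewrite subr_le0.
  have c0 : 0 <= b m - e by rewrite subr_ge0 ltW.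
  have [j hj] : exists j, (b m - e) ^+ j.+1 < b m ^+ j.+3.
    by apply: exponent_gap => //; rewrite ltrBlDr ltrDl.
  have lt : (b m - e) ^+ j.+1 < tail b r m j.+3.
    by apply: lt_le_trans hj _; case/andP: (b_b j).
  have ev : \forall k \near \oo, (b m - e) ^+ j.+1 < tail (be k) (n k) m j.+3.
    exact: cvgr_gt (tail_cvg j) _ lt.
  apply: filterS ev => k hk.
  have /andP[_ h1] := be_b k j; have h2 := lt_le_trans hk h1.
  rewrite leNgt; apply/negP => h3; have : be k m ^+ j.+1 <= (b m - e) ^+ j.+1.
    by rewrite lerXn2r ?nnegrE// ltW.
  by rewrite leNgt h2.
near=> k.
rewrite distrC ler_distl; apply/andP; split; near: k; [exact: lo|exact: up].
Unshelve. all: by end_near. Qed.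

End points_of_power_sums.

(** * Laplace transforms of the weighted sums and the converse implication *)

Section laplace_limits.
Context (R : realType) (d : measure_display) (T : measurableType d)
  (P : probability T R).

(** Convergence in law applies to the exponential truncated at [M]. Truncation costs at most
    [C / M], since [y > M] implies [y <= y ^+ 2 / M] and the square is the exponential at
    [2 * t]. *)
Lemma expR_moment_cvg (V : nat -> T -> R) (L : T -> R) (t C : R) :
  (forall k, measurable_fun setT (V k)) -> measurable_fun setT L ->
  (forall k, L1 P (fun w => expR (- (t * V k w)))) ->
  L1 P (fun w => expR (- (t * L w))) ->
  (forall k, L1 P (fun w => expR (- (2 * t * V k w)))) ->
  L1 P (fun w => expR (- (2 * t * L w))) ->
  (forall k, \int[P]_w expR (- (2 * t * V k w)) <= C) ->
  \int[P]_w expR (- (2 * t * L w)) <= C ->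
  (forall (f : R -> R) (B : R), continuous f -> (forall x, `|f x| <= B) ->
    \int[P]_w f (V k w) @[k --> \oo] --> \int[P]_w f (L w)) ->
  \int[P]_w expR (- (t * V k w)) @[k --> \oo] --> \int[P]_w expR (- (t * L w)).
Proof.
move=> mV mL I1 J1 I2 J2 IC JC law; apply/cvgrPdist_le => e e0.
(* Makes each of the two truncation errors at most [e / 3]; adding one keeps [M] positive. *)
pose M := 3 * (`|C| + 1) / e.
have C0 : 0 < `|C| + 1 by rewrite ltr_wpDl.
have M0 : 0 < M by rewrite divr_gt0// mulr_gt0.
have CM : C / M <= e / 3.
  rewrite ler_pdivrMr// /M (_ : e / 3 * _ = `|C| + 1); last first.
    by field; rewrite gt_eqF.
  by rewrite ler_wpDr// ler_norm.
pose f (x : R) := Num.min (expR (- (t * x))) M.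
have cf : continuous f.
  apply: (@min_fun_continuous _ R R (fun x => expR (- (t * x))) (fun=> M)); last by move=> ?; exact: cvg_cst.
  move=> x; apply: continuous_comp; last exact: continuous_expR.
  by apply: cvgN; apply: cvgM => //; exact: cvg_cst.
have f0 x : 0 <= f x by rewrite /f le_min expR_ge0 ltW.
have fB x : `|f x| <= M by rewrite ger0_norm// /f ge_min lexx orbT.
have gap x : `|expR (- (t * x)) - f x| <= expR (- (2 * t * x)) / M.
  have -> : expR (- (2 * t * x)) = expR (- (t * x)) ^+ 2.
    by rewrite -expRM_natl; congr expR; ring.
  set y := expR _; have y0 : 0 < y by exact: expR_gt0.
  rewrite /f -/y; have [yM|yM] := leP y M.
    by rewrite subrr normr0 divr_ge0 ?sqr_ge0// ltW.
  rewrite ger0_norm ?subr_ge0 ?(ltW yM)// ler_pdivlMr//.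
  apply: (@le_trans _ _ (y * M)); first by rewrite ler_wpM2r ?(ltW M0)// gerBl ltW.
  by rewrite expr2 ler_wpM2l ?ltW.
have near_trunc (U : T -> R) : measurable_fun setT U ->
    L1 P (fun w => expR (- (t * U w))) -> L1 P (fun w => expR (- (2 * t * U w))) ->
    \int[P]_w expR (- (2 * t * U w)) <= C ->
    `|\int[P]_w expR (- (t * U w)) - \int[P]_w f (U w)| <= e / 3.
  move=> mU K1 K2 KC.
  have If : L1 P (fun w => f (U w)) by exact: (integrable_bounded_comp P mU cf fB).
  have K3 : L1 P (fun w => expR (- (2 * t * U w)) / M).
    have := integrableRZ (M^-1) K2; apply: eq_integrable => // w _ /=.
    by rewrite mulrC.
  apply: le_trans CM; apply: (@le_trans _ _ (\int[P]_w (expR (- (2 * t * U w)) / M))).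
    by apply: Rintegral_dist_le => // w; exact: gap.
  by rewrite RintegralZr// ler_wpM2r// invr_ge0 ltW.
have e30 : 0 < e / 3 by rewrite divr_gt0.
have /cvgrPdist_le/(_ _ e30) ev := law f M cf fB.
apply: filterS ev => k hk.
have h1 := near_trunc _ (mV k) (I1 k) (I2 k) (IC k).
have h2 := near_trunc _ mL J1 J2 JC.
apply: le_trans (ler_distD (\int[P]_w f (L w)) _ _) _.
apply: (@le_trans _ _ (e / 3 + (e / 3 + e / 3))); last by lra.
apply: lerD => //; apply: le_trans (ler_distD (\int[P]_w f (V k w)) _ _) _.
by apply: lerD => //; rewrite distrC.
Qed.

Context (Y : nat -> T -> R) (Z : T -> R).
Hypotheses (mY : forall s, measurable_fun setT (Y s)) (mZ : measurable_fun setT Z).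
Hypotheses (lawY : forall s, normal_law P (Y s) 0 1) (lawZ : normal_law P Z 0 1).
Hypothesis indYZ : mutually_independent P (joint Y Z).

(** With [y = Num.sqrt 2 * t * be s], centring contributes [y / 2] and the chi-square factor
    [- ln (1 + y) / 2] to the exponent. *)
Lemma mgf_xsum (be : nat -> R) n (t : R) : 0 <= t -> (forall s, 0 <= be s) ->
  measurable_fun setT ((fun w => expR (- (t * xsum Y be n w))) : block (joint Y Z) (past n) -> R) /\
  (L1 P (fun w => expR (- (t * xsum Y be n w))) /\
  \int[P]_w expR (- (t * xsum Y be n w)) =
  expR ((\sum_(s < n) (log_rem (Num.sqrt 2 * t * be s) + (Num.sqrt 2 * t * be s) ^+ 2 / 2)) / 2)).
Proof.
move=> t0 be0.
have s20 : 0 < Num.sqrt 2 :> R by rewrite sqrtr_gt0.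
have s22 : Num.sqrt 2 ^+ 2 = 2 :> R by rewrite sqr_sqrtr.
have mX : measurable_fun setT ((fun w => expR (- (t * xsum Y be n w))) : block (joint Y Z) (past n) -> R).
  apply: measurableT_comp => //; apply: measurableT_comp => //.
  by apply: measurable_funM => //; exact: measurable_past_xsum.
split => //.
pose c := expR (t / Num.sqrt 2 * \sum_(s < n) be s).
pose q w := expR (- (t / Num.sqrt 2 * \sum_(s < n) be s * Y s w ^+ 2)).
have E w : expR (- (t * xsum Y be n w)) = c * q w.
  rewrite /c /q -expRD -mulrBr; congr expR.
  rewrite -mulrN -mulrA; congr (_ * _); rewrite /xsum -sumrN -sumrB mulr_sumr.
  by apply: eq_bigr => s _; rewrite /xi; field; rewrite gt_eqF.
have td0 : 0 <= t / Num.sqrt 2 by rewrite divr_ge0// ltW.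
have Iq : L1 P q.
  apply: (@bounded_integrable _ _ _ _ _ 1).
    apply: measurableT_comp => //; apply: measurableT_comp => //.
    apply: measurable_funM => //; apply: measurable_sum => s; apply: measurable_funM => //.
    exact: measurable_funX.
  move=> w; rewrite ger0_norm ?expR_ge0// -expR0 ler_expR oppr_le0 mulr_ge0//.
  by apply: sumr_ge0 => s _; rewrite mulr_ge0 ?sqr_ge0.
split.
  by have := integrableRZ c Iq; apply: eq_integrable => // w _ /=; rewrite E.
under eq_Rintegral do rewrite E.
rewrite RintegralZl// (Rintegral_exp_quad mY mZ lawY indYZ)//.
have -> : \prod_(s < n) (Num.sqrt (1 + 2 * (t / Num.sqrt 2 * be s)))^-1 =
    expR (- (\sum_(s < n) ln (1 + Num.sqrt 2 * t * be s)) / 2).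
  elim: (n) => [|m IHm]; first by rewrite !big_ord0 oppr0 mul0r expR0.
  rewrite !big_ord_recr/= IHm opprD [in RHS]mulrDl expRD; congr (_ * _).
  have -> : 2 * (t / Num.sqrt 2 * be m) = Num.sqrt 2 * t * be m.
    by rewrite -{1}s22; field; rewrite gt_eqF.
  have y0 : 0 < 1 + Num.sqrt 2 * t * be m by rewrite ltr_wpDr// !mulr_ge0// ltW.
  rewrite mulNr expRN; congr (_^-1); apply/eqP.
  rewrite -(@eqrXn2 _ 2)// ?expR_ge0 ?sqrtr_ge0// sqr_sqrtr ?ltW//.
  by rewrite -expRM_natl [X in expR X]mulrC divfK// lnK.
rewrite /c -expRD; congr expR.
rewrite !mulr_sumr mulNr mulr_suml -sumrN -big_split/= mulr_suml; apply: eq_bigr => s _.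
have -> : t / Num.sqrt 2 = Num.sqrt 2 * t / 2.
  by rewrite -[X in _ = _ / X]s22; field; rewrite gt_eqF.
by rewrite /log_rem; field.
Qed.

(** The quadratic terms give [t ^+ 2 * (1 - c ^+ 2) / 2] and the Gaussian variable supplies the
    missing [t ^+ 2 * c ^+ 2 / 2]: the total is independent of [c]. *)
Lemma mgf_xsum_Z (be : nat -> R) n (t c : R) : 0 <= t -> (forall s, 0 <= be s) ->
  0 <= c -> \sum_(s < n) be s ^+ 2 = 1 - c ^+ 2 ->
  L1 P (fun w => expR (- (t * (xsum Y be n w + c * Z w)))) /\
  \int[P]_w expR (- (t * (xsum Y be n w + c * Z w))) =
  expR ((\sum_(s < n) log_rem (Num.sqrt 2 * t * be s)) / 2 + t ^+ 2 / 2).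
Proof.
move=> t0 be0 c0 bec.
have [mX [IX EX]] := mgf_xsum n t0 be0.
have [Ic Ec] := mgf_normal mZ lawZ (t * c).
have mg : measurable_fun setT (fun z : R => expR (- (t * c * z))).
  by apply: measurableT_comp => //; apply: measurableT_comp => //; exact: measurable_funM.
have [I E] := past_mul_Z mY mZ indYZ mX mg IX Ic.
have eq w : expR (- (t * (xsum Y be n w + c * Z w))) =
   expR (- (t * xsum Y be n w)) * expR (- (t * c * Z w)).
  by rewrite -expRD; congr expR; ring.
split; first by move: I; apply: eq_integrable => // w _ /=; rewrite eq.
under eq_Rintegral do rewrite eq.
rewrite E EX Ec -expRD; congr expR.
have -> : \sum_(s < n) (log_rem (Num.sqrt 2 * t * be s) + (Num.sqrt 2 * t * be s) ^+ 2 / 2) =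
  \sum_(s < n) log_rem (Num.sqrt 2 * t * be s) + t ^+ 2 * (1 - c ^+ 2).
  rewrite big_split/=; congr (_ + _); rewrite -bec mulr_sumr; apply: eq_bigr => s _.
  by rewrite !exprMn sqr_sqrtr//; field.
by field.
Qed.

Context (be : nat -> nat -> R) (n : nat -> nat) (b : nat -> R) (r : nat).
Hypothesis be01 : forall k s, 0 <= be k s <= 1.
Hypothesis be_dec : forall k s t, (s <= t)%N -> be k t <= be k s.
Hypothesis be_out : forall k s, (n k <= s)%N -> be k s = 0.
Hypothesis be_norm : forall k, \sum_(s < n k) be k s ^+ 2 = 1.
Hypothesis b01 : forall s, 0 <= b s <= 1.
Hypothesis b_dec : forall s t, (s <= t)%N -> b t <= b s.
Hypothesis b_out : forall s, (r <= s)%N -> b s = 0.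
Hypothesis b_norm : \sum_(s < r) b s ^+ 2 <= 1.

(** The source of an exponential moment bound uniform in [k]: the number of terms does not
    appear. *)
Let sum_log_rem_le (c : nat -> R) m t : (forall s, 0 <= c s <= 1) ->
  \sum_(s < m) c s ^+ 2 <= 1 -> 0 <= t ->
  \sum_(s < m) log_rem (t * c s) <= t ^+ 3.
Proof.
move=> c01 c1 t0; apply: (@le_trans _ _ (\sum_(s < m) t ^+ 3 * c s ^+ 2)).
  apply: ler_sum => s _; have /andP[cs0 cs1] := c01 s.
  have := log_rem_taylor (leqnn 2) (mulr_ge0 t0 cs0); rewrite big_geq// subr0.
  move=> /(le_trans (ler_norm _)) /le_trans; apply.
  by rewrite exprMn ler_wpM2l ?exprn_ge0// exprS ler_piMl ?sqr_ge0.
by rewrite -mulr_sumr ler_piMr// exprn_ge0.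
Qed.

Lemma points_of_law_limit :
  (forall (f : R -> R) (B : R), continuous f -> (forall x, `|f x| <= B) ->
    \int[P]_w f (xsum Y (be k) (n k) w) @[k --> \oo] -->
    \int[P]_w f (xsum Y b r w + Num.sqrt (1 - \sum_(s < r) b s ^+ 2) * Z w)) ->
  forall s, be k s @[k --> \oo] --> b s.
Proof.
move=> law; have ben k : \sum_(s < n k) be k s ^+ 2 <= 1 by rewrite be_norm.
have be0 k s : 0 <= be k s by case/andP: (be01 k s).
have b0 s : 0 <= b s by case/andP: (b01 s).
apply: (points_cvg be01 be_dec be_out ben b01 b_dec b_out b_norm).
apply: (power_sums_cvg be01 ben b01 b_norm) => tau tau0.
(* The Laplace transform at [t] involves [log_rem] at [Num.sqrt 2 * t]. *)
pose t := tau / Num.sqrt 2.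
have s20 : 0 < Num.sqrt 2 :> R by rewrite sqrtr_gt0.
have t0 : 0 <= t by rewrite divr_ge0// ltW.
have tauE : Num.sqrt 2 * t = tau by rewrite /t; field; rewrite gt_eqF.
pose c := Num.sqrt (1 - \sum_(s < r) b s ^+ 2).
have bc : \sum_(s < r) b s ^+ 2 = 1 - c ^+ 2.
  by rewrite sqr_sqrtr ?subr_ge0//; ring.
have mb u u0 := @mgf_xsum_Z b r u c u0 b0 (sqrtr_ge0 _) bc.
have mbe k u (u0 : 0 <= u) : L1 P (fun w => expR (- (u * xsum Y (be k) (n k) w))) /\
    \int[P]_w expR (- (u * xsum Y (be k) (n k) w)) =
    expR ((\sum_(s < n k) log_rem (Num.sqrt 2 * u * be k s)) / 2 + u ^+ 2 / 2).
  (* The squares of [be k] sum to one, so the sum itself is the case of a Gaussian term with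
     coefficient zero. *)
  have bek : \sum_(s < n k) be k s ^+ 2 = 1 - 0 ^+ 2 by rewrite expr0n subr0.
  have eq : (fun w => expR (- (u * (xsum Y (be k) (n k) w + 0 * Z w)))) =
      (fun w => expR (- (u * xsum Y (be k) (n k) w))).
    by apply/funext => w; rewrite mul0r addr0.
  by rewrite -eq; exact: (mgf_xsum_Z u0 (be0 k) (lexx _) bek).
have t20 : 0 <= 2 * t by rewrite mulr_ge0.
have lim : \int[P]_w expR (- (t * xsum Y (be k) (n k) w)) @[k --> \oo] -->
    \int[P]_w expR (- (t * (xsum Y b r w + c * Z w))).
  apply: (@expR_moment_cvg (fun k => xsum Y (be k) (n k)) _ t
    (expR ((Num.sqrt 2 * (2 * t)) ^+ 3 / 2 + (2 * t) ^+ 2 / 2))) => //.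
  - by move=> k; exact: (measurable_xsum mY mZ).
  - by apply: measurable_funD; [exact: (measurable_xsum mY mZ)|exact: measurable_funM].
  - by move=> k; case: (mbe k t t0).
  - by case: (mb t t0).
  - by move=> k; case: (mbe k _ t20).
  - by case: (mb _ t20).
  - move=> k; rewrite (proj2 (mbe k _ t20)) ler_expR lerD2r ler_wpM2r ?invr_ge0//.
    by apply: sum_log_rem_le => //; rewrite mulr_ge0// ltW.
  - rewrite (proj2 (mb _ t20)) ler_expR lerD2r ler_wpM2r ?invr_ge0//.
    by apply: sum_log_rem_le => //; rewrite mulr_ge0// ltW.
have lnlim : ln (\int[P]_w expR (- (t * xsum Y (be k) (n k) w))) @[k --> \oo] -->
    ln (\int[P]_w expR (- (t * (xsum Y b r w + c * Z w)))).
  apply: cvg_comp; first exact: lim.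
  by apply: continuous_ln; rewrite (proj2 (mb t t0)) expR_gt0.
rewrite (proj2 (mb t t0)) expRK tauE in lnlim.
have lnE : (fun k => ln (\int[P]_w expR (- (t * xsum Y (be k) (n k) w)))) =
    (fun k => (\sum_(s < n k) log_rem (tau * be k s)) / 2 + t ^+ 2 / 2).
  by apply/funext => k; rewrite (proj2 (mbe k t t0)) expRK tauE.
rewrite lnE in lnlim.
have undo (x : R) : (x / 2 + t ^+ 2 / 2 - t ^+ 2 / 2) * 2 = x by field.
rewrite -[X in _ --> X]undo.
rewrite (_ : (fun k => _) = (fun k =>
  ((\sum_(s < n k) log_rem (tau * be k s)) / 2 + t ^+ 2 / 2 - t ^+ 2 / 2) * 2)); last first.
  by apply/funext => k; rewrite undo.
by apply: cvgM; [apply: cvgB => //; exact: cvg_cst|exact: cvg_cst].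
Qed.

End laplace_limits.

(** * Spectral decomposition *)

Section real_spectral_theorem.
Context (R : realType).

Let dot n (u v : 'rV[R]_n) : R := (u *m v^T) 0 0.

Lemma row_dotE n (u v : 'rV[R]_n) : u *m v^T = (dot u v)%:M.
Proof. exact: mx11_scalar. Qed.

Lemma row_dot_sum n (u v : 'rV[R]_n) : (u *m v^T) 0 0 = \sum_i u 0 i * v 0 i.
Proof. by rewrite mxE; apply: eq_bigr => i _; rewrite mxE. Qed.

Lemma row_dot_gt0 n (u : 'rV[R]_n) : u != 0 -> 0 < (u *m u^T) 0 0.
Proof.
move=> u0; rewrite row_dot_sum lt_neqAle; apply/andP; split; last first.
  by apply: sumr_ge0 => i _; rewrite -expr2 sqr_ge0.
apply: contra u0; rewrite eq_sym psumr_eq0; last by move=> i _; rewrite -expr2 sqr_ge0.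
move=> /allP h; apply/eqP/rowP => i; rewrite mxE; apply/eqP.
by have := h i (mem_index_enum _); rewrite mulf_eq0 orbb.
Qed.

(** The Householder reflection in the hyperplane orthogonal to [u - v]; equality of the norms gives
    [2 * dot u w = dot w w] for [w = u - v]. *)
Lemma reflection_exists n (u v : 'rV[R]_n) : (u *m u^T) 0 0 = (v *m v^T) 0 0 ->
  exists H : 'M[R]_n, [/\ H^T = H, H *m H = 1%:M & u *m H = v].
Proof.
move=> uv; have [->|uNv] := eqVneq u v.
  by exists 1%:M; rewrite trmx1 mulmx1 mulmx1.
pose w := u - v; have w0 : 0 < dot w w by apply: row_dot_gt0; rewrite subr_eq0.
have cN : dot w w != 0 by rewrite gt_eqF.
have wu : 2 * dot u w = dot w w.
  rewrite /dot /w !row_dot_sum mulr_sumr.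
  have e : \sum_i (u 0 i * u 0 i) = \sum_i (v 0 i * v 0 i).
    by move: uv; rewrite !row_dot_sum.
  apply/eqP; rewrite -subr_eq0 -sumrB.
  rewrite (_ : \sum_(i < n) _ = \sum_i (u 0 i * u 0 i) - \sum_i (v 0 i * v 0 i)); last first.
    by rewrite -sumrB; apply: eq_bigr => i _; rewrite !mxE; ring.
  by rewrite e subrr.
exists (1%:M - (2 / dot w w) *: (w^T *m w)); split.
- by rewrite linearB/= linearZ/= trmx_mul trmxK trmx1.
- have ww : w^T *m w *m (w^T *m w) = dot w w *: (w^T *m w).
    by rewrite mulmxA -(mulmxA _ w) row_dotE mul_mx_scalar -scalemxAl.
  move: (w^T *m w) ww => W ww.
  rewrite mulmxBl mul1mx mulmxBr mulmx1 -scalemxAl -scalemxAr ww !scalerA.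
  rewrite -addrA -opprD -[RHS]subr0; congr (_ - _).
  by rewrite -scalerBl -scalerDl [X in X *: _](_ : _ = 0) ?scale0r//; field.
- rewrite [LHS]mulmxBr mulmx1 -scalemxAr mulmxA row_dotE mul_scalar_mx scalerA.
  rewrite (_ : 2 / dot w w * dot u w = 1); last by rewrite mulrAC wu divff.
  by rewrite scale1r /w opprB addrC subrK.
Qed.

Lemma char_poly_conj n (A H : 'M[R]_n) : H *m H = 1%:M ->
  char_poly (H *m A *m H) = char_poly A.
Proof.
move=> HH; pose M := map_mx (@polyC R) H.
have MM : M *m M = 1%:M by rewrite -map_mxM HH map_mx1.
rewrite /char_poly (_ : char_poly_mx (H *m A *m H) = M *m char_poly_mx A *m M).
  by rewrite !det_mulmx mulrAC -det_mulmx MM det1 mul1r.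
rewrite /char_poly_mx !map_mxM mulmxBr mulmxBl; congr (_ - _).
by rewrite scalar_mxC -mulmxA MM mulmx1.
Qed.

Lemma char_poly_block n (c : R) (B : 'M[R]_n) :
  char_poly (block_mx (c%:M : 'M[R]_1) 0 0 B : 'M[R]_(1 + n)) = ('X - c%:P) * char_poly B.
Proof.
rewrite /char_poly /char_poly_mx map_block_mx !map_mx0 scalar_mx_block.
rewrite opp_block_mx add_block_mx !oppr0 !addr0 det_ublock; congr (_ * _).
by rewrite det_mx11 !mxE eqxx !mulr1n.
Qed.

(** Deflation: a reflection sends a unit eigenvector for [lam 0] to the first basis vector, and
    symmetry then splits off a block of size one. The remaining block has characteristic polynomial
    given by the shifted [lam], so real roots and their prescribed order pass to the induction. *)
Lemma real_spectral_theorem n (A : 'M[R]_n) (lam : nat -> R) : A^T = A ->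
  char_poly A = \prod_(s < n) ('X - (lam s)%:P) ->
  exists O : 'M[R]_n, O *m O^T = 1%:M /\ O *m A *m O^T = diag_mx (\row_s lam s).
Proof.
elim: n A lam => [|n IHn] A lam symA cpA.
  by exists 1%:M; split; apply/matrixP => -[].
have /eigenvalueP[v vA v0] : eigenvalue A (lam 0%N).
  by rewrite eigenvalue_root_char cpA big_ord_recl rootM root_XsubC eqxx.
pose e : 'rV[R]_(1 + n) := row_mx (1%:M) 0.
have ee : (e *m e^T) 0 0 = 1.
  by rewrite tr_row_mx mul_row_col trmx0 mulmx0 addr0 trmx1 mulmx1 mxE.
pose u := (Num.sqrt (dot v v))^-1 *: v.
have vv := row_dot_gt0 v0.
have uu : (u *m u^T) 0 0 = 1.
  rewrite /u linearZ/= -scalemxAl -scalemxAr scalerA mxE -invfM -expr2 sqr_sqrtr ?ltW//.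
  by rewrite mulVf// gt_eqF.
have uA : u *m A = lam 0%N *: u by rewrite /u -scalemxAl vA !scalerA mulrC.
have [H [symH HH eH]] := reflection_exists (etrans ee (esym uu)).
have uH : u *m H = e by rewrite -eH -mulmxA HH mulmx1.
pose B : 'M[R]_(1 + n) := H *m A *m H.
have symB : B^T = B by rewrite /B !trmx_mul symA symH mulmxA.
have eB : e *m B = lam 0%N *: e.
  by rewrite /B !mulmxA eH uA -scalemxAl uH.
have BE : B = block_mx ((lam 0%N)%:M) 0 0 (drsubmx B).
  have up : usubmx B = row_mx ((lam 0%N)%:M) 0.
    have : e *m B = usubmx B by rewrite -{1}(vsubmxK B) mul_row_col mul1mx mul0mx addr0.
    by rewrite eB => <-; rewrite scale_row_mx scaler0 scale_scalar_mx mulr1.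
  have ulB : ulsubmx B = (lam 0%N)%:M by rewrite /ulsubmx up row_mxKl.
  have urB : ursubmx B = 0 by rewrite /ursubmx up row_mxKr.
  have dlB : dlsubmx B = 0 by rewrite -symB -trmx_ursub urB trmx0.
  by rewrite -{1}(submxK B) ulB urB dlB.
have symB' : (drsubmx B)^T = drsubmx B by rewrite trmx_drsub symB.
have cpB' : char_poly (drsubmx B) = \prod_(s < n) ('X - (lam s.+1)%:P).
  have cpB : char_poly B = char_poly A by exact: char_poly_conj.
  have X0 : 'X - (lam 0%N)%:P != 0 by rewrite polyXsubC_eq0.
  by apply: (mulfI X0); rewrite -char_poly_block -BE cpB cpA big_ord_recl.
have [Q [OO OB]] := IHn _ (fun s => lam s.+1) symB' cpB'.
pose K : 'M[R]_(1 + n) := block_mx (1%:M) 0 0 Q.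
have KT : K^T = block_mx (1%:M) 0 0 Q^T by rewrite /K tr_block_mx !trmx0 trmx1.
have KK : K *m K^T = 1%:M.
  rewrite KT mulmx_block !mulmx0 !mul0mx !addr0 !add0r mulmx1 OO.
  by rewrite -scalar_mx_block.
exists (K *m H); split.
  rewrite trmx_mul symH mulmxA -[K *m H *m H]mulmxA HH mulmx1.
  exact: KK.
have -> : K *m H *m A *m (K *m H)^T = K *m B *m K^T.
  by rewrite trmx_mul symH /B !mulmxA.
rewrite BE KT !mulmx_block.
rewrite !mulmx0 !mul0mx !addr0 !add0r !mulmx1 !mul1mx !mul0mx OB.
apply/matrixP => i j; rewrite !mxE -(inj_eq val_inj)/=.
case: splitP => i' ei; rewrite !mxE; case: splitP => j' ej; rewrite !mxE ei ej ?ord1//=.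
Qed.

Lemma trace_spectral n (A O D : 'M[R]_n) : O *m O^T = 1%:M -> O *m A *m O^T = D ->
  \tr A = \tr D /\ \tr (A *m A) = \tr (D *m D).
Proof.
move=> OO <-; have OQ : O^T *m O = 1%:M by exact: mulmx1C.
split; first by rewrite mxtrace_mulC mulmxA OQ mul1mx.
rewrite !mulmxA -(mulmxA _ O^T O) OQ mulmx1 -(mulmxA O A A) [RHS]mxtrace_mulC.
by rewrite (mulmxA O^T) OQ mul1mx.
Qed.

Lemma spectral_trace n (A : 'M[R]_n) (lam : nat -> R) : A^T = A ->
  char_poly A = \prod_(s < n) ('X - (lam s)%:P) ->
  \tr A = \sum_(s < n) lam s /\ \tr (A *m A) = \sum_(s < n) lam s ^+ 2.
Proof.
move=> symA cpA; have [U [UU UA]] := real_spectral_theorem symA cpA.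
have [-> ->] := trace_spectral UU UA; rewrite mxtrace_diag mulmx_diag mxtrace_diag.
by split; apply: eq_bigr => s _; rewrite !mxE.
Qed.

End real_spectral_theorem.

(** * Kronecker products; mean and variance of the statistic as traces *)

Section tensor_trace.
Context (R : realType).

Lemma sum_mxtens m n (F : 'I_(m * n) -> R) :
  \sum_k F k = \sum_(i < m) \sum_(j < n) F (mxtens_index (i, j)).
Proof.
rewrite (reindex (@mxtens_index m n)) /=; last first.
  exists (@mxtens_unindex m n) => k _; [exact: mxtens_indexK|exact: mxtens_unindexK].
by rewrite pair_big/=; apply: eq_bigr => -[].
Qed.

Lemma mxtrace_tens m n (A : 'M[R]_m) (B : 'M[R]_n) : \tr (A *t B) = \tr A * \tr B.
Proof.
rewrite /mxtrace sum_mxtens mulr_suml; apply: eq_bigr => i _.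
by rewrite mulr_sumr; apply: eq_bigr => j _; rewrite tensmxE.
Qed.

Lemma tensmx_neq0 m n (A : 'M[R]_m) (B : 'M[R]_n) : A != 0 -> B != 0 -> A *t B != 0.
Proof.
move=> /matrix0Pn[i [j Aij]] /matrix0Pn[k [l Bkl]]; apply/matrix0Pn.
by exists (mxtens_index (i, k)), (mxtens_index (j, l)); rewrite tensmxE mulf_neq0.
Qed.

Lemma trace_sqr_gt0 n (A : 'M[R]_n) : A^T = A -> A != 0 -> 0 < \tr (A *m A).
Proof.
move=> symA A0; rewrite lt_neqAle eq_sym; have AE : \tr (A *m A) = \sum_i \sum_j A i j ^+ 2.
  apply: eq_bigr => i _; rewrite mxE; apply: eq_bigr => j _.
  by rewrite -[in X in _ * X]symA mxE expr2.
have ge0 i : 0 <= \sum_j A i j ^+ 2 by apply: sumr_ge0 => j _; exact: sqr_ge0.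
rewrite AE sumr_ge0 ?andbT//; move/matrix0Pn : A0 => [i [j Aij]].
apply: contra Aij; rewrite psumr_eq0// => /allP/(_ i (mem_index_enum _)) /=.
rewrite psumr_eq0; last by move=> ? _; exact: sqr_ge0.
by move=> /allP/(_ j (mem_index_enum _)); rewrite /= sqrf_eq0.
Qed.

End tensor_trace.

Section design_traces.
Context (R : realType) (D : design R).
Hypothesis nsz0 : forall i, (0 < nsz D i)%N.
Hypothesis SigmaP : posdef_mx (Sigma D).
Hypothesis TWP : orth_proj_mx (TW D).
Hypothesis TW0 : TW D != 0.
Hypothesis TSP : orth_proj_mx (TS D).
Hypothesis TS0 : TS D != 0.

Let w : 'rV[R]_(a D) := \row_i ((Ntot D)%:R / (nsz D i)%:R).

Lemma Ntot_gt0 (i : 'I_(a D)) : (0 < Ntot D)%N.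
Proof. by rewrite /Ntot (bigD1 i)//= ltn_addr. Qed.

Let w0 i : 0 < w 0 i.
Proof. by rewrite mxE divr_gt0// ltr0n// (Ntot_gt0 i). Qed.

Lemma TVT_tens : TVT D = (TW D *m diag_mx w *m TW D) *t (TS D *m Sigma D *m TS D).
Proof. by rewrite /TVT /Tmx /VN !tensmx_mul. Qed.

Lemma tr_Tmx : (Tmx D)^T = Tmx D.
Proof. by rewrite /Tmx trmx_tens; case: TWP => -> _; case: TSP => -> _. Qed.

Lemma mul_Tmx : Tmx D *m Tmx D = Tmx D.
Proof. by rewrite /Tmx tensmx_mul; case: TWP => _ ->; case: TSP => _ ->. Qed.

Lemma tr_TVT : (TVT D)^T = TVT D.
Proof.
rewrite TVT_tens trmx_tens !trmx_mul tr_diag_mx !mulmxA.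
by case: TWP => -> _; case: TSP => -> _; case: SigmaP => -> _.
Qed.

(** Together with the trace of the square, this identifies the constants in [Wtilde] with power sums
    of the eigenvalues. Idempotence and cyclicity of the trace remove one projection from each
    Kronecker factor. *)
Lemma trace_TVT : \tr (TVT D) = EQ0 D.
Proof.
rewrite TVT_tens mxtrace_tens /EQ0 mulrC; case: TWP => tW pW; case: TSP => tS pS.
rewrite mxtrace_mulC mulmxA pS [X in _ * X]mxtrace_mulC mulmxA pW; congr (_ * _).
by apply: eq_bigr => i _; rewrite mul_mx_diag !mxE mulrC.
Qed.

Lemma trace_TVT2 : 2 * \tr (TVT D *m TVT D) = VarQ0 D.
Proof.
rewrite TVT_tens tensmx_mul mxtrace_tens /VarQ0 -mulrA; congr (_ * _); rewrite mulrC.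
case: TWP => tW pW; case: TSP => tS pS.
have tr2 n (A B : 'M[R]_n) : A *m A = A ->
    \tr (A *m B *m A *m (A *m B *m A)) = \tr (A *m B *m (A *m B)).
  move=> AA; rewrite !mulmxA -(mulmxA _ A A) AA mxtrace_mulC !mulmxA AA.
  by rewrite -!mulmxA.
rewrite !tr2// expr2; congr (_ * _).
rewrite mul_mx_diag; apply: eq_bigr => i _; rewrite mxE; apply: eq_bigr => j _; rewrite !mxE.
have -> : TW D j i = TW D i j by rewrite -[in LHS]tW mxE.
by rewrite natrX invfM; ring.
Qed.

(** Each Kronecker factor has a positive diagonal entry: a weighted sum of squares of a nonzero row
    of [TW], and the value of the form [Sigma] at a nonzero row of [TS]. *)
Lemma TVT_neq0 : TVT D != 0.
Proof.
rewrite TVT_tens; case: TWP => tW _; case: TSP => tS _; apply: tensmx_neq0.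
- move/matrix0Pn : TW0 => [i [j Wij]]; apply/matrix0Pn; exists i, i.
  rewrite gt_eqF// mul_mx_diag mxE.
  rewrite (eq_bigr (fun r => w 0 r * TW D i r ^+ 2)); last first.
    by move=> r _; rewrite mxE -[in X in _ * X]tW [X in _ * X]mxE; ring.
  rewrite (bigD1 j)//= ltr_pwDl//; first by rewrite mulr_gt0// lt_neqAle eq_sym sqrf_eq0 Wij sqr_ge0.
  by apply: sumr_ge0 => r _; rewrite mulr_ge0 ?sqr_ge0// ltW.
- move/matrix0Pn : TS0 => [i [j Sij]]; apply/matrix0Pn; exists i, i.
  have r0 : row i (TS D) != 0.
    by apply/matrix0Pn; exists 0, j; rewrite mxE.
  have := (proj2 SigmaP) _ r0; rewrite tr_row tS -row_mul => h.
  rewrite gt_eqF//; move: h; congr (0 < _).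
  by rewrite !mxE; apply: eq_bigr => k _; rewrite !mxE.
Qed.

Lemma VarQ0_gt0 : 0 < VarQ0 D.
Proof. by rewrite -trace_TVT2 mulr_gt0// trace_sqr_gt0// ?tr_TVT ?TVT_neq0. Qed.

End design_traces.

(** * The quadratic form of the group means *)

Section stacked_vectors.
Context (R : realType) (D : design R).

Definition unstack (c : 'cV[R]_(a D * dimd D)) : 'M[R]_(a D, dimd D) :=
  \matrix_(i, l) c (mxtens_index (i, l)) 0.

Lemma unstackK c : stack (unstack c) = c.
Proof.
apply/colP => k; rewrite !mxE; congr (c _ 0).
by rewrite -[RHS]mxtens_unindexK; case: (mxtens_unindex k).
Qed.

Lemma dot_stack (M Q : 'M[R]_(a D, dimd D)) :
  ((stack M)^T *m stack Q) 0 0 = \sum_i (row i M *m (row i Q)^T) 0 0.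
Proof.
rewrite mxE sum_mxtens; apply: eq_bigr => i _; rewrite mxE; apply: eq_bigr => l _.
by rewrite !mxE mxtens_indexK.
Qed.

(** The block structure splits the form over the groups, which is the shape in which independent
    observations deliver the variance of a linear form in the group means. *)
Lemma VN_stack (M : 'M[R]_(a D, dimd D)) :
  ((stack M)^T *m VN D *m stack M) 0 0 =
  \sum_i ((Ntot D)%:R / (nsz D i)%:R) * (row i M *m Sigma D *m (row i M)^T) 0 0.
Proof.
pose Q : 'M[R]_(a D, dimd D) :=
  \matrix_(i, l) (((Ntot D)%:R / (nsz D i)%:R) * (Sigma D *m (row i M)^T) l 0).
rewrite -mulmxA (_ : VN D *m stack M = stack Q).
  rewrite dot_stack; apply: eq_bigr => i _; rewrite -mulmxA mxE [X in _ = _ * X]mxE mulr_sumr.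
  by apply: eq_bigr => l _; rewrite ![_^T _ _]mxE ![row _ _ _ _]mxE [Q _ _]mxE; ring.
apply/colP => k; rewrite [RHS]mxE mxE sum_mxtens.
rewrite -[k]mxtens_unindexK; case: (mxtens_unindex k) => i l; rewrite mxtens_indexK/=.
rewrite mxE (bigD1 i)//= [X in _ + X]big1 ?addr0; last first.
  move=> j ji; rewrite big1// => s _; rewrite /VN tensmxE !mxE eq_sym (negbTE ji).
  by rewrite mulr0n !mul0r.
rewrite mxE mulr_sumr; apply: eq_bigr => s _.
by rewrite /VN tensmxE !mxE eqxx mulr1n mxtens_indexK/= mulrA.
Qed.

End stacked_vectors.

Section gaussian_family.
Context (R : realType) (d : measure_display) (T : measurableType d)
  (P : probability T R) (I : eqType) (m : nat) (X : I -> T -> 'rV[R]_m)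
  (nu : I -> 'rV[R]_m) (S : 'M[R]_m).
Hypothesis mX : forall i, random_vector (X i).
Hypothesis indX : mutually_independent P X.
Hypothesis lawX : forall i, mv_normal_law P (X i) (nu i) S.
Hypothesis S_pos : posdef_mx S.

Let dot (u v : 'rV[R]_m) : R := (u *m v^T) 0 0.

Let var_ge0 (v : 'rV[R]_m) : 0 <= (v *m S *m v^T) 0 0.
Proof.
have [->|v0] := eqVneq v 0; first by rewrite !mul0mx mxE.
exact/ltW/(proj2 S_pos).
Qed.

Let measurable_dot i (v : 'rV[R]_m) : measurable_fun setT ((fun w => dot (X i w) v) : block X [:: i] -> R).
Proof.
rewrite /dot; under eq_fun do rewrite mxE; apply: measurable_sum => l.
apply: measurable_funM; last exact: measurable_cst.
by apply: measurable_coord; rewrite mem_head.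
Qed.

(** The Gaussian hypothesis speaks of nonzero [v] only; for [v = 0] both sides reduce to [cos u]. *)
Let dot_cos i (v : 'rV[R]_m) u :
  \int[P]_w cos (dot (X i w) v - dot (nu i) v + u) =
  cos u * expR (- ((v *m S *m v^T) 0 0 / 2)).
Proof.
have [->|v0] := eqVneq v 0.
  have d0 x : dot x 0 = 0 by rewrite /dot trmx0 mulmx0 mxE.
  under eq_Rintegral do rewrite !d0 subrr add0r.
  by rewrite Rintegral_prob_cst !mul0mx mxE mul0r oppr0 expR0 mulr1.
have s0 : 0 < Num.sqrt ((v *m S *m v^T) 0 0).
  by rewrite sqrtr_gt0; exact: (proj2 S_pos).
have mY : measurable_fun setT (fun w => dot (X i w) v).
  exact: (measurable_fun_block mX (@measurable_dot i v)).
have := Rintegral_cos_normal s0 mY (lawX i v0) 1 u.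
rewrite expr1n mul1r sqr_sqrtr// => <-.
by apply: eq_Rintegral => w _; rewrite mul1r.
Qed.

(** Induction on the list by the addition formula: the sine of the added centred term has
    expectation zero, and the exponents add. *)
Lemma Rintegral_cos_gaussian_family (s : seq I) (v : I -> 'rV[R]_m) (u : R) : uniq s ->
  \int[P]_w cos (\sum_(i <- s) (dot (X i w) (v i) - dot (nu i) (v i)) + u) =
  cos u * expR (- ((\sum_(i <- s) (v i *m S *m (v i)^T) 0 0) / 2)).
Proof.
elim: s u => [|i s IHs] u us.
  under eq_Rintegral do rewrite big_nil add0r.
  by rewrite Rintegral_prob_cst big_nil mul0r oppr0 expR0 mulr1.
have /andP[_ us'] := us.
pose A w := dot (X i w) (v i) - dot (nu i) (v i).
pose B w := \sum_(i <- s) (dot (X i w) (v i) - dot (nu i) (v i)) + u.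
have mA : measurable_fun setT (A : block X [:: i] -> R).
  by apply: measurable_funB; [exact: measurable_dot|exact: measurable_cst].
have mB : measurable_fun setT (B : block X s -> R).
  apply: measurable_funD; last exact: measurable_cst.
  have h t : {subset t <= s} -> measurable_fun setT
      ((fun w => \sum_(i <- t) (dot (X i w) (v i) - dot (nu i) (v i))) : block X s -> R).
    elim: t => [|j t IHt] ts.
      by under eq_fun do rewrite big_nil; exact: measurable_cst.
    under eq_fun do rewrite big_cons; apply: measurable_funD; last first.
      by apply: IHt => x xt; apply: ts; rewrite inE xt orbT.
    apply: measurable_funB; last exact: measurable_cst.
    rewrite /dot; under eq_fun do rewrite mxE; apply: measurable_sum => l.
    apply: measurable_funM; last exact: measurable_cst.
    by apply: measurable_coord; apply: ts; rewrite mem_head.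
  exact: h.
have mul (f g : R -> R) : continuous f -> continuous g ->
    (forall x, `|f x| <= 1) -> (forall x, `|g x| <= 1) ->
    L1 P (fun w => f (A w) * g (B w)) /\
    \int[P]_w (f (A w) * g (B w)) = (\int[P]_w f (A w)) * (\int[P]_w g (B w)).
  move=> cf cg f1 g1.
  have mf : measurable_fun setT ((fun w => f (A w)) : block X [:: i] -> R).
    by apply: measurableT_comp mA; exact: continuous_measurable_fun.
  have mg : measurable_fun setT ((fun w => g (B w)) : block X s -> R).
    by apply: measurableT_comp mB; exact: continuous_measurable_fun.
  apply: (Rintegral_block_mul mX indX (J := [:: i]) (K := s)) => //.
  - by apply: (@bounded_integrable _ _ _ _ _ 1) => //; exact: (measurable_fun_block mX mf).
  - by apply: (@bounded_integrable _ _ _ _ _ 1) => //; exact: (measurable_fun_block mX mg).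
have [Ic Ec] := mul _ _ (@continuous_cos R) (@continuous_cos R) (@cos_max R) (@cos_max R).
have [Is Es] := mul _ _ (@continuous_sin R) (@continuous_sin R) (@sin_max R) (@sin_max R).
have -> : \int[P]_w cos (\sum_(i <- i :: s) (dot (X i w) (v i) - dot (nu i) (v i)) + u) =
    \int[P]_w (cos (A w) * cos (B w) - sin (A w) * sin (B w)).
  by apply: eq_Rintegral => w _; rewrite big_cons -addrA cosD.
rewrite RintegralB// Ec Es.
have -> : \int[P]_w sin (A w) = 0.
  have := dot_cos i (v i) (- (pi / 2)); rewrite cosN cos_pihalf mul0r => <-.
  by apply: eq_Rintegral => w _; rewrite cosBpihalf.
have -> : \int[P]_w cos (A w) = expR (- ((v i *m S *m (v i)^T) 0 0 / 2)).
  have := dot_cos i (v i) 0; rewrite cos0 mul1r => <-.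
  by apply: eq_Rintegral => w _; rewrite addr0.
rewrite mul0r subr0 IHs// big_cons mulrDl opprD expRD; ring.
Qed.

End gaussian_family.

Section quadratic_form_law.
Context (R : realType) (d : measure_display) (T : measurableType d)
  (P : probability T R) (Y : nat -> T -> R) (Z : T -> R).
Hypotheses (mY : forall s, measurable_fun setT (Y s)) (mZ : measurable_fun setT Z).
Hypotheses (lawY : forall s, normal_law P (Y s) 0 1) (lawZ : normal_law P Z 0 1).
Hypothesis indYZ : mutually_independent P (joint Y Z).
Context (d0 : measure_display) (T0 : measurableType d0) (P0 : probability T0 R)
  (G : nat -> T0 -> R) (n : nat) (lam : nat -> R).
Hypothesis mG : forall s, measurable_fun setT (G s).
Hypothesis lam0 : forall s, 0 <= lam s.
Hypothesis G_cos : forall g : nat -> R,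
  \int[P0]_w cos (\sum_(s < n) g s * G s w) = expR (- (\sum_(s < n) g s ^+ 2 * lam s / 2)).

(** The Gaussian vector enters only through [G_cos], that is through its linear forms; neither a
    density nor independence of the coordinates [G s] has to be established. *)
Lemma laplace_sum_squares (t : R) : 0 <= t ->
  \int[P0]_w expR (- (t * \sum_(s < n) G s w ^+ 2)) =
  \int[P]_w expR (- (t * \sum_(s < n) lam s * Y s w ^+ 2)).
Proof.
move=> t0; pose c := Num.sqrt (2 * t).
have c2 : c ^+ 2 = 2 * t by rewrite sqr_sqrtr// mulr_ge0.
have -> : \int[P0]_w expR (- (t * \sum_(s < n) G s w ^+ 2)) =
    \int[P0]_w \int[P]_w' cos (c * \sum_(s < n) G s w * Y s w').
  apply: eq_Rintegral => w _.
  rewrite (Rintegral_cos_lin mY mZ lawY indYZ (fun s => G s w)) c2.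
  by congr expR; field.
rewrite (@Rintegral_swap _ _ T0 T R P0 P (fun z => cos (c * \sum_(s < n) G s z.1 * Y s z.2)) 1).
- apply: eq_Rintegral => w' _.
  have := G_cos (fun s => c * Y s w').
  have -> : (fun w => cos (\sum_(s < n) c * Y s w' * G s w)) =
      (fun w => cos (c * \sum_(s < n) G s w * Y s w')).
    by apply/funext => w; rewrite mulr_sumr; congr cos; apply: eq_bigr => s _; ring.
  move=> ->; congr (expR (- _)); rewrite mulr_sumr; apply: eq_bigr => s _.
  by rewrite exprMn c2; field.
- apply: measurableT_comp; first exact: (continuous_measurable_fun (@continuous_cos R)).
  apply: measurable_funM => //; apply: measurable_sum => s; apply: measurable_funM.
    by apply: measurableT_comp => //; exact: measurable_fst.
  by apply: measurableT_comp => //; exact: measurable_snd.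
- by move=> z; exact: cos_max.
Qed.

Lemma law_sum_squares (f : R -> R) (B : R) : continuous f -> (forall x, `|f x| <= B) ->
  \int[P0]_w f (\sum_(s < n) G s w ^+ 2) = \int[P]_w f (\sum_(s < n) lam s * Y s w ^+ 2).
Proof.
move=> cf fB; apply: (@laplace_law R _ T0 P0 _ T P (fun w => \sum_(s < n) G s w ^+ 2)
  (fun w => \sum_(s < n) lam s * Y s w ^+ 2) _ _ _ _ _ f B) => //.
- by apply: measurable_sum => s; exact: measurable_funX.
- apply: measurable_sum => s; apply: measurable_funM => //; exact: measurable_funX.
- by move=> w; apply: sumr_ge0 => s _; exact: sqr_ge0.
- by move=> w; apply: sumr_ge0 => s _; rewrite mulr_ge0 ?sqr_ge0.
- by move=> k; exact: laplace_sum_squares.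
Qed.

End quadratic_form_law.

Section quadratic_statistic.
Context (R : realType) (D : design R).
Hypothesis nsz0 : forall i, (0 < nsz D i)%N.
Hypothesis SigmaP : posdef_mx (Sigma D).
Hypothesis TWP : orth_proj_mx (TW D).
Hypothesis TW0 : TW D != 0.
Hypothesis TSP : orth_proj_mx (TS D).
Hypothesis TS0 : TS D != 0.
Context (lam : nat -> R).
Local Notation n := (a D * dimd D)%N.
Hypothesis lamE : char_poly (TVT D) = \prod_(s < n) ('X - (lam s)%:P).

Let n0 i : 0 < (nsz D i)%:R :> R.
Proof. by rewrite ltr0n. Qed.

Let Ntot_ge0 : 0 <= (Ntot D)%:R :> R.
Proof. exact: ler0n. Qed.

Let Sigma_ge0 (v : 'rV[R]_(dimd D)) : 0 <= (v *m Sigma D *m v^T) 0 0.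
Proof.
have [->|v0] := eqVneq v 0; first by rewrite !mul0mx mxE.
exact/ltW/(proj2 SigmaP).
Qed.

(** [z] collects the coefficients of the group means in a combination of the eigen-coordinates; its
    [VN] form is the variance of that combination and is diagonal in [g]. *)
Let spectral_var (Q : 'M[R]_n) (g : nat -> R) :
  Q *m TVT D *m Q^T = diag_mx (\row_s lam s) ->
  let z := unstack ((\row_(s < n) g s) *m Q *m Tmx D)^T in
  ((stack z)^T *m VN D *m stack z) 0 0 = \sum_(s < n) g s ^+ 2 * lam s.
Proof.
move=> QE z; rewrite unstackK trmxK !trmx_mul (tr_Tmx TWP TSP) !mulmxA.
set u := \row_(s < n) g s.
have -> : u *m Q *m Tmx D *m VN D *m Tmx D *m Q^T *m u^T = u *m (Q *m TVT D *m Q^T) *m u^T.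
  by rewrite /TVT !mulmxA.
rewrite QE mul_mx_diag mxE; apply: eq_bigr => s _; rewrite !mxE; ring.
Qed.

(** Taking [g] to be the indicator of [s] exhibits [lam s] as a value of the nonnegative form
    [VN]. *)
Lemma TVT_eigenvalue_ge0 s : (s < n)%N -> 0 <= lam s.
Proof.
move=> sn; have [Q [_ QE]] := real_spectral_theorem (tr_TVT SigmaP TWP TSP) lamE.
have := @spectral_var Q (fun t => (t == s)%:R) QE.
rewrite (bigD1 (Ordinal sn))//= eqxx expr1n mul1r big1 ?addr0; last first.
  move=> t ts; rewrite (_ : (t : nat) == s = false) ?expr0n ?mul0r//.
  by apply: contraNF ts => /eqP ts; apply/eqP/val_inj.
move=> <-; rewrite VN_stack; apply: sumr_ge0 => i _; rewrite mulr_ge0//.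
Qed.

Lemma sum_eigenvalues : \sum_(s < n) lam s = EQ0 D.
Proof.
rewrite -(trace_TVT TWP TSP).
by case: (spectral_trace (tr_TVT SigmaP TWP TSP) lamE) => ->.
Qed.

Lemma sum_sqr_eigenvalues : 2 * \sum_(s < n) lam s ^+ 2 = VarQ0 D.
Proof.
rewrite -(trace_TVT2 TWP TSP).
by case: (spectral_trace (tr_TVT SigmaP TWP TSP) lamE) => _ ->.
Qed.

Lemma sum_sqr_eigenvalues_gt0 : 0 < \sum_(s < n) lam s ^+ 2.
Proof.
have := VarQ0_gt0 nsz0 SigmaP TWP TW0 TSP TS0.
by rewrite -sum_sqr_eigenvalues pmulr_rgt0.
Qed.

Hypothesis lam_dec : forall s t, (s <= t)%N -> (t < n)%N -> lam t <= lam s.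

Local Notation be := (beta n lam).

Lemma beta_ge0 s : 0 <= be s.
Proof. by rewrite /beta; case: ifP => // sn; rewrite divr_ge0 ?sqrtr_ge0 ?TVT_eigenvalue_ge0. Qed.

Lemma beta_out s : (n <= s)%N -> be s = 0.
Proof. by rewrite /beta ltnNge => ->. Qed.

Lemma beta_norm : \sum_(s < n) be s ^+ 2 = 1.
Proof.
have s0 := sum_sqr_eigenvalues_gt0.
under eq_bigr do rewrite /beta ltn_ord exprMn exprVn sqr_sqrtr ?ltW//.
by rewrite -mulr_suml divff// gt_eqF.
Qed.

Lemma beta_le1 s : be s <= 1.
Proof.
have [sn|sn] := ltnP s n; last by rewrite beta_out.
rewrite -(@ler_pXn2r _ 2)// ?nnegrE ?beta_ge0// expr1n -beta_norm (bigD1 (Ordinal sn))//=.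
by rewrite lerDl sumr_ge0// => t _; exact: sqr_ge0.
Qed.

Lemma beta_dec s t : (s <= t)%N -> be t <= be s.
Proof.
move=> st; have [tn|tn] := ltnP t n; last by rewrite beta_out ?beta_ge0.
rewrite /beta tn (leq_ltn_trans st tn) ler_wpM2r ?invr_ge0 ?sqrtr_ge0//.
exact: lam_dec.
Qed.

Context (d0 : measure_display) (T0 : measurableType d0) (P0 : probability T0 R)
  (X : forall i : 'I_(a D), 'I_(nsz D i) -> T0 -> 'rV[R]_(dimd D)).
Hypothesis mX : forall i j, random_vector (@X i j).
Hypothesis indX : mutually_independent P0
  (fun p : {i : 'I_(a D) & 'I_(nsz D i)} => X (tagged p)).
Hypothesis lawX : forall i j, mv_normal_law P0 (@X i j) (row i (mu D)) (Sigma D).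
Hypothesis H0D : H0 D.

Lemma measurable_stack_Xbar k : measurable_fun setT (fun w => stack (Xbar X w) k 0).
Proof.
under eq_fun do rewrite !mxE; apply: measurable_funM => //.
by apply: measurable_sum => j; exact: mX.
Qed.

Lemma measurable_Wtilde : measurable_fun setT (Wtilde X).
Proof.
apply: measurable_funM => //; apply: measurable_funB => //.
apply: measurable_funM => //; under eq_fun do rewrite mxE.
apply: measurable_sum => k; apply: measurable_funM; last exact: measurable_stack_Xbar.
under eq_fun do rewrite mxE; apply: measurable_sum => l; apply: measurable_funM => //.
by under eq_fun do rewrite mxE; exact: measurable_stack_Xbar.
Qed.

Let dot_row (u : 'rV[R]_n) w :
  (u *m stack (Xbar X w)) 0 0 = \sum_i \sum_(j < nsz D i)
    (nsz D i)%:R^-1 * (X j w *m (row i (unstack u^T))^T) 0 0.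
Proof.
have uE : u = (stack (unstack u^T))^T by rewrite unstackK trmxK.
rewrite {1}uE dot_stack; apply: eq_bigr => i _.
rewrite mxE; under eq_bigr do rewrite [X in _ * X]mxE [X in _ * X]mxE [X in _ * X]mxE mulr_sumr mulr_sumr.
rewrite exchange_big/=; apply: eq_bigr => j _; rewrite mxE mulr_sumr.
by apply: eq_bigr => l _; rewrite [X in _ = _ * (_ * X)]mxE; ring.
Qed.

Let dot_mean (u : 'rV[R]_n) :
  (u *m stack (mu D)) 0 0 = \sum_i \sum_(j < nsz D i)
    (nsz D i)%:R^-1 * (row i (mu D) *m (row i (unstack u^T))^T) 0 0.
Proof.
have uE : u = (stack (unstack u^T))^T by rewrite unstackK trmxK.
rewrite {1}uE dot_stack; apply: eq_bigr => i _.
rewrite sumr_const card_ord -mulrnAl -mulr_natr mulVf ?mul1r ?gt_eqF//.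
transitivity ((row i (mu D) *m (row i (unstack u^T))^T)^T 0 0); last by rewrite mxE.
by rewrite trmx_mul trmxK.
Qed.

Lemma cos_projected_mean (Q : 'M[R]_n) (g : nat -> R) :
  Q *m TVT D *m Q^T = diag_mx (\row_s lam s) ->
  \int[P0]_w cos (Num.sqrt (Ntot D)%:R *
      ((\row_(s < n) g s) *m Q *m Tmx D *m stack (Xbar X w)) 0 0) =
  expR (- (\sum_(s < n) g s ^+ 2 * lam s / 2)).
Proof.
move=> QE; set u := _ *m Q *m Tmx D; pose z := unstack u^T.
(* Each of the [nsz D i] observations of group [i] contributes the squared coefficient
   [Ntot D / nsz D i ^ 2], in total the weight [Ntot D / nsz D i] of [VN]. *)
pose v (p : {i : 'I_(a D) & 'I_(nsz D i)}) : 'rV[R]_(dimd D) :=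
  (Num.sqrt (Ntot D)%:R / (nsz D (tag p))%:R) *: row (tag p) z.
(* The null hypothesis enters here: the linear form ends with [Tmx], so its mean vanishes and the
   observations may be centred. *)
have umu : u *m stack (mu D) = 0 by rewrite /u -mulmxA H0D mulmx0.
have E w : Num.sqrt (Ntot D)%:R * (u *m stack (Xbar X w)) 0 0 =
    \sum_(p <- index_enum _) ((X (tagged p) w *m (v p)^T) 0 0 -
       (row (tag p) (mu D) *m (v p)^T) 0 0) + 0.
  have -> : (u *m stack (Xbar X w)) 0 0 =
      (u *m stack (Xbar X w)) 0 0 - (u *m stack (mu D)) 0 0.
    by rewrite umu [X in _ - X]mxE subr0.
  rewrite addr0 dot_row dot_mean -sumrB mulr_sumr.
  under eq_bigr do rewrite -sumrB mulr_sumr.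
  rewrite sig_big_dep/=; apply: eq_bigr => p _.
  by rewrite /v [(_ *: _)^T]linearZ/= -!scalemxAr [X in _ = X - _]mxE [X in _ = _ - X]mxE; ring.
under eq_Rintegral do rewrite E.
rewrite (Rintegral_cos_gaussian_family (nu := fun p => row (tag p) (mu D))
  (fun p => @mX (tag p) (tagged p)) indX (fun p => @lawX (tag p) (tagged p)) SigmaP v 0).
  rewrite cos0 mul1r; congr (expR (- _)); rewrite -[RHS]mulr_suml; congr (_ / _).
  have := spectral_var g QE; rewrite /= -/u -/z => <-; rewrite VN_stack.
  have sum_tag (F : {i : 'I_(a D) & 'I_(nsz D i)} -> R) :
      \sum_(p <- index_enum _) F p = \sum_i \sum_(j < nsz D i) F (Tagged _ j).
    by rewrite sig_big_dep/=; apply: eq_bigr => -[].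
  rewrite sum_tag.
  apply: eq_bigr => i _; rewrite /v/= sumr_const card_ord -[LHS]mulr_natl.
  rewrite [(_ *: _)^T]linearZ/= -!scalemxAl -scalemxAr scalerA [X in _ * X]mxE mulrA; congr (_ * _).
  rewrite -[X in _ = X / _](sqr_sqrtr Ntot_ge0); field.
  by rewrite gt_eqF.
exact: index_enum_uniq.
Qed.

Context (d : measure_display) (T : measurableType d)
  (P : probability T R) (Y : nat -> T -> R) (Z : T -> R).
Hypotheses (mY : forall s, measurable_fun setT (Y s)) (mZ : measurable_fun setT Z).
Hypotheses (lawY : forall s, normal_law P (Y s) 0 1) (lawZ : normal_law P Z 0 1).
Hypothesis indYZ : mutually_independent P (joint Y Z).

(** Since [Tmx] is an orthogonal projection and [Q] an orthogonal matrix, [QN] is [Ntot D] times the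
    squared norm of [Q *m Tmx D] applied to the means, hence a sum of squares of centred Gaussian
    coordinates with variances [lam s]. *)
Lemma law_QN (f : R -> R) (B : R) : continuous f -> (forall x, `|f x| <= B) ->
  \int[P0]_w f (QN X w) = \int[P]_w f (\sum_(s < n) lam s * Y s w ^+ 2).
Proof.
move=> cf fB.
have [Q [QQ QE]] := real_spectral_theorem (tr_TVT SigmaP TWP TSP) lamE.
pose V w := Q *m Tmx D *m stack (Xbar X w).
(* The coordinates are extended by zero from ['I_n] to all natural indices. *)
pose G (s : nat) w := if insub s is Some i then Num.sqrt (Ntot D)%:R * V w i 0 else 0.
have GE (s : 'I_n) w : G s w = Num.sqrt (Ntot D)%:R * V w s 0 by rewrite /G valK.
(* Beyond [n] the values of [lam] are arbitrary; replacing them by zero makes the variances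
   nonnegative everywhere. *)
pose la s := if (s < n)%N then lam s else 0.
have laE (s : 'I_n) : la s = lam s by rewrite /la ltn_ord.
have QNE w : QN X w = \sum_(s < n) G s w ^+ 2.
  rewrite /QN; have -> : (stack (Xbar X w))^T *m Tmx D *m stack (Xbar X w) = (V w)^T *m V w.
    rewrite /V !trmx_mul (tr_Tmx TWP TSP) !mulmxA -(mulmxA _ Q^T) (mulmx1C QQ) mulmx1.
    by rewrite -(mulmxA _ (Tmx D) (Tmx D)) (mul_Tmx TWP TSP).
  rewrite mxE mulr_sumr; apply: eq_bigr => s _.
  by rewrite GE exprMn sqr_sqrtr// mxE expr2.
under eq_Rintegral do rewrite QNE.
under [RHS]eq_Rintegral do under eq_bigr do rewrite -laE.
apply: (law_sum_squares mY mZ lawY indYZ _ _ _ cf fB).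
- move=> s; rewrite /G; case: insubP => [i _ _|_]; last exact: measurable_cst.
  apply: measurable_funM => //; rewrite /V; under eq_fun do rewrite mxE.
  by apply: measurable_sum => k; apply: measurable_funM => //; exact: measurable_stack_Xbar.
- by move=> s; rewrite /la; case: ifP => // sn; exact: TVT_eigenvalue_ge0.
- move=> g; under [in RHS]eq_bigr do rewrite laE.
  rewrite -(cos_projected_mean g QE); congr (Rintegral _ _ _).
  apply/funext => w; congr cos.
  rewrite -!mulmxA mxE mulr_sumr; apply: eq_bigr => s _.
  by rewrite GE /V mulmxA [in RHS]mxE; ring.
Qed.

(** Centring subtracts the sum of the eigenvalues, and [Num.sqrt (2 * sum)] factors into the
    normalisation of [beta] and that of [xi]. *)
Lemma law_Wtilde (f : R -> R) (B : R) : continuous f -> (forall x, `|f x| <= B) ->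
  \int[P0]_w f (Wtilde X w) = \int[P]_w f (xsum Y be n w).
Proof.
move=> cf fB; pose g x := f ((x - EQ0 D) / Num.sqrt (VarQ0 D)).
have cg : continuous g.
  move=> x; apply: continuous_comp; last exact: cf.
  by apply: cvgM; [apply: cvgB => //; exact: cvg_cst|exact: cvg_cst].
rewrite (law_QN cg (fun x => fB _)).
apply: eq_Rintegral => w _; congr f.
have s0 := sum_sqr_eigenvalues_gt0.
rewrite -sum_eigenvalues -sum_sqr_eigenvalues -sumrB mulr_suml /xsum.
rewrite sqrtrM//; apply: eq_bigr => s _; rewrite /beta ltn_ord /xi.
field.
by rewrite !gt_eqF// sqrtr_gt0.
Qed.

End quadratic_statistic.

(** * Transfer to weighted sums on the limit space, and both limit statements *)

Theorem theorem1 (R : realType) (D : nat -> design R)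
  (* the model: observations on a probability space for each index k *)
  (dsp : measure_display) (Omega : nat -> measurableType dsp)
  (P : forall k, probability (Omega k) R)
  (X : forall k (i : 'I_(a (D k))), 'I_(nsz (D k) i) -> Omega k -> 'rV[R]_(dimd (D k)))
  (* sorted eigenvalues of T V_N T, 0-based *)
  (lam : nat -> nat -> R)
  (* limit objects *)
  (dsp' : measure_display) (Omega' : measurableType dsp')
  (P' : probability Omega' R) (Y : nat -> Omega' -> R) (Z : Omega' -> R) :
  (* structural assumptions *)
  (forall k (i : 'I_(a (D k))), (0 < nsz (D k) i)%N) ->
  (forall k, posdef_mx (Sigma (D k))) ->
  (forall k, orth_proj_mx (TW (D k)) /\ TW (D k) != 0) ->
  (forall k, orth_proj_mx (TS (D k)) /\ TS (D k) != 0) ->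
  (* the asymptotic frameworks (I)-(V) *)
  (([/\ nat_diverges (fun k => a (D k)), nat_bounded (fun k => dimd (D k))
          & nat_bounded (fun k => nmax (D k))]) \/
      ([/\ nat_diverges (fun k => a (D k)), nat_diverges (fun k => dimd (D k))
          & nat_bounded (fun k => nmax (D k))]) \/
      ([/\ nat_diverges (fun k => a (D k)), nat_bounded (fun k => dimd (D k))
          & nat_diverges (fun k => nmax (D k))]) \/
      ([/\ nat_bounded (fun k => a (D k)), nat_diverges (fun k => dimd (D k))
          & nat_diverges (fun k => nmax (D k))]) \/
      ([/\ nat_diverges (fun k => a (D k)), nat_diverges (fun k => dimd (D k))
          & nat_diverges (fun k => nmax (D k))])) ->
  (* the Gaussian model *)
  (forall k i j, random_vector (@X k i j)) ->
  (forall k, mutually_independent (P k)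
      (fun p : {i : 'I_(a (D k)) & 'I_(nsz (D k) i)} => X k (tag p) (tagged p))) ->
  (forall k i j, mv_normal_law (P k) (@X k i j) (row i (mu (D k))) (Sigma (D k))) ->
  (* the null hypothesis *)
  (forall k, H0 (D k)) ->
  (* lam k are the eigenvalues of T V_N T, with multiplicity, non-increasing *)
  (forall k, char_poly (TVT (D k)) =
             \prod_(s < a (D k) * dimd (D k)) ('X - (lam k s)%:P)) ->
  (forall k s t, (s <= t)%N -> (t < a (D k) * dimd (D k))%N -> lam k t <= lam k s) ->
  (* C_s = Y_s^2 with Y_s i.i.d. N(0,1), Z ~ N(0,1), all independent *)
  (forall s, measurable_fun setT (Y s)) -> measurable_fun setT Z ->
  (forall s, normal_law P' (Y s) 0 1) -> normal_law P' Z 0 1 ->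
  mutually_independent P'
    (fun o : option nat => fun w => (match o with
                                      | None => Z w
                                      | Some s => Y s w end)%:M : 'rV[R]_1) ->
  (* (a) *)
  (forall (b : nat -> R) (r : nat),
     (forall s t, (s <= t)%N -> b t <= b s) ->
     (forall s, 0 <= b s <= 1) ->
     (forall s, b s != 0 <-> (s < r)%N) ->
     \sum_(s < r) b s ^+ 2 <= 1 ->
     (cvg_in_distribution P
        (fun k => Wtilde (@X k)) P'
        (fun w => \sum_(s < r) b s * (Y s w ^+ 2 - 1) / Num.sqrt 2
                  + Num.sqrt (1 - \sum_(s < r) b s ^+ 2) * Z w)
      <-> (forall s, (fun k => beta (a (D k) * dimd (D k)) (lam k) s) @ \oo --> b s)))
  /\
  (* (b) *)
  (forall b : nat -> R,
     (forall s t, (s <= t)%N -> b t <= b s) ->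
     (forall s, 0 < b s < 1) ->
     (fun n => \sum_(s < n) b s ^+ 2) @ \oo --> (1 : R) ->
     (forall s, (fun k => beta (a (D k) * dimd (D k)) (lam k) s) @ \oo --> b s) ->
     cvg_in_distribution P (fun k => Wtilde (@X k)) P'
       (fun w => lim ((fun n => \sum_(s < n) b s * (Y s w ^+ 2 - 1) / Num.sqrt 2)
                       @ \oo))).
Proof.
move=> nsz0 SP TWP TSP _ mX indX lawX H0D lamE lam_dec mY mZ lawY lawZ indYZ.
pose n k := (a (D k) * dimd (D k))%N.
pose be k := beta (n k) (lam k).
have be_ge0 k s : 0 <= be k s.
  exact: (beta_ge0 (SP k) (proj1 (TWP k)) (proj1 (TSP k)) (lamE k)).
have be_out k s : (n k <= s)%N -> be k s = 0 by exact: beta_out.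
have be_norm k : \sum_(s < n k) be k s ^+ 2 = 1.
  exact: (beta_norm (nsz0 k) (SP k) (proj1 (TWP k)) (proj2 (TWP k)) (proj1 (TSP k))
    (proj2 (TSP k)) (lamE k)).
have be01 k s : 0 <= be k s <= 1.
  rewrite be_ge0; exact: (beta_le1 (nsz0 k) (SP k) (proj1 (TWP k)) (proj2 (TWP k))
    (proj1 (TSP k)) (proj2 (TSP k)) (lamE k)).
have be_dec k s t : (s <= t)%N -> be k t <= be k s.
  exact: (beta_dec (SP k) (proj1 (TWP k)) (proj1 (TSP k)) (lamE k) (@lam_dec k)).
(* From here on the observations are gone: every expectation is that of a weighted sum on the space
   of [Y] and [Z]. *)
have lawW k (f : R -> R) B : continuous f -> (forall x, `|f x| <= B) ->
    ('E_(P k)[f \o Wtilde (@X k)] = (\int[P']_w f (xsum Y (be k) (n k) w))%:E)%E.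
  move=> cf fB; rewrite expectation_Rintegral; last first.
    exact: (integrable_bounded_comp (P k) (measurable_Wtilde (mX k)) cf fB).
  congr (_%:E); exact: (law_Wtilde (nsz0 k) (SP k) (proj1 (TWP k)) (proj2 (TWP k))
    (proj1 (TSP k)) (proj2 (TSP k)) (lamE k) (mX k) (indX k) (lawX k) (H0D k)
    mY mZ lawY indYZ cf fB).
(* Passes between extended-real expectations in the statement and real integrals in the limit
   theorems. *)
have lawL (L : Omega' -> R) : measurable_fun setT L ->
    cvg_in_distribution P (fun k => Wtilde (@X k)) P' L <->
    (forall (f : R -> R) (B : R), continuous f -> (forall x, `|f x| <= B) ->
     \int[P']_w f (xsum Y (be k) (n k) w) @[k --> \oo] --> \int[P']_w f (L w)).
  move=> mL.
  have EL (f : R -> R) B : continuous f -> (forall x, `|f x| <= B) ->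
      ('E_P'[f \o L] = (\int[P']_w f (L w))%:E)%E.
    by move=> cf fB; rewrite expectation_Rintegral//; exact: (integrable_bounded_comp P' mL cf fB).
  split=> [cvgW f B cf fB|cvgf f cf [B fB]].
    have := cvgW f cf (ex_intro _ B fB); rewrite (EL f B)//.
    by under eq_fun do rewrite (lawW _ f B)//; exact: fine_cvg.
  rewrite (EL f B)//; under eq_fun do rewrite (lawW _ f B)//.
  by apply: cvg_EFin; [exact: nearW|exact: cvgf].
split=> [b r b_dec b01 br b1|b b_dec b01 b1 be_cvg].
  have b_out s : (r <= s)%N -> b s = 0.
    by move=> rs; apply/eqP; apply: contraT => /br; rewrite ltnNge rs.
  have -> : (fun w => \sum_(s < r) b s * (Y s w ^+ 2 - 1) / Num.sqrt 2
      + Num.sqrt (1 - \sum_(s < r) b s ^+ 2) * Z w) =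
    (fun w => xsum Y b r w + Num.sqrt (1 - \sum_(s < r) b s ^+ 2) * Z w).
    by apply/funext => w; congr (_ + _); apply: eq_bigr => s _; rewrite /xi mulrA.
  rewrite lawL; last first.
    by apply: measurable_funD; [exact: (measurable_xsum mY mZ)|exact: measurable_funM].
  split=> [law|be_cvg].
    exact: (points_of_law_limit mY mZ lawY lawZ indYZ be01 be_dec be_out be_norm
      b01 b_dec b_out b1 law).
  move=> f B cf fB.
  exact: (law_limit_mixture mY mZ lawY lawZ indYZ be01 be_dec be_out be_norm be_cvg
    b_out b1 cf fB).
have sum_le1 m : \sum_(s < m) b s ^+ 2 <= 1.
  rewrite -(cvg_lim (@Rhausdorff R) b1).
  apply: (nondecreasing_cvgn_le (u_ := fun m => \sum_(s < m) b s ^+ 2)); last first.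
    by apply/cvg_ex; exists 1.
  apply/nondecreasing_seqP => p; rewrite big_ord_recr/= lerDl; exact: sqr_ge0.
pose tau m := 1 - \sum_(s < m) b s ^+ 2.
(* Partial sums increase to one, so each block of squares after [m] is at most what is missing at
   [m]. *)
have tail_b m k : \sum_(i < k) b (m + i)%N ^+ 2 <= tau m.
  by have := sum_le1 (m + k)%N; rewrite big_split_ord/= /tau; lra.
have tau0 : tau m @[m --> \oo] --> (0 : R).
  by rewrite -[X in _ --> X](subrr 1); apply: cvgB => //; exact: cvg_cst.
have b_cvg0 : b s @[s --> \oo] --> (0 : R).
  apply/cvgrPdist_le => e e0; have e20 : 0 < e ^+ 2 by rewrite exprn_gt0.
  have /cvgrPdist_le/(_ _ e20) := tau0; apply: filterS => m.
  have /andP[bm0 _] := b01 m; rewrite !sub0r !normrN (ger0_norm (ltW bm0)).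
  move=> /(le_trans (ler_norm _)) h; rewrite -(@ler_pXn2r _ 2)// ?nnegrE ?(ltW bm0) ?(ltW e0)//.
  (* A block of length one: [b m ^+ 2 <= tau m]. *)
  by apply: le_trans h; have := tail_b m 1%N; rewrite big_ord1 addn0.
have -> : (fun w => lim ((fun n => \sum_(s < n) b s * (Y s w ^+ 2 - 1) / Num.sqrt 2) @ \oo)) =
    (fun w => lim (xsum Y b m w @[m --> \oo])).
  apply/funext => w; rewrite (_ : (fun n => _) = (fun m => xsum Y b m w))//; apply/funext => m.
  by apply: eq_bigr => s _; rewrite /xi mulrA.
have mL := measurable_xsum_lim mY mZ b.
apply/lawL => // f B cf fB.
apply: (law_limit_series mY mZ lawY indYZ be01 be_dec be_out be_norm be_cvg mL _ b_cvg0 b1 cf fB).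
exact: (xsum_ae_cvg mY mZ lawY indYZ tail_b tau0).
Qed.
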